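(* Spheres are stationary points of the total variation of the normal $$|n|_{TV(\Gamma)} = \int_\Gamma \bigl(|(D_\Gamma n)\,\xi_1|^2 + |(D_\Gamma n)\,\xi_2|^2\bigr)^{1/2}\, ds = \int_\Gamma \bigl(k_1^2+k_2^2\bigr)^{1/2}\, ds$$ among all surfaces $\Gamma$ of constant area. That is: for every sphere $\Gamma = \partial\Omega\subset\mathbb{R}^3$ (boundary of a ball $\Omega$), with $A_0$ denoting the area of this sphere, there exists a Lagrange multiplier $\mu \in \mathbb{R}$ such that for every smooth vector field $V$ $$\frac{d}{d\varepsilon}\Big|_{\varepsilon = 0^+} \left[ |n_\varepsilon|_{TV(\Gamma_\varepsilon)} + \mu\left(\int_{\Gamma_\varepsilon} 1\, ds_\varepsilon - A_0\right)\right] = 0 .$$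
   Context: Surfaces $\Gamma$ are boundaries of bounded domains $\Omega\subset\mathbb{R}^3$; each $\Gamma$ is a smooth, compact, orientable two-dimensional manifold without boundary embedded in $\mathbb{R}^3$. $n$ is the outer unit normal field, viewed as a map $\Gamma \to S^2$, and $D_\Gamma n$ is its derivative, mapping $T_s\Gamma$ to $T_{n(s)}S^2 \cong T_s\Gamma$. $\{\xi_1(s),\xi_2(s)\}$ is any orthonormal basis of $T_s\Gamma$ (the integrand does not depend on the choice), and $|\cdot|$ is the Euclidean norm. $k_1,k_2$ are the principal curvatures, i.e. the eigenvalues of $D_\Gamma n$ on $T_s\Gamma$ (so $k_1=k_2=1/r$ on a sphere of radius $r$). Perturbations: let $V:\mathcal{D}\to\mathbb{R}^3$ be a smooth vector field with compact support in an open hold-all $\mathcal{D}\supset\overline{\Omega}$, let $T_\varepsilon(x) = x+\varepsilon V(x)$, $\Omega_\varepsilon = T_\varepsilon(\Omega)$, $\Gamma_\varepsilon = T_\varepsilon(\Gamma)$ for small $\varepsilon\ge 0$, and let $n_\varepsilon$ be the outer unit normal field of $\Gamma_\varepsilon$. *)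

(* Defs.v *)
From HB Require Import structures.
From mathcomp Require Import all_boot all_order all_algebra.
From mathcomp Require Import all_classical all_reals all_analysis.

Set Implicit Arguments.
Unset Strict Implicit.
Unset Printing Implicit Defensive.

Import Order.TTheory GRing.Theory Num.Theory.
Import numFieldNormedType.Exports.

Local Open Scope classical_set_scope.
Local Open Scope ring_scope.

Section EuclideanSpace.
Context {R : realType}.
Implicit Types (u v : 'rV[R]_3) (W A : set 'rV[R]_3).

(* The library norm on 'rV[R]_3 is the max norm, which induces the same
   topology and the same derivatives as the Euclidean norm enorm. *)
Definition dot u v : R := \sum_i u 0 i * v 0 i.
Definition enorm u : R := Num.sqrt (dot u u).
Definition gram u v : R := dot u u * dot v v - dot u v ^+ 2.

Definition eball (c : 'rV[R]_3) (r : R) : set 'rV[R]_3 :=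
  [set x | enorm (x - c) < r].

Definition frontier A : set 'rV[R]_3 := closure A `\` A°.

Definition is_span W u v : Prop := W = [set a *: u + b *: v | a in setT & b in setT].

(* 0 < gram u v is linear independence (equality case of Cauchy-Schwarz). *)
Definition is_basis W u v : Prop := 0 < gram u v /\ is_span W u v.

Definition is_orthonormal_basis W u v : Prop :=
  [/\ dot u u = 1, dot v v = 1, dot u v = 0 & is_span W u v].

Definition borel3 : measurableType _ :=
  g_sigma_algebraType (@open 'rV[R]_3).

End EuclideanSpace.
Arguments borel3 R : clear implicits.

Section Smoothness.
Context {R : realType} {E F : normedModType R}.

Definition iter_derive (vs : seq E) (f : E -> F) : E -> F :=
  foldr (fun v g => 'D_v g) f vs.

(* C^oo on the open set U: differentiability of all iterated directional
   derivatives entails their continuity. *)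
Definition smooth_on (U : set E) (f : E -> F) : Prop :=
  forall (vs : seq E) (x : E), U x -> differentiable (iter_derive vs f) x.

End Smoothness.

Section Surfaces.
Context {R : realType}.
Implicit Types (G Om : set 'rV[R]_3) (X : R * R -> 'rV[R]_3) (s x : 'rV[R]_3).

(* EG - F^2, whose square root is |X_u x X_v|. *)
Definition area_element X (p : R * R) : R :=
  Num.sqrt (gram ('D_((1, 0) : R * R) X p) ('D_((0, 1) : R * R) X p)).

(* The last clause says that X is open as a map U -> G, so that it is a
   homeomorphism of U onto a relatively open subset of G. *)
Definition local_param G (U : set (R * R)) X : Prop :=
  [/\ open U, smooth_on U X, {in U &, injective X},
      (forall p, U p -> 0 < area_element X p)
    & forall W, open W -> W `<=` U ->
        exists2 O, open O & X @` W = G `&` O].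

Definition closed_surface G : Prop :=
  compact G /\
  forall s, G s -> exists U X, local_param G U X /\ (X @` U) s.

(* The surface measure ds of G: the Borel measure carried by G which is
   sqrt(EG - F^2) du dv in every local parametrization. These requirements
   determine sigma when G is a closed surface, as countably many
   parametrized pieces cover G. *)
Definition is_surface_measure G
    (sigma : {measure set borel3 R -> \bar R}) : Prop :=
  sigma (~` G) = 0%E /\
  forall U X (A : set (borel3 R)), local_param G U X ->
    measurable A -> A `<=` X @` U ->
    sigma A = (\int[(@lebesgue_measure R \x @lebesgue_measure R)%E]_(p in
                 U `&` X @^-1` A) (area_element X p)%:E)%E.

(* Differentiability of gamma at 0 only is required; on a smooth surface this
   yields the same tangent vectors as smooth curves do. *)
Definition curve_at G s (gamma : R -> 'rV[R]_3) (xi : 'rV[R]_3) : Prop :=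
  [/\ forall t, G (gamma t), gamma 0 = s & is_derive (0 : R) (1 : R) gamma xi].

Definition tangent_space G s : set 'rV[R]_3 :=
  [set xi | exists gamma, curve_at G s gamma xi].

(* (D_G f)(s) xi is the velocity of f o gamma, for every curve gamma in G
   through s with velocity xi. *)
Definition surface_derive G (f : 'rV[R]_3 -> 'rV[R]_3) s (xi : 'rV[R]_3) :
    'rV[R]_3 :=
  xget 0 [set w | forall gamma, curve_at G s gamma xi ->
                    is_derive (0 : R) (1 : R) (f \o gamma) w].

Definition is_outer_normal Om G s (nu : 'rV[R]_3) : Prop :=
  [/\ enorm nu = 1,
      (forall xi, tangent_space G s xi -> dot nu xi = 0)
    & exists2 d : R, 0 < d &
        forall t, 0 < t < d -> Om (s - t *: nu) /\ ~ Om (s + t *: nu)].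

Definition outer_normal Om G s : 'rV[R]_3 :=
  xget 0 [set nu | is_outer_normal Om G s nu].

Definition Dnormal Om G s : 'rV[R]_3 -> 'rV[R]_3 :=
  surface_derive G (outer_normal Om G) s.

(* Some orthonormal basis of T_s G; tv_density does not depend on the choice. *)
Definition tangent_frame G s : 'rV[R]_3 * 'rV[R]_3 :=
  xget (0, 0) [set b | is_orthonormal_basis (tangent_space G s) b.1 b.2].

Definition tv_density Om G s : R :=
  let xi := tangent_frame G s in
  Num.sqrt (enorm (Dnormal Om G s xi.1) ^+ 2 + enorm (Dnormal Om G s xi.2) ^+ 2).

(* The eigenvalues of D_G n on T_s G, with multiplicity, in either order. *)
Definition principal_curvatures Om G s : R * R :=
  xget (0, 0) [set k | exists e1 e2, [/\ is_basis (tangent_space G s) e1 e2,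
    Dnormal Om G s e1 = k.1 *: e1 & Dnormal Om G s e2 = k.2 *: e2]].

Definition curvature_density Om G s : R :=
  let k := principal_curvatures Om G s in Num.sqrt (k.1 ^+ 2 + k.2 ^+ 2).

Definition surface_integral (sigma : {measure set borel3 R -> \bar R}) G
    (f : 'rV[R]_3 -> R) : R :=
  Rintegral sigma (G : set (borel3 R)) f.

Definition normal_TV sigma Om G : R :=
  surface_integral sigma G (tv_density Om G).

Definition normal_TV_curv sigma Om G : R :=
  surface_integral sigma G (curvature_density Om G).

Definition area sigma G : R := surface_integral sigma G (fun=> 1).

Definition perturb (V : 'rV[R]_3 -> 'rV[R]_3) (e : R) x : 'rV[R]_3 :=
  x + e *: V x.

(* Elements of C_c^oo(D, R^3), extended by 0 outside of D. *)
Definition test_field (D : set 'rV[R]_3) (V : 'rV[R]_3 -> 'rV[R]_3) : Prop :=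
  let supp := closure [set x | V x != 0] in
  [/\ smooth_on setT V, compact supp & supp `<=` D].

End Surfaces.

(* Main.v *)
(* Pulled back to the sphere S by T_e, the total variation of the normal and the
   area become integrals over S of algebraic expressions in the first two
   derivatives of V: if nu is the cofactor matrix of D T_e applied to y = s - c,
   then nu / |nu| is the outer normal of T_e(S) and |nu| / r is the area
   Jacobian. Expanding to first order in e, uniformly on S, with
   mu = - sqrt 2 / (2 r), the derivative of the Lagrangian at e = 0 is the
   integral over S of
     mu (3 div_S V - 2 div V + y . (D^2 V(a1, a1) + D^2 V(a2, a2)))
       = mu / r^2 (L_0 psi_0 + L_1 psi_1 + L_2 psi_2),
   where (a1, a2) is an orthonormal tangent frame, L_k is the derivative along
   the rotation field e_k x y and psi_k = y . L_k V. Each L_k psi_k has integral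
   0 because the surface measure is invariant under rotations about c. *)

Require Import Defs.
From HB Require Import structures.
From mathcomp Require Import all_boot all_order all_algebra.
From mathcomp Require Import all_classical all_reals all_analysis.
From mathcomp Require Import measurable_realfun.
From mathcomp Require Import ring lra.
Import Order.TTheory GRing.Theory Num.Theory.
Import numFieldNormedType.Exports.
Local Open Scope classical_set_scope.
Local Open Scope ring_scope.

(** * Vectors and cross products *)

(** The measures [sigma G] are known only through charts, and the normal, its derivative and the
    curvatures are selected by [xget]. Each quantity on a perturbed surface must therefore first be
    identified with a formula on the fixed sphere. This needs [perturb V e] to be a global
    diffeomorphism for small [e], obtained by a contraction argument, with positive Jacobian
    determinant: the sign decides which of the two unit normals points outwards. The integrand
    (k_1^2 + k_2^2)^(1/2) is not differentiable at a flat point, but at e = 0 it is the positive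
    constant sqrt 2 / r, so the square root can be expanded there. All remainders are O(e^2) with
    one constant for the whole sphere, whose measure is finite; the expansion can thus be integrated
    term by term. [V] is not split into normal and tangential components. Invariance under rotations
    replaces integration by parts on the sphere, and it is an instance of the same change of
    variables that pulls the integrals back: a rotation maps the sphere to itself with area Jacobian
    1. *)

Definition i0 : 'I_3 := @Ordinal 3 0 isT.
Definition i1 : 'I_3 := @Ordinal 3 1 isT.
Definition i2 : 'I_3 := @Ordinal 3 2 isT.

Lemma ord3P (P : 'I_3 -> Prop) : P i0 -> P i1 -> P i2 -> forall i, P i.
Proof.
move=> P0 P1 P2 [[|[|[|//]]] lti].
- by rewrite (_ : Ordinal _ = i0)//; exact: val_inj.
- by rewrite (_ : Ordinal _ = i1)//; exact: val_inj.
- by rewrite (_ : Ordinal _ = i2)//; exact: val_inj.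
Qed.

Lemma sum3E (V : nmodType) (F : 'I_3 -> V) : \sum_i F i = F i0 + F i1 + F i2.
Proof.
rewrite !big_ord_recl big_ord0 addr0 addrA.
by congr (F _ + F _ + F _); exact: val_inj.
Qed.

Section Vectors3.
Context {R : realType}.
Implicit Types (u v w x y p : 'rV[R]_3).

Lemma rV3P u v :
  u 0 i0 = v 0 i0 -> u 0 i1 = v 0 i1 -> u 0 i2 = v 0 i2 -> u = v.
Proof. by move=> h0 h1 h2; apply/rowP; apply: ord3P. Qed.

Definition mk3 (a b c : R) : 'rV[R]_3 :=
  \row_i (if i == i0 then a else if i == i1 then b else c).

Lemma mk30 (a b c : R) : mk3 a b c 0 i0 = a. Proof. by rewrite mxE. Qed.
Lemma mk31 (a b c : R) : mk3 a b c 0 i1 = b. Proof. by rewrite mxE. Qed.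
Lemma mk32 (a b c : R) : mk3 a b c 0 i2 = c. Proof. by rewrite mxE. Qed.
Definition mk3E := (mk30, mk31, mk32).

Definition e_ (i : 'I_3) : 'rV[R]_3 := delta_mx 0 i.

Lemma e_E i j : e_ i 0 j = (j == i)%:R.
Proof. by rewrite mxE eqxx. Qed.

Lemma row3_sum u : u = u 0 i0 *: e_ i0 + u 0 i1 *: e_ i1 + u 0 i2 *: e_ i2.
Proof. by rewrite {1}(row_sum_delta u) sum3E. Qed.

Lemma dotE u v : dot u v = u 0 i0 * v 0 i0 + u 0 i1 * v 0 i1 + u 0 i2 * v 0 i2.
Proof. by rewrite /dot sum3E. Qed.

Lemma dotC u v : dot u v = dot v u.
Proof. by rewrite !dotE; ring. Qed.

Lemma dotDl u v w : dot (u + v) w = dot u w + dot v w.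
Proof. by rewrite !dotE !mxE; ring. Qed.

Lemma dotDr u v w : dot w (u + v) = dot w u + dot w v.
Proof. by rewrite !dotE !mxE; ring. Qed.

Lemma dotZl k u w : dot (k *: u) w = k * dot u w.
Proof. by rewrite !dotE !mxE; ring. Qed.

Lemma dotZr k u w : dot w (k *: u) = k * dot w u.
Proof. by rewrite !dotE !mxE; ring. Qed.

Lemma dotNl u w : dot (- u) w = - dot u w.
Proof. by rewrite !dotE !mxE; ring. Qed.

Lemma dotNr u w : dot w (- u) = - dot w u.
Proof. by rewrite !dotE !mxE; ring. Qed.

Lemma dotBl u v w : dot (u - v) w = dot u w - dot v w.
Proof. by rewrite dotDl dotNl. Qed.

Lemma dotBr u v w : dot w (u - v) = dot w u - dot w v.
Proof. by rewrite dotDr dotNr. Qed.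

Lemma dot0l w : dot 0 w = 0.
Proof. by rewrite !dotE !mxE; ring. Qed.

Lemma dot0r w : dot w 0 = 0.
Proof. by rewrite dotC dot0l. Qed.

Definition dotLE := (dotDl, dotDr, dotNl, dotNr, dotZl, dotZr, dot0l, dot0r).

Lemma dot_ge0 u : 0 <= dot u u.
Proof. by rewrite dotE !addr_ge0// -expr2 sqr_ge0. Qed.

Lemma dot_eq0 u : dot u u = 0 -> u = 0.
Proof.
rewrite dotE -!expr2 => h.
have := sqr_ge0 (u 0 i0); have := sqr_ge0 (u 0 i1); have := sqr_ge0 (u 0 i2).
move=> h2 h1 h0; apply: rV3P; rewrite mxE; apply/eqP; rewrite -sqrf_eq0; apply/eqP; lra.
Qed.

Lemma dot_gt0 u : (0 < dot u u) = (u != 0).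
Proof.
rewrite lt_def dot_ge0 andbT; congr (~~ _); apply/eqP/eqP => [|->]; first exact: dot_eq0.
by rewrite dot0l.
Qed.

Lemma enorm_ge0 u : 0 <= enorm u. Proof. exact: sqrtr_ge0. Qed.

Lemma enorm_sqr u : enorm u ^+ 2 = dot u u.
Proof. by rewrite /enorm sqr_sqrtr// dot_ge0. Qed.

Lemma enorm_gt0 u : (0 < enorm u) = (u != 0).
Proof. by rewrite /enorm sqrtr_gt0 dot_gt0. Qed.

Lemma coord_le_enorm u i : `|u 0 i| <= enorm u.
Proof.
rewrite -sqrtr_sqr; apply: ler_wsqrtr; rewrite dotE.
have h0 := sqr_ge0 (u 0 i0); have h1 := sqr_ge0 (u 0 i1); have h2 := sqr_ge0 (u 0 i2).
by move: i; apply: ord3P; nra.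
Qed.

Definition cross u v : 'rV[R]_3 :=
  mk3 (u 0 i1 * v 0 i2 - u 0 i2 * v 0 i1)
      (u 0 i2 * v 0 i0 - u 0 i0 * v 0 i2)
      (u 0 i0 * v 0 i1 - u 0 i1 * v 0 i0).

Lemma dot_cross u v : dot (cross u v) (cross u v) = gram u v.
Proof. by rewrite /gram !dotE !mk3E; ring. Qed.

Lemma cross_cross u v w : cross u (cross v w) = dot u w *: v - dot u v *: w.
Proof. by apply: rV3P; rewrite !dotE !(mk3E, mxE); ring. Qed.

Definition det3 u v w := dot u (cross v w).

Lemma cramer3 u v w x :
  det3 u v w *: x =
    dot (cross v w) x *: u + dot (cross w u) x *: v + dot (cross u v) x *: w.
Proof. by apply: rV3P; rewrite /det3 !dotE !(mk3E, mxE); ring. Qed.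

Definition comb3 u v w (a : 'rV[R]_3) := a 0 i0 *: u + a 0 i1 *: v + a 0 i2 *: w.

(** The cofactor matrix of the matrix with columns u, v, w, applied to a. It transports normals
    ([dot_cof3]) and cross products ([cross_comb3]). *)
Definition cof3 u v w (a : 'rV[R]_3) :=
  a 0 i0 *: cross v w + a 0 i1 *: cross w u + a 0 i2 *: cross u v.

Lemma dot_cof3 u v w a b :
  dot (cof3 u v w a) (comb3 u v w b) = det3 u v w * dot a b.
Proof. by rewrite /det3 /cof3 /comb3 !dotE !(mk3E, mxE); ring. Qed.

Lemma cross_comb3 u v w a b :
  cross (comb3 u v w a) (comb3 u v w b) = cof3 u v w (cross a b).
Proof. by apply: rV3P; rewrite /comb3 /cof3 !(mk3E, mxE); ring. Qed.

Lemma cof3Z k u v w a : cof3 u v w (k *: a) = k *: cof3 u v w a.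
Proof. by rewrite /cof3 !mxE !scalerDr !scalerA. Qed.

(** Cramer's rule for the inverse of [comb3 u v w]. *)
Definition solve3 u v w x :=
  mk3 (dot (cross v w) x / det3 u v w) (dot (cross w u) x / det3 u v w)
      (dot (cross u v) x / det3 u v w).

Lemma comb3K u v w x : det3 u v w != 0 -> comb3 u v w (solve3 u v w x) = x.
Proof.
move=> d0; rewrite /comb3 !mk3E.
rewrite ![_ / det3 u v w]mulrC -!scalerA -!scalerDr -cramer3.
by rewrite scalerA mulVf// scale1r.
Qed.

Lemma solve3K u v w a : det3 u v w != 0 -> solve3 u v w (comb3 u v w a) = a.
Proof.
move=> d0; have := d0; rewrite /det3 dotE !mk3E => d0'.
by apply: rV3P; rewrite /solve3 /comb3 /det3 !dotE !(mk3E, mxE); field.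
Qed.

(** Crossing twice with e_k gives minus the projection of y orthogonal to e_k, and every coordinate
    of y survives in two of the three projections. *)
Lemma rotation_cross_sum y : cross (e_ i0) (cross (e_ i0) y) +
  cross (e_ i1) (cross (e_ i1) y) + cross (e_ i2) (cross (e_ i2) y) = - 2 *: y.
Proof. by apply: rV3P; rewrite /cross !(mk3E, e_E, mxE) /=; ring. Qed.

(** * Planes *)

Lemma gram_comb (p q : 'rV[R]_3) (a b c d : R) :
  gram (a *: p + b *: q) (c *: p + d *: q) = (a * d - b * c) ^+ 2 * gram p q.
Proof. by rewrite /gram !dotLE (dotC q p); ring. Qed.

Lemma span_comb (W : set 'rV[R]_3) p q (a b c d : R) : is_span W p q ->
  a * d - b * c != 0 -> is_span W (a *: p + b *: q) (c *: p + d *: q).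
Proof.
move=> -> dn; rewrite /is_span; apply/seteqP; split => x /=.
- move=> [s _] [t _] <-; set D := a * d - b * c in dn *.
  exists ((s * d - t * c) / D) => //; exists ((t * a - s * b) / D) => //.
  by apply: rV3P; rewrite !mxE; rewrite /D in dn *; field.
- move=> [s _] [t _] <-; exists (s * a + t * c) => //; exists (s * b + t * d) => //.
  by apply: rV3P; rewrite !mxE; ring.
Qed.

Lemma is_spanP {W : set 'rV[R]_3} {p q} : is_span W p q ->
  forall x, W x -> exists a b, x = a *: p + b *: q.
Proof. by move=> -> x [a _] [b _] <-; exists a, b. Qed.

Lemma is_spanI {W : set 'rV[R]_3} {p q} : is_span W p q ->
  forall a b, W (a *: p + b *: q).
Proof. by move=> -> a b; exists a => //; exists b. Qed.

Lemma orthonormal_exists (W : set 'rV[R]_3) p q : is_basis W p q ->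
  exists x1 x2, is_orthonormal_basis W x1 x2.
Proof.
move=> [g0 sp].
have p0 : 0 < dot p p.
  rewrite dot_gt0; apply: contraTneq g0 => ->; rewrite /gram !dot0l; lra.
(* Gram-Schmidt: [t *: p] is the projection of q on p, and the residual has squared norm
   [gram p q / dot p p]. *)
pose t := dot p q / dot p p.
have z0 : 0 < dot (q - t *: p) (q - t *: p).
  have -> : dot (q - t *: p) (q - t *: p) = gram p q / dot p p.
    rewrite /gram !dotLE (dotC q p) /t; field; exact: lt0r_neq0.
  by rewrite divr_gt0.
pose A := (enorm p)^-1; pose B := (enorm (q - t *: p))^-1.
have A2 : A ^+ 2 * dot p p = 1.
  by rewrite /A exprVn enorm_sqr mulVf// lt0r_neq0.
have B2 : B ^+ 2 * dot (q - t *: p) (q - t *: p) = 1.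
  by rewrite /B exprVn enorm_sqr mulVf// lt0r_neq0.
exists (A *: p), (B *: (q - t *: p)); split.
- by rewrite !dotLE mulrA -expr2.
- by rewrite dotZl dotZr mulrA -expr2.
- rewrite dotZl dotZr dotBr dotZr /t divfK ?subrr ?mulr0//; exact: lt0r_neq0.
- have -> : A *: p = A *: p + 0 *: q by rewrite scale0r addr0.
  have -> : B *: (q - t *: p) = (- B * t) *: p + B *: q.
    by apply: rV3P; rewrite !mxE; ring.
  apply: span_comb => //; rewrite mul0r subr0.
  have An : A != 0 by rewrite invr_eq0 gt_eqF// enorm_gt0 -dot_gt0.
  have Bn : B != 0 by rewrite invr_eq0 gt_eqF// enorm_gt0 -dot_gt0.
  exact: mulf_neq0.
Qed.

(** N x (p x q) vanishes because N is orthogonal to p and q; crossing with N once more writes |N|^2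
    (p x q) as a multiple of N. *)
Lemma cross_orthogonal N p q : dot N p = 0 -> dot N q = 0 -> dot N N != 0 ->
  cross p q = (det3 N p q / dot N N) *: N.
Proof.
move=> Np Nq NN.
have := cross_cross N p q; rewrite Np Nq !scale0r subr0 => c0.
have := cross_cross N N (cross p q); rewrite c0.
have -> : cross N 0 = 0 by apply: rV3P; rewrite !(mk3E, mxE); ring.
move/eqP; rewrite eq_sym subr_eq0 => /eqP h.
have : (dot N N)^-1 *: (dot N N *: cross p q) = cross p q by rewrite scalerA mulVf// scale1r.
by rewrite -h scalerA mulrC => <-.
Qed.

(** Cramer's rule in the basis (N, p, q): the coefficient of N is [dot (cross p q) x], which is zero
    because [cross p q] is a multiple of N. *)
Lemma orthogonal_span N p q x : dot N p = 0 -> dot N q = 0 -> 0 < gram p q ->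
  dot N x = 0 -> dot N N != 0 -> exists a b, x = a *: p + b *: q.
Proof.
move=> Np Nq g0 Nx NN; have crossE := cross_orthogonal _ _ _ Np Nq NN.
have D0 : det3 N p q != 0.
  apply: contraTneq g0 => d0; rewrite -dot_cross crossE d0 mul0r scale0r dot0l; lra.
have := cramer3 N p q x.
rewrite {1}crossE dotZl Nx mulr0 scale0r add0r => h.
exists (dot (cross q N) x / det3 N p q), (dot (cross N p) x / det3 N p q).
apply: (scalerI D0); rewrite h scalerDr !scalerA.
by rewrite ![det3 N p q * _]mulrC !divfK.
Qed.

Lemma span_orthogonal0 w p q (k l : R) :
  dot w p = 0 -> dot w q = 0 -> w = k *: p + l *: q -> w = 0.
Proof.
move=> wp wq wE; apply: dot_eq0; rewrite {2}wE dotDr !dotZr wp wq; ring.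
Qed.

(** This is tr(A^2) = (tr A)^2 - 2 det A for A = g^-1 k, with denominators cleared by (det g)^2. *)
Definition trace_sqr (g11 g12 g22 k11 k12 k22 : R) :=
  (g22 * k11 + g11 * k22 - 2 * g12 * k12) ^+ 2
  - 2 * (g11 * g22 - g12 ^+ 2) * (k11 * k22 - k12 ^+ 2).

(* In the basis (p, q) the operator has matrix g^-1 k, and trace_sqr g k is
   the trace of its square times (det g)^2. *)
Definition shape_sqr p q (W : 'rV[R]_3 -> 'rV[R]_3) :=
  trace_sqr (dot p p) (dot p q) (dot q q) (dot (W p) p) (dot (W p) q) (dot (W q) q)
  / gram p q ^+ 2.

(** * Self-adjoint operators on a plane: trace of the square and eigenvalues *)

Section SelfAdjoint.
Variables (tau : set 'rV[R]_3) (N p q : 'rV[R]_3) (W : 'rV[R]_3 -> 'rV[R]_3).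
Hypothesis tau_basis : is_basis tau p q.
Hypothesis N1 : dot N N = 1.
Hypothesis Ntau : forall x, tau x -> dot N x = 0.
Hypothesis W_lin : forall a b x y, tau x -> tau y ->
  W (a *: x + b *: y) = a *: W x + b *: W y.
Hypothesis NW : forall x, tau x -> dot N (W x) = 0.
Hypothesis W_sym : dot (W p) q = dot (W q) p.

Lemma mem_tau x : dot N x = 0 -> tau x.
Proof.
case: tau_basis => g0 sp Nx.
have tp : tau p by have := is_spanI sp 1 0; rewrite scale1r scale0r addr0.
have tq : tau q by have := is_spanI sp 0 1; rewrite scale1r scale0r add0r.
have [|a [b ->]] := orthogonal_span N p q x (Ntau _ tp) (Ntau _ tq) g0 Nx.
  by rewrite N1 oner_neq0.
exact: is_spanI.
Qed.

Lemma selfadjoint_matrix x1 x2 : is_orthonormal_basis tau x1 x2 ->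
  exists al be ga, [/\ W x1 = al *: x1 + be *: x2, W x2 = be *: x1 + ga *: x2 &
   shape_sqr p q W = al ^+ 2 + 2 * be ^+ 2 + ga ^+ 2].
Proof.
move=> [x11 x22 x12 spx]; case: tau_basis => g0 sp.
have tp : tau p by have := is_spanI sp 1 0; rewrite scale1r scale0r addr0.
have tq : tau q by have := is_spanI sp 0 1; rewrite scale1r scale0r add0r.
have t1 : tau x1 by have := is_spanI spx 1 0; rewrite scale1r scale0r addr0.
have t2 : tau x2 by have := is_spanI spx 0 1; rewrite scale1r scale0r add0r.
have [al [be W1]] := is_spanP spx _ (mem_tau _ (NW _ t1)).
have [be' [ga W2]] := is_spanP spx _ (mem_tau _ (NW _ t2)).
have [a [b pE]] := is_spanP spx _ tp.
have [c [d qE]] := is_spanP spx _ tq.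
have gE : gram p q = (a * d - b * c) ^+ 2.
  by rewrite pE qE gram_comb /gram x11 x22 x12; ring.
have Wp : W p = a *: W x1 + b *: W x2 by rewrite pE W_lin.
have Wq : W q = c *: W x1 + d *: W x2 by rewrite qE W_lin.
have dn : a * d - b * c != 0 by move: g0; rewrite gE exprn_even_gt0.
(* The antisymmetric part of [W] in (p, q) is the one in (x1, x2) times the determinant a d - b c,
   so symmetry on the pair (p, q) passes to the orthonormal basis. *)
have bb : be = be'.
  have := W_sym; rewrite Wp Wq W1 W2 pE qE !dotLE (dotC x2 x1) x11 x22 x12 => h.
  have : (a * d - b * c) * (be - be') = 0 by lra.
  by move/eqP; rewrite mulf_eq0 (negPf dn)/= subr_eq0 => /eqP.
exists al, be, ga; split => //; first by rewrite {1}bb.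
rewrite /shape_sqr gE /trace_sqr Wp Wq W1 W2 pE qE -bb !dotLE (dotC x2 x1) x11 x22 x12.
by field.
Qed.

Lemma orthonormal_shape x1 x2 : is_orthonormal_basis tau x1 x2 ->
  dot (W x1) (W x1) + dot (W x2) (W x2) = shape_sqr p q W.
Proof.
move=> onb; have [al [be [ga [-> -> ->]]]] := selfadjoint_matrix _ _ onb.
case: onb => x11 x22 x12 _.
by rewrite !dotLE (dotC x2 x1) x11 x22 x12; ring.
Qed.

Lemma eigen_shape e1 e2 k1 k2 : is_basis tau e1 e2 ->
  W e1 = k1 *: e1 -> W e2 = k2 *: e2 -> k1 ^+ 2 + k2 ^+ 2 = shape_sqr p q W.
Proof.
move=> [ge spe] We1 We2; have [x1 [x2 onb]] := orthonormal_exists _ _ _ tau_basis.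
have [al [be [ga [W1 W2 ->]]]] := selfadjoint_matrix _ _ onb.
case: onb => x11 x22 x12 spx.
have t1 : tau x1 by have := is_spanI spx 1 0; rewrite scale1r scale0r addr0.
have t2 : tau x2 by have := is_spanI spx 0 1; rewrite scale1r scale0r add0r.
have te1 : tau e1 by have := is_spanI spe 1 0; rewrite scale1r scale0r addr0.
have te2 : tau e2 by have := is_spanI spe 0 1; rewrite scale1r scale0r add0r.
have [a [b e1E]] := is_spanP spx _ te1.
have [c [d e2E]] := is_spanP spx _ te2.
have gE : gram e1 e2 = (a * d - b * c) ^+ 2.
  by rewrite e1E e2E gram_comb /gram x11 x22 x12; ring.
have dn : a * d - b * c != 0 by move: ge; rewrite gE exprn_even_gt0.
have E11 : k1 * a = a * al + b * be.
  have := congr1 (dot x1) We1; rewrite e1E W_lin// W1 W2 !dotLE x11 x12; lra.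
have E12 : k1 * b = a * be + b * ga.
  have := congr1 (dot x2) We1; rewrite e1E W_lin// W1 W2 !dotLE (dotC x2 x1) x22 x12; lra.
have E21 : k2 * c = c * al + d * be.
  have := congr1 (dot x1) We2; rewrite e2E W_lin// W1 W2 !dotLE x11 x12; lra.
have E22 : k2 * d = c * be + d * ga.
  have := congr1 (dot x2) We2; rewrite e2E W_lin// W1 W2 !dotLE (dotC x2 x1) x22 x12; lra.
have F11 : k1 ^+ 2 * a = a * al ^+ 2 + 2 * 0 + b * be * (al + ga) + a * be ^+ 2.
  by rewrite expr2 -mulrA E11 mulrDr mulrA (mulrA k1 b) E11 E12; ring.
have F12 : k1 ^+ 2 * b = a * be * (al + ga) + b * be ^+ 2 + b * ga ^+ 2.
  by rewrite expr2 -mulrA E12 mulrDr mulrA (mulrA k1 b) E11 E12; ring.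
have F21 : k2 ^+ 2 * c = c * al ^+ 2 + d * be * (al + ga) + c * be ^+ 2.
  by rewrite expr2 -mulrA E21 mulrDr mulrA (mulrA k2 d) E21 E22; ring.
have F22 : k2 ^+ 2 * d = c * be * (al + ga) + d * be ^+ 2 + d * ga ^+ 2.
  by rewrite expr2 -mulrA E22 mulrDr mulrA (mulrA k2 d) E21 E22; ring.
(* With det taken in the basis (x1, x2): det(W^2 e1, e2) + det(e1, W^2 e2) = tr(W^2) det(e1, e2).
   This covers eigenvectors that are not orthogonal to each other. *)
apply: (mulIf dn).
have -> : (k1 ^+ 2 + k2 ^+ 2) * (a * d - b * c) =
    (k1 ^+ 2 * a) * d - (k1 ^+ 2 * b) * c + (k2 ^+ 2 * d) * a - (k2 ^+ 2 * c) * b by ring.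
by rewrite F11 F12 F21 F22; ring.
Qed.

Lemma eigen_exists : exists k1 k2 e1 e2,
  [/\ is_basis tau e1 e2, W e1 = k1 *: e1 & W e2 = k2 *: e2].
Proof.
have [x1 [x2 onb]] := orthonormal_exists _ _ _ tau_basis.
have [al [be [ga [W1 W2 _]]]] := selfadjoint_matrix _ _ onb.
case: onb => x11 x22 x12 spx.
have t1 : tau x1 by have := is_spanI spx 1 0; rewrite scale1r scale0r addr0.
have t2 : tau x2 by have := is_spanI spx 0 1; rewrite scale1r scale0r add0r.
have g12 : gram x1 x2 = 1 by rewrite /gram x11 x22 x12; ring.
(* For [be = 0] the matrix is already diagonal, and one of the eigenvectors used in the other case
   would vanish. *)
have [b0|bn] := eqVneq be 0.
  exists al, ga, x1, x2; split; first by split => //; rewrite g12.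
    by rewrite W1 b0 scale0r addr0.
  by rewrite W2 b0 scale0r add0r.
(* Square root of the discriminant of the characteristic polynomial. For a root k, the vector (be, k
   - al) is the eigenvector read off the first row of the matrix. *)
pose S := Num.sqrt ((al - ga) ^+ 2 + 4 * be ^+ 2).
have Sp : 0 < (al - ga) ^+ 2 + 4 * be ^+ 2.
  by rewrite ltr_wpDl ?sqr_ge0// mulr_gt0// exprn_even_gt0//= ?bn.
have S2 : S ^+ 2 = (al - ga) ^+ 2 + 4 * be ^+ 2 by rewrite sqr_sqrtr// ltW.
have S0 : S != 0 by rewrite gt_eqF// sqrtr_gt0.
pose k1 := (al + ga + S) / 2; pose k2 := (al + ga - S) / 2.
exists k1, k2, (be *: x1 + (k1 - al) *: x2), (be *: x1 + (k2 - al) *: x2).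
have dn : be * (k2 - al) - (k1 - al) * be != 0.
  have -> : be * (k2 - al) - (k1 - al) * be = - (be * S) by rewrite /k1 /k2; field.
  by rewrite oppr_eq0 mulf_neq0.
have root1 : (k1 - al) * (k1 - ga) = be ^+ 2.
  by apply: (mulfI (_ : 4 != 0 :> R)) => //; rewrite /k1; transitivity (S ^+ 2 - (al - ga) ^+ 2); [field | rewrite S2; ring].
have root2 : (k2 - al) * (k2 - ga) = be ^+ 2.
  by apply: (mulfI (_ : 4 != 0 :> R)) => //; rewrite /k2; transitivity (S ^+ 2 - (al - ga) ^+ 2); [field | rewrite S2; ring].
split.
- split; last exact: span_comb.
  by rewrite gram_comb g12 mulr1 exprn_even_gt0.
- rewrite W_lin// W1 W2.
  have -> : k1 *: (be *: x1 + (k1 - al) *: x2) =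
     (be * al + (k1 - al) * be) *: x1 + (be ^+ 2 + (k1 - al) * ga) *: x2.
    by rewrite -root1; apply: rV3P; rewrite !mxE; ring.
  by apply: rV3P; rewrite !mxE; ring.
- rewrite W_lin// W1 W2.
  have -> : k2 *: (be *: x1 + (k2 - al) *: x2) =
     (be * al + (k2 - al) * be) *: x1 + (be ^+ 2 + (k2 - al) * ga) *: x2.
    by rewrite -root2; apply: rV3P; rewrite !mxE; ring.
  by apply: rV3P; rewrite !mxE; ring.
Qed.

End SelfAdjoint.

End Vectors3.

(** * Smooth maps *)

Section NearDifferentiable.
Context {R : realType} {E F : normedModType R}.

Lemma near_eq_differentiable (f g : E -> F) x :
  (\near x, f x = g x) -> differentiable f x -> differentiable g x.
Proof.
move=> fg df; have [df_cont df_eq] := (diff_locallyP _ _).1 df.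
have gE : g \o shift x = cst (g x) + 'd f x +o_ 0 id.
  apply/eqaddoP => eps eps0; have H := (eqaddoP _ _ _ _).1 df_eq eps eps0.
  have fg' : \forall h \near (0 : E), f (h + x) = g (h + x).
    have := fg; rewrite (near_shift 0 x) /=; apply: filterS => h /=.
    by rewrite subr0.
  near=> h.
  rewrite -[X in `|X|]/(g (h + x) - (g x + 'd f x h)) -(nbhs_singleton fg).
  rewrite -(_ : f (h + x) = g (h + x)); last by near: h.
  by near: h; exact: H.
apply/diff_locallyP; suff -> : 'd g x = 'd f x :> (E -> F) by split.
exact: diff_unique.
Unshelve. all: by end_near. Qed.

Lemma is_derive_curve (f : E -> F) (gam : R -> E) (t : R) xi :
  is_derive t (1 : R) gam xi -> differentiable f (gam t) ->
  is_derive t (1 : R) (f \o gam) ('D_xi f (gam t)).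
Proof.
move=> [/derivable1_diffP dg gE] df.
have dfg : differentiable (f \o gam) t by exact: differentiable_comp.
apply: DeriveDef; first exact: diff_derivable.
by rewrite !deriveE// diff_comp//= -gE deriveE.
Qed.

Lemma is_derive_line (f : E -> F) p a (t : R) :
  differentiable f (p + t *: a) ->
  is_derive t (1 : R) (fun t => f (p + t *: a)) ('D_a f (p + t *: a)).
Proof.
move=> df; apply: (is_derive_curve f (fun t => p + t *: a)) => //.
have da : is_derive t (1 : R) (fun t : R => t *: a) a.
  apply: DeriveDef; first exact: diff_derivable.
  by rewrite deriveE// diff_val/= scale1r.
have : is_derive t (1 : R) (cst p + (fun t : R => t *: a)) (0 + a).
  exact: is_deriveD.
by rewrite add0r; apply.
Qed.

Lemma derive_linear (f : E -> F) x a b s t : differentiable f x ->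
  'D_(a *: s + b *: t) f x = a *: 'D_s f x + b *: 'D_t f x.
Proof. by move=> df; rewrite !deriveE// linearP linearZ. Qed.

End NearDifferentiable.

Section Components.
Context {R : realType} {E : normedModType R}.

Lemma differentiable_rV3 (f : E -> 'rV[R]_3) x :
  (forall i, differentiable (fun x => f x 0 i) x) -> differentiable f x.
Proof.
move=> df.
have -> : f = (fun x => f x 0 i0 *: e_ i0) + (fun x => f x 0 i1 *: e_ i1)
    + (fun x => f x 0 i2 *: e_ i2).
  by apply/funext => y; rewrite {1}(row3_sum (f y)).
by do 2?apply: differentiableD; apply: differentiableZl.
Qed.

Lemma differentiable_comp_rV3 (f : E -> 'rV[R]_3) x i :
  differentiable f x -> differentiable (fun x => f x 0 i) x.
Proof.
move=> df; apply: (@differentiable_comp _ _ _ _ f (fun M : 'rV[R]_3 => M 0 i)) => //.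
exact: differentiable_coord.
Qed.

Lemma derive_rV3 (f : E -> 'rV[R]_3) x v i :
  derivable f x v -> ('D_v f x) 0 i = 'D_v (fun x => f x 0 i) x.
Proof. by move=> df; rewrite derive_mx// mxE. Qed.

Lemma is_derive_rV3 (f : E -> 'rV[R]_3) x v (w : 'rV[R]_3) :
  (forall i, is_derive x v (fun x => f x 0 i) (w 0 i)) -> is_derive x v f w.
Proof.
move=> df; have d : derivable f x v.
  by apply/derivable_mxP => i j; rewrite (ord1 i); have [] := df j.
apply: DeriveDef => //; apply/rowP => i; rewrite derive_rV3//.
by have [] := df i.
Qed.

Lemma is_derive_coord (f : E -> 'rV[R]_3) x v (w : 'rV[R]_3) i :
  is_derive x v f w -> is_derive x v (fun x => f x 0 i) (w 0 i).
Proof.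
move=> [df <-]; apply: DeriveDef; last by rewrite derive_rV3.
by have /derivable_mxP := df; apply.
Qed.

End Components.

Lemma derive_basis (R : realType) (F : normedModType R) (f : 'rV[R]_3 -> F) (x v : 'rV[R]_3) :
  differentiable f x -> 'D_v f x = v 0 i0 *: 'D_(e_ i0) f x +
    v 0 i1 *: 'D_(e_ i1) f x + v 0 i2 *: 'D_(e_ i2) f x.
Proof.
by move=> df; rewrite {1}(row3_sum v) !deriveE// !linearD !linearZ.
Qed.

(** * Closure properties of smooth maps *)

Section Cn.
Context {R : realType} {E : normedModType R}.

(** The recursion takes the innermost derivative first, whereas [iter_derive] adds the outermost; in
    this form the product, quotient and chain rules feed directly into an induction on n. *)
Fixpoint Cn {F : normedModType R} n (U : set E) (f : E -> F) : Prop :=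
  (forall x, U x -> differentiable f x) /\
  if n is n'.+1 then forall v, Cn n' U ('D_v f) else True.

Lemma CnW (F : normedModType R) n U (f : E -> F) : Cn n.+1 U f -> Cn n U f.
Proof.
elim: n f => [|n IH] f; first by case.
by move=> [df Df]; split => // v; exact/IH/Df.
Qed.

Lemma smooth_onP (F : normedModType R) U (f : E -> F) :
  smooth_on U f <-> forall n, Cn n U f.
Proof.
split=> [sf n|Cf vs].
- elim: n f sf => [|n IH] f sf; split=> //.
  + exact: sf [::].
  + exact: sf [::].
  + move=> v; apply: IH => vs x Ux; have := sf (rcons vs v) x Ux.
    by rewrite /iter_derive foldr_rcons.
- move: (Cf (size vs)); elim/last_ind: vs {Cf} f => [|vs v IH] f; first by case.
  rewrite size_rcons => -[_ /(_ v)/IH].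
  by rewrite /iter_derive foldr_rcons.
Qed.

Lemma smooth_diff (F : normedModType R) U (f : E -> F) : smooth_on U f ->
  forall x, U x -> differentiable f x.
Proof. by move=> sf x Ux; have := sf [::] x Ux. Qed.

Lemma smooth_derive (F : normedModType R) U (f : E -> F) v :
  smooth_on U f -> smooth_on U ('D_v f).
Proof.
by move=> /smooth_onP sf; apply/smooth_onP => n; have [_] := sf n.+1; apply.
Qed.

End Cn.

Section CnCalculus.
Context {R : realType} {E : normedModType R}.
Variable U : set E.
Hypothesis Uo : open U.

Lemma Cn_ext (F : normedModType R) n (f g : E -> F) :
  (forall x, U x -> f x = g x) -> Cn n U f -> Cn n U g.
Proof.
elim: n f g => [|n IH] f g fg [df Df].
  split=> // x Ux; apply: near_eq_differentiable (df x Ux).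
  by near=> y; apply: fg; near: y; exact: open_nbhs_nbhs.
split=> [x Ux|v].
  apply: near_eq_differentiable (df x Ux).
  by near=> y; apply: fg; near: y; exact: open_nbhs_nbhs.
apply: (IH _ _ _ (Df v)) => x Ux; apply: near_eq_derive.
by near=> y; apply: fg; near: y; exact: open_nbhs_nbhs.
Unshelve. all: by end_near. Qed.

Lemma Cn_cst (F : normedModType R) n (a : F) : Cn n U (cst a : E -> F).
Proof.
elim: n a => [|n IH] a; split=> // v.
by have -> : 'D_v (cst a : E -> F) = cst 0 by apply/funext => x; rewrite derive_cst.
Qed.

Lemma CnD (F : normedModType R) n (f g : E -> F) : Cn n U f -> Cn n U g -> Cn n U (f + g).
Proof.
elim: n f g => [|n IH] f g [df Df] [dg Dg].
  split=> [x Ux|]; last exact: I.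
  by apply: differentiableD; [exact: df|exact: dg].
split=> [x Ux|v]; first by apply: differentiableD; [exact: df|exact: dg].
apply: (Cn_ext _ _ _ _ _ (IH _ _ (Df v) (Dg v))) => x Ux.
by rewrite deriveD//; apply: diff_derivable; [exact: df|exact: dg].
Qed.

Lemma CnM n (f g : E -> R) : Cn n U f -> Cn n U g -> Cn n U (f * g).
Proof.
elim: n f g => [|n IH] f g Cf Cg; have [df Df] := Cf; have [dg Dg] := Cg;
  split=> [x Ux|] //.
- by apply: differentiableM; [exact: df|exact: dg].
- by apply: differentiableM; [exact: df|exact: dg].
- move=> v; have := CnD _ _ _ _ (IH _ _ (CnW _ _ _ _ Cf) (Dg v)) (IH _ _ (CnW _ _ _ _ Cg) (Df v)).
  apply: Cn_ext => x Ux.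
  by rewrite deriveM//; apply: diff_derivable; [exact: df|exact: dg].
Qed.

Lemma CnV n (f : E -> R) : (forall x, U x -> f x != 0) ->
  Cn n U f -> Cn n U (fun x => (f x)^-1).
Proof.
move=> f0; elim: n f f0 => [|n IH] f f0 Cf; have [df Df] := Cf;
  split=> [x Ux|] //.
- by apply: differentiableV; [exact: df|exact: f0].
- by apply: differentiableV; [exact: df|exact: f0].
- move=> v; have CV := IH _ f0 (CnW _ _ _ _ Cf).
  have := CnM _ _ _ (CnM _ _ _ (Cn_cst _ n (-1 : R)) (Df v)) (CnM _ _ _ CV CV).
  apply: Cn_ext => x Ux; rewrite deriveV//; [|exact: f0|exact/diff_derivable/df].
  by rewrite -[LHS]/((-1 * 'D_v f x) * ((f x)^-1 * (f x)^-1)) /GRing.scale/= -exprVn expr2; ring.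
Qed.

Lemma Cn_rV3 n (f : E -> 'rV[R]_3) :
  Cn n U f <-> forall i, Cn n U (fun x => f x 0 i).
Proof.
elim: n f => [|n IH] f.
  split=> [[df _] i|Cf]; split=> // x Ux.
    exact/differentiable_comp_rV3/df.
  by apply: differentiable_rV3 => i; have [+ _] := Cf i; exact.
split=> [[df Df] i|Cf].
  split=> [x Ux|v]; first exact/differentiable_comp_rV3/df.
  apply: (Cn_ext _ _ _ _ _ ((IH ('D_v f)).1 (Df v) i)) => x Ux.
  exact/derive_rV3/diff_derivable/df.
have df x : U x -> differentiable f x.
  by move=> Ux; apply: differentiable_rV3 => i; have [+ _] := Cf i; exact.
split=> // v; apply/IH => i; have [_ /(_ v)] := Cf i.
by apply: Cn_ext => x Ux; rewrite derive_rV3//; exact/diff_derivable/df.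
Qed.

(** The induction runs over all [T] at once: the chain rule makes 'D_v (T \o X) a sum of products of
    coordinates of 'D_v X with partial derivatives of [T] composed with [X], and these partials are
    smooth again. *)
Lemma Cn_comp n (T : 'rV[R]_3 -> R) (X : E -> 'rV[R]_3) :
  smooth_on setT T -> smooth_on U X -> Cn n U (T \o X).
Proof.
move=> + sX; elim: n T => [|n IH] T sT.
  split=> // x Ux; apply: differentiable_comp; first exact: (smooth_diff _ _ _ sX).
  exact: (smooth_diff _ _ _ sT).
split=> [x Ux|v].
  apply: differentiable_comp; first exact: (smooth_diff _ _ _ sX).
  exact: (smooth_diff _ _ _ sT).
have CX i : Cn n U (fun x => ('D_v X x) 0 i).
  by have /smooth_onP/(_ n)/Cn_rV3 := smooth_derive _ _ _ v sX.
have CT i : Cn n U ('D_(e_ i) T \o X) by exact/IH/smooth_derive.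
have := CnD _ _ _ _ (CnD _ _ _ _ (CnM _ _ _ (CX i0) (CT i0)) (CnM _ _ _ (CX i1) (CT i1)))
  (CnM _ _ _ (CX i2) (CT i2)).
apply: Cn_ext => x Ux.
have dX : differentiable X x by exact: (smooth_diff _ _ _ sX).
have dT : differentiable T (X x) by exact: (smooth_diff _ _ _ sT).
rewrite [RHS]deriveE; last exact: differentiable_comp.
by rewrite diff_comp//= -!deriveE// derive_basis.
Qed.

Lemma smooth_comp (T : 'rV[R]_3 -> 'rV[R]_3) (X : E -> 'rV[R]_3) :
  smooth_on setT T -> smooth_on U X -> smooth_on U (T \o X).
Proof.
move=> sT sX; apply/smooth_onP => n; apply/Cn_rV3 => i.
apply: (Cn_comp n (fun x => T x 0 i)) => //; apply/smooth_onP => m.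
have /smooth_onP/(_ m) := sT.
elim: m T {sT} => [|m IH] T [dT DT]; split=> [x _|] //.
- exact/differentiable_comp_rV3/dT.
- exact/differentiable_comp_rV3/dT.
- move=> v; have := IH _ (DT v); congr Cn; apply/funext => x.
  by rewrite derive_rV3//; exact/diff_derivable/dT.
Qed.

End CnCalculus.

Set Implicit Arguments.
Unset Strict Implicit.
Unset Printing Implicit Defensive.

Section SmoothClosure.
Context {R : realType} {E : normedModType R}.
Variables (U : set E) (Uo : open U).

Lemma smooth_ext (F : normedModType R) (f g : E -> F) :
  (forall x, U x -> f x = g x) -> smooth_on U f -> smooth_on U g.
Proof.
by move=> fg /smooth_onP sf; apply/smooth_onP => n; exact: Cn_ext fg (sf n).
Qed.

Lemma smooth_cst (F : normedModType R) (a : F) : smooth_on U (fun _ : E => a).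
Proof. by apply/smooth_onP => n; exact: Cn_cst. Qed.

Lemma smoothD (F : normedModType R) (f g : E -> F) :
  smooth_on U f -> smooth_on U g -> smooth_on U (fun x => f x + g x).
Proof.
by move=> /smooth_onP sf /smooth_onP sg; apply/smooth_onP => n; exact: CnD.
Qed.

Lemma smoothM (f g : E -> R) :
  smooth_on U f -> smooth_on U g -> smooth_on U (fun x => f x * g x).
Proof.
by move=> /smooth_onP sf /smooth_onP sg; apply/smooth_onP => n; exact: CnM.
Qed.

Lemma smoothV (f : E -> R) : (forall x, U x -> f x != 0) ->
  smooth_on U f -> smooth_on U (fun x => (f x)^-1).
Proof. by move=> f0 /smooth_onP sf; apply/smooth_onP => n; exact: CnV. Qed.

Lemma smoothN (f : E -> R) : smooth_on U f -> smooth_on U (fun x => - f x).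
Proof.
move=> sf; apply: smooth_ext (smoothM (smooth_cst (-1 : R)) sf) => x _.
by rewrite mulN1r.
Qed.

Lemma smoothB (f g : E -> R) :
  smooth_on U f -> smooth_on U g -> smooth_on U (fun x => f x - g x).
Proof. by move=> sf /smoothN; exact: smoothD. Qed.

Lemma smooth_rV3 (f : E -> 'rV[R]_3) :
  smooth_on U f <-> forall i, smooth_on U (fun x => f x 0 i).
Proof.
split=> [/smooth_onP sf i|sf]; apply/smooth_onP => n.
  by have /(Cn_rV3 U Uo) := sf n; apply.
by apply/Cn_rV3 => // i; have /smooth_onP := sf i; apply.
Qed.

Lemma linear_derive (F : normedModType R) (f : E -> F) x v : linear f -> continuous f ->
  differentiable f x /\ 'D_v f x = f v.
Proof.
move=> lf cf; pose NM := GRing.isLinear.Build _ _ _ _ _ lf.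
pose L : {linear E -> F} := HB.pack f NM.
have dL : differentiable L x by exact: linear_differentiable.
by split; [exact: dL|rewrite (deriveE v dL) diff_lin].
Qed.

Lemma smooth_linear (F : normedModType R) (f : E -> F) :
  linear f -> continuous f -> smooth_on U f.
Proof.
move=> lf cf; have H x v := linear_derive x v lf cf.
have df x : U x -> differentiable f x by move=> _; exact: (H x 0).1.
apply/smooth_onP => -[|n]; split=> // v.
apply: (Cn_ext _ Uo _ _ (fun _ : E => f v)); last exact: Cn_cst.
by move=> x _; rewrite (H x v).2.
Qed.

End SmoothClosure.

Section SmoothReal.
Context {R : realType}.

Lemma smooth_coord (U : set 'rV[R]_3) i : open U ->
  smooth_on U (fun x : 'rV[R]_3 => x 0 i).
Proof.
move=> Uo.
apply: (smooth_linear Uo); last exact: coord_continuous.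
by move=> a x y; rewrite !mxE.
Qed.

Lemma smooth_fst (U : set (R * R)) : open U -> smooth_on U (fst : R * R -> R).
Proof. by move=> Uo; apply: (smooth_linear Uo) => // x; exact: cvg_fst. Qed.

Lemma smooth_snd (U : set (R * R)) : open U -> smooth_on U (snd : R * R -> R).
Proof. by move=> Uo; apply: (smooth_linear Uo) => // x; exact: cvg_snd. Qed.

Lemma diff_cont (E F : normedModType R) (f : E -> F) x :
  differentiable f x -> {for x, continuous f}.
Proof. exact: differentiable_continuous. Qed.

Lemma continuous_dist (E F : normedModType R) (f : E -> F) x (eps : R) :
  {for x, continuous f} -> 0 < eps ->
  exists2 d : R, 0 < d & forall y, `|x - y| < d -> `|f x - f y| < eps.
Proof.
move=> /cvgrPdist_lt cf e0; have /nbhs_ballP[d d0 H] := cf _ e0.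
by exists d => // y xy; apply: H; rewrite -ball_normE.
Qed.

End SmoothReal.

(** * Symmetry of second derivatives *)

Section Schwarz.
Context {R : realType}.
Implicit Types (f : 'rV[R]_3 -> R) (x a b : 'rV[R]_3).

Lemma MVT_line (phi dphi : R -> R) (h : R) : 0 < h ->
  (forall t, is_derive t (1 : R) phi (dphi t)) ->
  exists2 t, 0 < t < h & phi h - phi 0 = dphi t * h.
Proof.
move=> h0 dp.
have c : {within `[0, h], continuous phi}.
  by apply: derivable_within_continuous => t _; have [] := dp t.
have [t] := MVT h0 (fun t _ => dp t) c.
by rewrite in_itv/= => th; rewrite subr0 => e; exists t.
Qed.

(** The mean value theorem twice: along a for the increment of f in direction b, then along b for
    the derivative 'D_a f so obtained. *)
Lemma second_difference f x a b (h : R) : smooth_on setT f -> 0 < h ->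
  exists s t, [/\ 0 < s < h, 0 < t < h &
   f (x + h *: a + h *: b) - f (x + h *: a) - (f (x + h *: b) - f x)
     = h ^+ 2 * 'D_b ('D_a f) (x + s *: a + t *: b)].
Proof.
move=> sf h0.
have df y : differentiable f y by exact: (smooth_diff _ _ _ sf).
have dDf y : differentiable ('D_a f) y by exact/(smooth_diff _ _ _ (smooth_derive _ _ _ a sf)).
pose phi s := f (x + s *: a + h *: b) - f (x + s *: a).
have dphi s : is_derive s (1 : R) phi ('D_a f (x + s *: a + h *: b) - 'D_a f (x + s *: a)).
  have -> : phi = (fun s => f ((x + h *: b) + s *: a)) - (fun s => f (x + s *: a)).
    by apply/funext => u; rewrite /phi addrAC.
  apply: is_deriveB; last exact: is_derive_line.
  by rewrite addrAC; exact: is_derive_line.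
have [s sh E1] := MVT_line h0 dphi.
pose psi t := 'D_a f (x + s *: a + t *: b).
have dpsi t : is_derive t (1 : R) psi ('D_b ('D_a f) (x + s *: a + t *: b)).
  exact: is_derive_line.
have [t th E2] := MVT_line h0 dpsi.
exists s, t; split => //.
move: E1 E2; rewrite /phi /psi !scale0r !addr0 => -> ->; ring.
Qed.

Let near_mid (P Q Z eps : R) : `|P - Z| < eps / 2 -> `|Q - Z| < eps / 2 ->
  `|P - Q| <= eps.
Proof.
move=> PZ QZ; rewrite (le_trans (ler_distD Z _ _))// (distrC Z) (splitr eps).
by apply: lerD; exact: ltW.
Qed.

Let mixed_difference (A B C D k X Y : R) : k != 0 ->
  A - B - (C - D) = k * X -> A - C - (B - D) = k * Y -> X = Y.
Proof. by move=> k0 eX eY; apply: (mulfI k0); rewrite -eX -eY; ring. Qed.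

(** The second difference is symmetric in a and b, so the two mixed derivatives agree at two points
    near x, and their continuity at x gives equality there. *)
Lemma deriveC f x a b : smooth_on setT f -> 'D_b ('D_a f) x = 'D_a ('D_b f) x.
Proof.
move=> sf; apply/eqP; rewrite -subr_eq0 -normr_le0; apply/ler_addgt0Pl => eps eps0.
rewrite addr0.
have c1 : {for x, continuous ('D_b ('D_a f))}.
  exact/diff_cont/(smooth_diff _ _ _ (smooth_derive _ _ _ b (smooth_derive _ _ _ a sf))).
have c2 : {for x, continuous ('D_a ('D_b f))}.
  exact/diff_cont/(smooth_diff _ _ _ (smooth_derive _ _ _ a (smooth_derive _ _ _ b sf))).
have e2 : 0 < eps / 2 by rewrite divr_gt0.
have [d1 d10 H1] := continuous_dist c1 e2.
have [d2 d20 H2] := continuous_dist c2 e2.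
(* Since [h * M] is the smaller of the two continuity radii, all intermediate points stay within
   both; the 1 keeps [M] positive. *)
pose M := `|a| + `|b| + 1.
have M0 : 0 < M by rewrite ltr_wpDl// addr_ge0.
pose h := Num.min d1 d2 / M.
have h0 : 0 < h by rewrite divr_gt0// lt_min; apply/andP.
have near_x s t : 0 < s < h -> 0 < t < h ->
    `|s *: a + t *: b| < Num.min d1 d2.
  move=> /andP[s0 sh] /andP[t0 th].
  have -> : Num.min d1 d2 = h * M by rewrite /h divfK// gt_eqF.
  apply: (@le_lt_trans _ _ (h * (`|a| + `|b|))); last first.
    by rewrite ltr_pM2l// /M ltrDl.
  rewrite mulrDr (le_trans (ler_normD _ _))// lerD// normrZ gtr0_norm//;
    exact: ler_wpM2r (ltW _).
have [s [t [sh th E1]]] := second_difference x a b sf h0.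
have [t' [s' [th' sh' E2]]] := second_difference x b a sf h0.
have E : 'D_b ('D_a f) (x + s *: a + t *: b) = 'D_a ('D_b f) (x + t' *: b + s' *: a).
  by apply: mixed_difference E1 _; [rewrite expf_neq0// gt_eqF | rewrite (addrAC x)].
have N1 : `|x - (x + s *: a + t *: b)| < d1.
  rewrite -addrA opprD addrA subrr add0r normrN.
  by apply: lt_le_trans (near_x _ _ sh th) _; rewrite ge_min lexx.
have N2 : `|x - (x + t' *: b + s' *: a)| < d2.
  rewrite -addrA opprD addrA subrr add0r normrN addrC.
  by apply: lt_le_trans (near_x _ _ sh' th') _; rewrite ge_min lexx orbT.
have := H2 _ N2; rewrite -E; exact: near_mid (H1 _ N1).
Qed.

Lemma deriveC_rV3 (g : 'rV[R]_3 -> 'rV[R]_3) x a b :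
  smooth_on setT g -> 'D_a ('D_b g) x = 'D_b ('D_a g) x.
Proof.
move=> sg; have sgi i : smooth_on setT (fun x => g x 0 i).
  by move: sg => /(smooth_rV3 openT); apply.
have E u v i : ('D_u ('D_v g) x) 0 i = 'D_u ('D_v (fun x => g x 0 i)) x.
  have d1 : derivable ('D_v g) x u.
    exact/diff_derivable/(smooth_diff _ _ _ (smooth_derive _ _ _ _ sg)).
  have fE : (fun y => ('D_v g y) 0 i) = 'D_v (fun y => g y 0 i).
    apply/funext => y; apply: derive_rV3.
    exact/diff_derivable/(smooth_diff _ _ _ sg).
  by rewrite -fE; exact: (derive_rV3 _ _ _ i d1).
by apply/rowP => i; exact: etrans (E a b i) (etrans (deriveC x b a (sgi i)) (esym (E b a i))).
Qed.

End Schwarz.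

(** * Lipschitz estimates and bounds on compact sets *)

Section Lipschitz.
Context {R : realType}.
Implicit Types (f : 'rV[R]_3 -> R) (x y a b : 'rV[R]_3).

Lemma le_coord_norm (x : 'rV[R]_3) i : `|x 0 i| <= `|x|.
Proof.
rewrite [leRHS]/Num.Def.normr/= mx_normrE.
exact: (le_bigmax _ (fun ij : 'I_1 * 'I_3 => `|x ij.1 ij.2|) (0, i)).
Qed.

Lemma norm_rV3_le (x : 'rV[R]_3) (M : R) : 0 <= M ->
  (forall i, `|x 0 i| <= M) -> `|x| <= M.
Proof.
move=> M0 h; rewrite [leLHS]/Num.Def.normr/= mx_normrE.
by apply: bigmax_le => // -[i j] _; rewrite (ord1 i).
Qed.

Lemma enorm_le_norm (x : 'rV[R]_3) : enorm x <= 3 * `|x|.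
Proof.
have N0 : 0 <= 3 * `|x| by rewrite mulr_ge0.
rewrite -[leRHS]ger0_norm// -sqrtr_sqr ler_wsqrtr// dotE.
have S i : x 0 i * x 0 i <= `|x| ^+ 2.
  by rewrite -expr2 -[leLHS]ger0_norm ?sqr_ge0// normrX lerXn2r ?nnegrE// le_coord_norm.
have := S i0; have := S i1; have := S i2; rewrite exprMn; move: (`|x| ^+ 2) (sqr_ge0 `|x|) => N.
by lra.
Qed.

(** In the max norm each of the three coordinates of y - x is bounded by the norm, whence the factor
    3. *)
Lemma lipschitz_line f (B : R) x y : (forall z, differentiable f z) ->
  (forall t i, 0 < t < 1 -> `|'D_(e_ i) f (x + t *: (y - x))| <= B) ->
  `|f y - f x| <= 3 * B * `|y - x|.
Proof.
move=> df hB.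
pose phi t := f (x + t *: (y - x)).
have dphi t : is_derive t (1 : R) phi ('D_(y - x) f (x + t *: (y - x))).
  exact: is_derive_line.
have [t th] := MVT_line ltr01 dphi.
rewrite /phi scale1r scale0r addr0 addrCA subrr addr0 mulr1 => ->.
rewrite derive_basis//.
have bd i : `|(y - x) 0 i *: 'D_(e_ i) f (x + t *: (y - x))| <= B * `|y - x|.
  by rewrite normrZ mulrC ler_pM// ?le_coord_norm// hB.
rewrite (le_trans (ler_normD _ _))//.
have -> : 3 * B * `|y - x| = B * `|y - x| + B * `|y - x| + B * `|y - x| by ring.
by rewrite lerD// (le_trans (ler_normD _ _))// lerD.
Qed.

Lemma compact_fun_bounded (K : set 'rV[R]_3) f : compact K -> continuous f ->
  exists2 B : R, 0 <= B & forall x, K x -> `|f x| <= B.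
Proof.
move=> cK cf.
have /compact_bounded : compact (f @` K).
  by apply: continuous_compact => //; exact: continuous_subspaceT.
move=> [M [Mr HM]]; exists (`|M| + 1); first by rewrite addr_ge0.
move=> x Kx; apply: (HM (`|M| + 1)); last by exists x.
by rewrite (le_lt_trans (ler_norm _))// ltrDl.
Qed.

Lemma compact_funs_bounded (K : set 'rV[R]_3) (I : finType) (f : I -> 'rV[R]_3 -> R) :
  compact K -> (forall i, continuous (f i)) ->
  exists2 B : R, 0 <= B & forall i x, K x -> `|f i x| <= B.
Proof.
move=> cK cf.
have /choice[B HB] i := (let: ex_intro2 B a b := compact_fun_bounded cK (cf i) in
  ex_intro (fun B => 0 <= B /\ forall x, K x -> `|f i x| <= B) B (conj a b)).
exists (\sum_i B i); first by apply: sumr_ge0 => i _; have [] := HB i.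
move=> i x Kx; have [_ /(_ x Kx) /le_trans] := HB i; apply.
by rewrite (bigD1 i)//= lerDl; apply: sumr_ge0 => j _; have [] := HB j.
Qed.

Lemma derive_out_support (F : normedModType R) (f : 'rV[R]_3 -> F) x v :
  ~ closure [set x | f x != 0] x -> 'D_v f x = 0.
Proof.
move=> nx; have fx0 : \near x, f x = (fun _ => 0) x.
  have : nbhs x (~` closure [set x | f x != 0]).
    by apply: open_nbhs_nbhs; split => //; exact/closed_openC/closed_closure.
  apply: filterS => y ny /=; apply/eqP; apply: contrapT => /negP fy.
  exact/ny/subset_closure.
by rewrite (near_eq_derive _ fx0) derive_cst.
Qed.

End Lipschitz.

(** * Change of variables for surface measures *)

Section DensityTransfer.
Context d1 d2 (T1 : measurableType d1) (T2 : measurableType d2) (R : realType).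
Variables (mu : {measure set T1 -> \bar R}) (nu : {measure set T2 -> \bar R}).
Variables (D1 : set T1) (D2 : set T2) (Phi : T1 -> T2) (J : T1 -> R) (f : T2 -> R).
Hypotheses (mD1 : measurable D1) (mD2 : measurable D2).
Hypothesis mPhi : measurable_fun D1 Phi.
Hypothesis PhiD : forall x, D1 x -> D2 (Phi x).
Hypothesis mJ : measurable_fun D1 J.
Hypothesis J0 : forall x, D1 x -> 0 <= J x.
Hypothesis nuE : forall B, measurable B -> B `<=` D2 ->
  nu B = (\int[mu]_(x in D1 `&` Phi @^-1` B) (J x)%:E)%E.

Import HBNNSimple.
Local Open Scope ereal_scope.

(** [nuE] is the case of an indicator function; a simple function is a finite nonnegative
    combination of these over its range. *)
Lemma density_transfer_nnsfun (h : {nnsfun T2 >-> R}) :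
  \int[nu]_(y in D2) (h y)%:E = \int[mu]_(x in D1) (h (Phi x) * J x)%:E.
Proof.
have mhk (r : R) : measurable (h @^-1` [set r]) by [].
have m0 (r : R) : measurable_fun setT (\1_(h @^-1` [set r]) : T2 -> R).
  exact: measurable_indic.
have mi (r : R) : measurable_fun D1 (fun x => \1_(h @^-1` [set r]) (Phi x) : R).
  exact: (measurableT_comp (m0 r) mPhi).
have m1 (r : R) : measurable_fun D1 (fun x => r * \1_(h @^-1` [set r]) (Phi x) * J x)%R.
  by apply: measurable_funM => //; exact: measurable_funM.
have r0 (r : R) y : (0 <= r * \1_(h @^-1` [set r]) y)%R.
  exact: nnfun_muleindic_ge0.
transitivity (\sum_(k \in range h)
    \int[nu]_(x in D2) (k * \1_(h @^-1` [set k]) x)%:E).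
  under eq_integral do rewrite fimfunE -fsumEFin//.
  rewrite ge0_integral_fsum// => [y|y x _].
    by apply/measurable_EFinP; exact: measurable_funM.
  by rewrite lee_fin; exact: r0.
transitivity (\sum_(k \in range h)
    \int[mu]_(x in D1) (k * \1_(h @^-1` [set k]) (Phi x) * J x)%:E); last first.
  rewrite -ge0_integral_fsum//.
  - apply: eq_integral => x _; rewrite fsumEFin//; congr EFin.
    by rewrite fimfunE !fsbig_finite//= mulr_suml.
  - by move=> k; exact/measurable_EFinP.
  - by move=> k x Dx; rewrite lee_fin mulr_ge0 ?J0// r0.
apply: eq_fsbigr => k /[!inE] -[z _ hz].
have k0 : (0 <= k)%R by rewrite -hz.
rewrite integralZl_indic_nnsfun// integral_indic// nuE//; last exact: measurableI.
under [RHS]eq_integral do rewrite -mulrA EFinM.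
rewrite ge0_integralZl//; last 2 first.
- by apply/measurable_EFinP; exact: measurable_funM.
- by move=> x Dx; rewrite lee_fin mulr_ge0// J0.
congr (_ * _).
have -> : D1 `&` Phi @^-1` (h @^-1` [set k] `&` D2) = D1 `&` Phi @^-1` (h @^-1` [set k]).
  by apply/seteqP; split=> x /= [Dx]; [move=> []|split => //; split => //; exact: PhiD].
rewrite integral_mkcondr; apply: eq_integral => x _.
rewrite epatch_indic EFinM muleC; congr (_ * _).
Qed.

(** Monotone convergence, on both sides, along an increasing approximation of f by simple
    functions. *)
Lemma density_transfer : measurable_fun D2 f -> (forall y, D2 y -> (0 <= f y)%R) ->
  \int[nu]_(y in D2) (f y)%:E = \int[mu]_(x in D1) (f (Phi x) * J x)%:E.
Proof.
move=> mf f0.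
have mf' : measurable_fun D2 (EFin \o f) by exact/measurable_EFinP.
pose h := nnsfun_approx mD2 mf'.
have f0' y : D2 y -> 0 <= (EFin \o f) y by move=> Dy; rewrite lee_fin f0.
have mh n : measurable_fun D1 (h n \o Phi).
  exact: measurableT_comp.
transitivity (limn (fun n => \int[nu]_(y in D2) (h n y)%:E)).
  rewrite -monotone_convergence//.
  - apply: eq_integral => y /[!inE] yD; apply/esym/cvg_lim => //.
    exact: cvg_nnsfun_approx.
  - by move=> n; by apply/measurable_EFinP; exact: measurable_funTS.
  - by move=> n y _; rewrite lee_fin.
  - by move=> y _ m n mn; rewrite lee_fin; exact/lefP/nd_nnsfun_approx.
under eq_fun do rewrite density_transfer_nnsfun.
rewrite -monotone_convergence//.
- apply: eq_integral => x /[!inE] Dx; apply/cvg_lim => //.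
  under eq_fun do rewrite EFinM.
  rewrite EFinM; apply: cvgeZr => //.
  exact: (cvg_nnsfun_approx mD2 mf' f0' (PhiD Dx)).
- by move=> n; apply/measurable_EFinP; exact: (measurable_funM (mh n) mJ).
- by move=> n x Dx; rewrite lee_fin mulr_ge0// J0.
- move=> x Dx m n mn; rewrite lee_fin ler_wpM2r ?J0//.
  exact/lefP/nd_nnsfun_approx.
Qed.

End DensityTransfer.

(** * Measurability of open sets and continuous maps *)

Section OpenMeasurable.
Context {R : realType}.

Lemma open_measurable_prod (U : set (R * R)) : open U -> measurable U.
Proof.
move=> Uo.
pose box (q : rat * rat * rat) : set (R * R) :=
  ball (ratr q.1.1 : R) (ratr q.2 : R) `*` ball (ratr q.1.2 : R) (ratr q.2 : R).
pose F q := if `[< box q `<=` U >] then box q else set0.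
have -> : U = \bigcup_q F q.
  apply/seteqP; split=> [[x y] Uxy|p [q _]]; last first.
    by rewrite /F; case: asboolP => // + ?; apply.
  have /nbhs_ballP[e /= e0 He] : nbhs (x, y) U by exact: open_nbhs_nbhs.
  (* A centre within [r] of the point and a radius [r] below [e / 2] keep the whole rational box
     inside the ball of radius [e]. *)
  have [r /andP[r0 re]] : exists r : rat, 0 < (ratr r : R) < e / 2.
    have e2 : 0 < e / 2 by rewrite divr_gt0.
    have [r rin] := rat_in_itvoo e2.
    by exists r; move: rin; rewrite in_itv.
  have near (z : R) : exists q : rat, `|z - ratr q| < ratr r.
    have lt : z - ratr r < z + ratr r by lra.
    have [q] := rat_in_itvoo lt.
    rewrite in_itv/= => /andP[q1 q2]; exists q; rewrite ltr_distlC.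
    by apply/andP; split; lra.
  have [a xa] := near x; have [b yb] := near y.
  exists (a, b, r) => //; rewrite /F; case: asboolP => [_|].
    by split; rewrite /= -ball_normE /= distrC.
  case=> -[u v] [/= ua vb]; apply: He; split => /=.
    move: ua; rewrite -!ball_normE /= => ua.
    rewrite (le_lt_trans (ler_distD (ratr a) _ _))//; lra.
  move: vb; rewrite -!ball_normE /= => vb.
  rewrite (le_lt_trans (ler_distD (ratr b) _ _))//; lra.
apply: countable_bigcupT_measurable => // q.
rewrite /F; case: asboolP => // _; apply: measurableX; exact: measurable_ball.
Qed.

Lemma open_borel3 (O : set 'rV[R]_3) : open O -> measurable (O : set (borel3 R)).
Proof. by move=> Oo; exact: sub_sigma_algebra. Qed.

Lemma compact_borel3 (K : set 'rV[R]_3) : compact K -> measurable (K : set (borel3 R)).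
Proof.
move=> cK; rewrite -(setCK K); apply: measurableC; apply: open_borel3.
apply: closed_openC; apply: compact_closed => //; exact: norm_hausdorff.
Qed.

Lemma continuous_borel3 (f : 'rV[R]_3 -> R) (D : set (borel3 R)) :
  continuous f -> measurable_fun D (f : borel3 R -> R).
Proof.
move=> cf; apply: measurable_funTS.
apply: (measurability _ (RGenOInfty.measurableE R)).
move=> _ [_ [a ->] <-]; rewrite setTI; apply: open_borel3.
by apply: open_comp => [x _|]; [exact: cf|exact: interval_open].
Qed.

Lemma continuous_prod_measurable (U : set (R * R)) (f : R * R -> R) : open U ->
  (forall p, U p -> {for p, continuous f}) -> measurable_fun U f.
Proof.
move=> Uo cf; apply: (measurability _ (RGenOInfty.measurableE R)).
move=> _ [_ [a ->] <-]; apply: open_measurable_prod.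
rewrite openE => p [Up fp]; apply: filterI; first exact: open_nbhs_nbhs.
by apply: (cf p Up); apply: open_nbhs_nbhs; split => //; exact: interval_open.
Qed.

Lemma continuous_prod_borel3 (U : set (R * R)) (X : R * R -> 'rV[R]_3) : open U ->
  (forall p, U p -> {for p, continuous X}) -> measurable_fun U (X : R * R -> borel3 R).
Proof.
move=> Uo cX; apply: (@measurability _ _ _ (borel3 R) _ _ (@open 'rV[R]_3)) => //.
move=> _ [Z Zo <-]; apply: open_measurable_prod.
rewrite openE => p [Up Xp]; apply: filterI; first exact: open_nbhs_nbhs.
by apply: (cX p Up); exact: open_nbhs_nbhs.
Qed.

Lemma continuous_borel3_borel3 (T : 'rV[R]_3 -> 'rV[R]_3) : continuous T ->
  measurable_fun setT (T : borel3 R -> borel3 R).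
Proof.
move=> cT; apply: (@measurability _ _ _ (borel3 R) _ _ (@open 'rV[R]_3)) => //.
move=> _ [Z Zo <-]; rewrite setTI; apply: open_borel3.
by apply: open_comp => // x _; exact: cT.
Qed.

End OpenMeasurable.

Section CompactCover.
Import finmap.
Context {R : realType}.

(** The finite subcover is numbered so that its users can argue by induction on the number of
    patches. *)
Lemma compact_cover_nat (K : set 'rV[R]_3) (Good : set 'rV[R]_3 -> Prop) :
  compact K -> (forall s, K s -> exists O, [/\ open O, Good O & O s]) ->
  exists n (O : nat -> set 'rV[R]_3),
   (forall i, (i < n)%N -> open (O i) /\ Good (O i)) /\
   K `<=` [set x | exists2 i, (i < n)%N & O i x].
Proof.
move=> cK H.
have /choice[ O HO] s : exists O, K s -> [/\ open O, Good O & O s].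
  have [Ks|nKs] := pselect (K s); last by exists set0.
  by have [Z HZ] := H s Ks; exists Z.
have := cK; rewrite compact_cover => /(_ _ K O) [||D sD KD].
- by move=> s /HO[].
- by move=> s Ks; exists s => //; have [] := HO s Ks.
exists (size (enum_fset D)), (fun i => O (nth 0 (enum_fset D) i)); split=> [i il|x Kx].
  have /sD : nth 0 (enum_fset D) i \in D by exact: mem_nth.
  by move=> /set_mem /HO[].
have [s /= sD' Ox] := KD x Kx.
exists (index s (enum_fset D)); first by rewrite index_mem.
by rewrite nth_index.
Qed.

End CompactCover.

(** * Integration in charts and finiteness of surface measures *)

Section Charts.
Context {R : realType}.
Implicit Types (G : set 'rV[R]_3) (X : R * R -> 'rV[R]_3).

Lemma differentiable_dot (E : normedModType R) (f g : E -> 'rV[R]_3) x :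
  differentiable f x -> differentiable g x ->
  differentiable (fun x => dot (f x) (g x)) x.
Proof.
move=> df dg.
have -> : (fun x => dot (f x) (g x)) = (fun x => f x 0 i0) * (fun x => g x 0 i0) +
   (fun x => f x 0 i1) * (fun x => g x 0 i1) + (fun x => f x 0 i2) * (fun x => g x 0 i2).
  by apply/funext => y; rewrite dotE.
by do 2?apply: differentiableD; apply: differentiableM; exact: differentiable_comp_rV3.
Qed.

Lemma area_element_continuous X p :
  differentiable ('D_((1, 0) : R * R) X) p -> differentiable ('D_((0, 1) : R * R) X) p ->
  {for p, continuous (area_element X)}.
Proof.
move=> d1 d2; apply: (@continuous_comp _ _ _ _ (@Num.sqrt R)); last exact: sqrt_continuous.
apply: diff_cont; rewrite /gram.
pose f := 'D_((1, 0) : R * R) X; pose g := 'D_((0, 1) : R * R) X.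
have -> : (fun p => dot (f p) (f p) * dot (g p) (g p) - dot (f p) (g p) ^+ 2) =
  ((fun p => dot (f p) (f p)) * (fun p => dot (g p) (g p)) -
   (fun p => dot (f p) (g p)) * (fun p => dot (f p) (g p))).
  by apply/funext => q; rewrite expr2.
have d11 := differentiable_dot d1 d1; have d12 := differentiable_dot d1 d2.
have d22 := differentiable_dot d2 d2.
exact: (differentiableB (differentiableM d11 d22) (differentiableM d12 d12)).
Qed.

Lemma local_param_area_continuous G U X p : local_param G U X -> U p ->
  {for p, continuous (area_element X)}.
Proof.
move=> [Uo sX _ _ _] Up.
by apply: area_element_continuous; apply: (smooth_diff _ _ _ (smooth_derive _ _ _ _ sX)).
Qed.

Lemma local_param_continuous G U X p : local_param G U X -> U p ->
  {for p, continuous X}.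
Proof. by move=> [Uo sX _ _ _] Up; apply/diff_cont/(smooth_diff _ _ _ sX). Qed.

Lemma local_param_sub G U X : local_param G U X -> X @` U `<=` G.
Proof.
by move=> [Uo _ _ _ /(_ U Uo (@subset_refl _ _))[Z _ ->]] s [].
Qed.

Definition leb2 : {measure set (measurableTypeR R * measurableTypeR R) -> \bar R} :=
  (@lebesgue_measure R \x @lebesgue_measure R)%E.

Lemma chart_integral G (sigma : {measure set borel3 R -> \bar R}) U X
    (A : set (borel3 R)) (h : borel3 R -> R) :
  is_surface_measure G sigma -> local_param G U X ->
  measurable A -> A `<=` X @` U ->
  measurable_fun A h -> (forall s, A s -> 0 <= h s) ->
  (\int[sigma]_(s in A) (h s)%:E =
   \int[leb2]_(p in U `&` X @^-1` A) (h (X p) * area_element X p)%:E)%E.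
Proof.
move=> [_ sE] lp mA AX mh h0; have [Uo _ _ _ _] := lp.
have mU : measurable (U : set (R * R)) by exact: open_measurable_prod.
have mX : measurable_fun (U : set (R * R)) (X : R * R -> borel3 R).
  by apply: continuous_prod_borel3 => // p; exact: local_param_continuous lp.
have mD : measurable (U `&` X @^-1` A : set (R * R)) by exact: mX.
apply: density_transfer => //.
- exact: (measurable_funS mU (@subIsetl _ _ _) mX).
- by move=> p [].
- apply: (measurable_funS mU (@subIsetl _ _ _)).
  by apply: continuous_prod_measurable => // p; exact: local_param_area_continuous lp.
- by move=> p _; exact: sqrtr_ge0.
- move=> B mB BA; rewrite (sE U X B lp mB (subset_trans BA AX)).
  congr integral; apply/seteqP; split=> p /=; last by move=> [[]].
  by move=> [Up Bp]; split=> //; split=> //; exact: BA.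
Qed.

(** Near each parameter the area element is bounded on a small ball, and the image of that ball is a
    relatively open patch of finite measure; finitely many patches cover the surface. *)
Lemma compact_surface_finite G (sigma : {measure set borel3 R -> \bar R}) :
  closed_surface G -> is_surface_measure G sigma -> (sigma (G : set (borel3 R)) < +oo)%E.
Proof.
move=> [cG chG] sm; have [_ sE] := sm.
have mG : measurable (G : set (borel3 R)) by exact: compact_borel3.
pose fin_on (Z : set 'rV[R]_3) := (sigma (G `&` Z : set (borel3 R)) < +oo)%E.
have cov s : G s -> exists Z, [/\ open Z, fin_on Z & Z s].
  move=> Gs; have [U [X [lp [p Up <-]]]] := chG s Gs.
  have [Uo sX inj pos opn] := lp.
  have ca := local_param_area_continuous lp Up.
  have [d d0 Hd] := continuous_dist ca ltr01.
  have /nbhs_ballP[d' /= d'0 Hd'] : nbhs p U by exact: open_nbhs_nbhs.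
  pose m := Num.min d d'.
  have m0 : 0 < m by rewrite lt_min d0.
  have Wo : open (ball p m) by exact: ball_open.
  have WU : ball p m `<=` U.
    by apply: subset_trans Hd'; apply: le_ball; rewrite ge_min lexx orbT.
  have [Z Zo XW] := opn _ Wo WU.
  exists Z; rewrite /fin_on; split=> //; last first.
    have : (G `&` Z) (X p) by rewrite -XW; exists p => //; exact: ballxx.
    by case.
  have mGZ : measurable (G `&` Z : set (borel3 R)) by apply: measurableI => //; exact: open_borel3.
  rewrite (sE U X (G `&` Z) lp mGZ); last first.
    by rewrite -XW => _ [q qW <-]; exists q => //; exact: WU.
  (* Injectivity of the chart: no parameter outside the ball is mapped into the patch. *)
  have -> : U `&` X @^-1` (G `&` Z) = ball p m.
    rewrite -XW; apply/seteqP; split=> q /=.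
      by move=> [Uq [q' q'W Xq]]; rewrite -(inj q' q) ?inE//; exact: WU.
    by move=> qW; split; [exact: WU|exists q].
  have mW : measurable (ball p m : set (R * R)) by exact: open_measurable_prod.
  have mA : measurable_fun (ball p m : set (R * R)) (area_element X : R * R -> R).
    apply: (continuous_prod_measurable Wo) => q qW.
    exact: (local_param_area_continuous lp (WU q qW)).
  (* On the ball the area element is at most its value at the centre plus 1, by the choice of
     [d]. *)
  apply: (@le_lt_trans _ _ (\int[leb2]_(q in ball p m) ((area_element X p + 1)%:E))%E).
    apply: ge0_le_integral => //.
    - by move=> q _; rewrite lee_fin sqrtr_ge0.
    - exact/measurable_EFinP.
      - move=> q qW; rewrite lee_fin.
      have : `|p - q| < d.
        move: qW; rewrite -ball_normE /= => /lt_le_trans; apply.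
        by rewrite ge_min lexx.
      move=> /Hd; rewrite ltr_norml => /andP[+ _].
      by rewrite ltrBrDr addrC ltrBlDr => /ltW; rewrite addrC.
  rewrite integral_cst// /leb2 /=.
  have -> : ball p m = ball p.1 m `*` ball p.2 m by [].
  rewrite product_measure1E; [|exact: measurable_ball|exact: measurable_ball].
  rewrite (_ : (_ * (_ * _))%E =
    ((area_element X p + 1)%:E * ((m *+ 2)%:E * (m *+ 2)%:E))%E); last first.
    by congr (_ * (_ * _))%E; exact: lebesgue_measure_ball (ltW m0).
  by rewrite -!EFinM ltry.
have [n [ O [HO GO]]] := compact_cover_nat cG cov.
have fin k : (k <= n)%N -> (sigma (G `&` [set x | exists2 i, (i < k)%N & O i x] :
    set (borel3 R)) < +oo)%E /\ open [set x | exists2 i, (i < k)%N & O i x].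
  elim: k => [_|k IH kn].
    have -> : [set x | exists2 i, (i < 0)%N & O i x] = set0 by apply/seteqP; split=> x // [].
    by rewrite setI0 measure0; split => //; exact: open0.
  have [IH1 IH2] := IH (ltnW kn); have [Ok fk] := HO k kn.
  have -> : [set x | exists2 i, (i < k.+1)%N & O i x] =
     [set x | exists2 i, (i < k)%N & O i x] `|` O k.
    apply/seteqP; split=> x /=.
      by move=> [i]; rewrite ltnS leq_eqVlt => /orP[/eqP->|ik] Ox; [right|left; exists i].
    by move=> [[i ik Ox]|Ox]; [exists i => //; exact: ltnW|exists k].
  split; last exact: openU.
  rewrite setIUr; apply: le_lt_trans (measureU2 _ _ _) _; last exact: lte_add_pinfty.
    by apply: measurableI => //; exact: open_borel3.
  by apply: measurableI => //; exact: open_borel3.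
have [+ _] := fin n (leqnn n); apply: le_lt_trans; apply: le_measure; rewrite ?inE//.
  by apply: measurableI => //; apply: open_borel3; have [] := fin n (leqnn n).
by move=> s Gs; split=> //; exact: GO.
Qed.

End Charts.

Section ChangeOfVariables.
Context {R : realType}.
Variables (G : set 'rV[R]_3) (T : 'rV[R]_3 -> 'rV[R]_3) (J : 'rV[R]_3 -> R).
Variables (sigma sigma' : {measure set borel3 R -> \bar R}).
Hypothesis G_surface : closed_surface G.
Hypothesis T_cont : continuous T.
Hypothesis T_inj : {in G &, injective T}.
Hypothesis T_param : forall U X, local_param G U X -> local_param (T @` G) U (T \o X).
Hypothesis T_area : forall U X p, local_param G U X -> U p ->
  area_element (T \o X) p = J (X p) * area_element X p.
Hypothesis J0 : forall s, G s -> 0 <= J s.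
Hypothesis mJ : measurable_fun (G : set (borel3 R)) (J : borel3 R -> R).
Hypothesis sigmaP : is_surface_measure G sigma.
Hypothesis sigmaP' : is_surface_measure (T @` G) sigma'.

Let mG : measurable (G : set (borel3 R)).
Proof. by have [cG _] := G_surface; exact: compact_borel3. Qed.

Let mT : measurable_fun setT (T : borel3 R -> borel3 R).
Proof. exact: continuous_borel3_borel3. Qed.

Let mTG : measurable (T @` G : set (borel3 R)).
Proof.
have [cG _] := G_surface; apply: compact_borel3; apply: continuous_compact => //.
exact: continuous_subspaceT.
Qed.

Let mpre (B : set (borel3 R)) : measurable B -> measurable (G `&` T @^-1` B : set (borel3 R)).
Proof.
by move=> mB; apply: measurableI => //; rewrite -[X in measurable X]setTI; exact: mT.
Qed.

Let good (Z : set 'rV[R]_3) := forall B : set (borel3 R), measurable B ->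
  G `&` T @^-1` B `<=` Z ->
  (sigma' B = \int[sigma]_(s in G `&` T @^-1` B) (J s)%:E)%E.

(** [X] and [T \o X] have the same parameter domain, so both sides become integrals over one set of
    parameters, with integrands matched by [T_area]. *)
Let chart_good U X Z : local_param G U X -> X @` U = G `&` Z -> good Z.
Proof.
move=> lp XU B mB BZ; have [null' sE'] := sigmaP'.
have lp' := T_param lp.
have mB' : measurable (B `&` T @` G) by exact: measurableI.
(* [sigma'] is carried by the image surface, so B may be cut down to it before the chart formula,
   which needs a subset of the chart's image, is applied. *)
have -> : sigma' B = sigma' (B `&` T @` G).
  rewrite -{1}(setUIDK B (T @` G)) measureU ?setIDAC//; last 2 first.
  - exact: measurableD.
  - by apply/seteqP; split=> x // [[_ ?] []].
  rewrite [X in (_ + X)%E](_ : _ = 0%E) ?adde0//; last first.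
    apply: (@subset_measure0 _ _ _ sigma' _ (~` (T @` G))) => //.
    - exact: measurableD.
    - exact: measurableC.
rewrite (sE' U (T \o X) _ lp' mB'); last first.
  move=> t [Bt [s Gs Tst]]; have : (X @` U) s.
    by rewrite XU; split=> //; apply: BZ; split => //=; rewrite Tst.
  by move=> [p Up Xp]; exists p => //=; rewrite Xp.
rewrite (chart_integral sigmaP lp (mpre mB)); first last.
- by move=> s [Gs _]; exact: J0.
- by apply: measurable_funS mJ => //; exact: subIsetl.
- by move=> s [Gs Bs]; rewrite XU; split=> //; exact: BZ.
have -> : U `&` (T \o X) @^-1` (B `&` T @` G) = U `&` X @^-1` (G `&` T @^-1` B).
  apply/seteqP; split=> p /= [Up].
    by move=> [BX _]; split=> //; split=> //; apply: (local_param_sub lp); exists p.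
  by move=> [GX BX]; split=> //; split=> //; exists (X p).
by apply: eq_integral => p /[!inE] -[Up _]; rewrite (T_area lp Up).
Qed.

Lemma change_of_variables_set (B : set (borel3 R)) : measurable B ->
  (sigma' B = \int[sigma]_(s in G `&` T @^-1` B) (J s)%:E)%E.
Proof.
have [cG chG] := G_surface.
have cov s : G s -> exists Z, [/\ open Z, good Z & Z s].
  move=> Gs; have [U [X [lp sX]]] := chG s Gs.
  have [Uo _ _ _ opn] := lp; have [Z Zo XU] := opn U Uo (@subset_refl _ _).
  exists Z; split=> //; first exact: chart_good lp XU.
  by move: sX; rewrite XU => -[].
have [n [Z [HZ GZ]]] := compact_cover_nat cG cov.
(* Induction on the number of patches needed: C is split into a part whose preimage lies in patch k
   and a rest covered by the first k patches. *)
have step k (C : set (borel3 R)) : (k <= n)%N -> measurable C ->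
    G `&` T @^-1` C `<=` [set x | exists2 i, (i < k)%N & Z i x] ->
    (sigma' C = \int[sigma]_(s in G `&` T @^-1` C) (J s)%:E)%E.
  elim: k C => [|k IH] C kn mC CZ.
    have [null' _] := sigmaP'.
    have C0 : G `&` T @^-1` C = set0 by apply/seteqP; split=> s // /CZ[].
    rewrite C0 integral_set0; apply: (@subset_measure0 _ _ _ sigma' _ (~` (T @` G))) => //.
      exact: measurableC.
    move=> t Ct [s Gs st]; have : (G `&` T @^-1` C) s by split=> //=; rewrite st.
    by rewrite C0.
  have [Zo gZ] := HZ k kn.
  (* An open set of the target whose preimage in [G] is exactly patch k: [G] minus the patch is
     compact, hence so is its image, and injectivity of [T] separates the two. It makes both pieces
     of C Borel. *)
  pose Z' := ~` (T @` (G `\` Z k)).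
  have Z'o : open Z'.
    apply: closed_openC; apply: compact_closed; first exact: norm_hausdorff.
    apply: continuous_compact; first exact: continuous_subspaceT.
    apply: (subclosed_compact _ cG); last by move=> s [].
    rewrite setDE; apply: closedI; last exact: open_closedC.
    by apply: compact_closed => //; exact: norm_hausdorff.
  have mZ' : measurable (Z' : set (borel3 R)) by exact: open_borel3.
  have Z'E s : G s -> Z' (T s) <-> Z k s.
    move=> Gs; split=> [nZ|Zs [t [Gt nZt]]].
      by apply: contrapT => nZs; apply: nZ; exists s.
    by move=> /T_inj; rewrite !inE => /(_ Gt Gs) ts; apply: nZt; rewrite ts.
  have CE : C = (C `&` Z') `|` (C `\` Z') by rewrite setUIDK.
  have dj : (C `&` Z') `&` (C `\` Z') = set0.
    by apply/seteqP; split=> x // [[_ ?] []].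
  have SU : sigma' C = (sigma' (C `&` Z') + sigma' (C `\` Z'))%E.
    by rewrite {1}CE; apply: measureU => //; [exact: measurableI|exact: measurableD].
  rewrite SU gZ; [|exact: measurableI|].
    rewrite (IH (C `\` Z')); [|exact: ltnW|exact: measurableD|].
      have -> : G `&` T @^-1` C = (G `&` T @^-1` (C `&` Z')) `|` (G `&` T @^-1` (C `\` Z')).
        by rewrite -setIUr -preimage_setU -CE.
      rewrite ge0_integral_setU//.
      - by apply: mpre; exact: measurableI.
      - by apply: mpre; exact: measurableD.
      - rewrite -setIUr; apply/measurable_EFinP.
        exact: (measurable_funS mG (@subIsetl _ _ _) mJ).
      - by rewrite -setIUr => s [Gs _]; rewrite lee_fin; exact: J0.
      - rewrite disj_set2E; apply/eqP/seteqP; split=> s //= [[_ [_ z1]] [_ [_ z2]]].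
        exact: z2.
    move=> s [Gs [Cs nZ's]]; have [|i] := CZ s; first by split.
    rewrite ltnS leq_eqVlt => /orP[/eqP->|ik] Zs; last by exists i.
    by exfalso; apply: nZ's; exact/Z'E.
  by move=> s [Gs [_ /Z'E]]; apply.
by move=> mB; apply: (step n) => // s [Gs _]; exact: GZ.
Qed.

Lemma change_of_variables (f : 'rV[R]_3 -> R) :
  measurable_fun (T @` G : set (borel3 R)) (f : borel3 R -> R) ->
  (forall s, (T @` G) s -> 0 <= f s) ->
  (\int[sigma']_(y in T @` G) (f y)%:E = \int[sigma]_(s in G) (f (T s) * J s)%:E)%E.
Proof.
move=> mf f0; apply: density_transfer => //.
- exact: (measurable_funTS mT).
- by move=> B mB _; exact: change_of_variables_set.
Qed.

End ChangeOfVariables.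

(** * The sphere *)

Section DeriveRules.
Context {R : realType} {E : normedModType R}.
Implicit Types (f g : E -> R) (x v : E).

Lemma is_derive_add f g x v (df dg : R) : is_derive x v f df -> is_derive x v g dg ->
  is_derive x v (fun y => f y + g y) (df + dg).
Proof. by move=> hf hg; exact: is_deriveD. Qed.

Lemma is_derive_sub f g x v (df dg : R) : is_derive x v f df -> is_derive x v g dg ->
  is_derive x v (fun y => f y - g y) (df - dg).
Proof. by move=> hf hg; exact: is_deriveB. Qed.

Lemma is_derive_mul f g x v (df dg : R) : is_derive x v f df -> is_derive x v g dg ->
  is_derive x v (fun y => f y * g y) (df * g x + f x * dg).
Proof.
move=> hf hg; have := is_deriveM hf hg; rewrite /GRing.scale /= => h.
by rewrite addrC (mulrC df).
Qed.

Lemma is_derive_const x v (a : R) : is_derive x v (fun _ : E => a) 0.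
Proof. exact: is_derive_cst. Qed.

Lemma is_derive_invf f x v (df : R) : f x != 0 -> is_derive x v f df ->
  is_derive x v (fun y => (f y)^-1) (- ((f x)^-1 * (f x)^-1) * df).
Proof.
move=> f0 [d dE]; apply: DeriveDef; first exact: derivableV.
by rewrite deriveV// dE -exprVn expr2.
Qed.

End DeriveRules.

Section Sphere.
Context {R : realType}.
Variables (c : 'rV[R]_3) (r : R).
Hypothesis r0 : 0 < r.

Definition sphere : set 'rV[R]_3 := [set x | dot (x - c) (x - c) = r ^+ 2].

Lemma differentiable_subc x : differentiable (fun x : 'rV[R]_3 => x - c) x.
Proof. exact: differentiableB. Qed.

Lemma dist_sqr_continuous : continuous (fun x : 'rV[R]_3 => dot (x - c) (x - c)).
Proof.
move=> x; apply: diff_cont; apply: differentiable_dot; exact: differentiable_subc.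
Qed.

Lemma eballE : eball c r = [set x | dot (x - c) (x - c) < r ^+ 2].
Proof.
apply/seteqP; split=> x /=; rewrite -enorm_sqr ltr_pXn2r ?nnegrE ?enorm_ge0//; exact: ltW.
Qed.

Lemma sphere_closed : closed sphere.
Proof.
rewrite /sphere (_ : mkset _ = (fun x => dot (x - c) (x - c)) @^-1` [set r ^+ 2])//.
by apply: closed_comp => [x _|]; [exact: dist_sqr_continuous|exact: closed_eq].
Qed.

Lemma sphere_coord s i : sphere s -> `|(s - c) 0 i| <= r.
Proof.
rewrite /sphere /= => ss; apply: (le_trans (coord_le_enorm _ i)).
by rewrite /enorm ss sqrtr_sqr gtr0_norm.
Qed.

Lemma sphere_compact : compact sphere.
Proof.
apply: bounded_closed_compact; last exact: sphere_closed.
exists (`|c| + r); split; first exact: num_real.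
move=> M lM x; rewrite /sphere/= => sx; rewrite (le_trans _ (ltW lM))//.
rewrite -{1}(subrK c x) (le_trans (ler_normD _ _))// addrC lerD2l.
apply: norm_rV3_le; first exact: ltW.
by move=> i; exact: sphere_coord.
Qed.

Lemma frontier_eball : frontier (eball c r) = sphere.
Proof.
have cd := dist_sqr_continuous.
have bo : open (eball c r).
  rewrite eballE (_ : mkset _ = (fun x => dot (x - c) (x - c)) @^-1` [set x | x < r ^+ 2])//.
  by apply: open_comp => [x _|]; [exact: cd|exact: open_lt].
rewrite /frontier; have -> : (eball c r)° = eball c r by exact/(interior_id _).1.
apply/seteqP; split=> x.
  move=> [clx]; rewrite eballE /sphere /= => /negP; rewrite -leNgt => ge.
  apply/eqP; rewrite eq_le ge andbT.
  have cl : closed [set x | dot (x - c) (x - c) <= r ^+ 2].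
    rewrite (_ : mkset _ = (fun x => dot (x - c) (x - c)) @^-1` [set x | x <= r ^+ 2])//.
    by apply: closed_comp => [y _|]; [exact: cd|exact: closed_le].
  have : closure (eball c r) `<=` [set x | dot (x - c) (x - c) <= r ^+ 2].
    rewrite [X in _ `<=` X]((closure_id _).1 cl); apply: closure_subset.
    by rewrite eballE => y /= /ltW.
  exact.
move=> sx; split; last by rewrite eballE /= sx ltxx.
move=> B Bx.
(* Moving radially inwards multiplies x - c by 1 - t, which exhibits x as a limit of points of the
   ball. *)
pose gam (t : R) := x - t *: (x - c).
have cg : {for 0, continuous gam}.
  rewrite /continuous_at; apply: cvgB; first exact: cvg_cst.
  by apply: cvgZr_tmp; exact: cvg_id.
have : nbhs (0 : R) (gam @^-1` B).
  by apply: (cg B); rewrite /gam scale0r subr0.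
move=> /nbhs_ballP[d /= d0 Hd].
pose t := Num.min (d / 2) 1.
have t0 : 0 < t by rewrite lt_min divr_gt0//= ltr01.
have t1 : t <= 1 by rewrite ge_min lexx orbT.
have td : t < d.
  by apply: le_lt_trans (_ : d / 2 < d); [rewrite ge_min lexx|lra].
exists (gam t); split; last first.
  by apply: Hd; rewrite -ball_normE /= sub0r normrN gtr0_norm.
rewrite eballE /= /gam.
have -> : x - t *: (x - c) - c = (1 - t) *: (x - c).
  by apply: rV3P; rewrite !mxE; ring.
rewrite dotZl dotZr mulrA sx gtr_pMl ?exprn_gt0//.
nra.
Qed.

(* Stereographic projection from the pole c + r * (0, 0, sg), with sg = 1 or -1. *)
Definition stereo (sg : R) (p : R * R) : 'rV[R]_3 :=
  let w := (1 + p.1 * p.1 + p.2 * p.2)^-1 in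
  mk3 (c 0 i0 + r * (2 * p.1 * w)) (c 0 i1 + r * (2 * p.2 * w))
      (c 0 i2 + r * (sg * (1 - 2 * w))).

Lemma stereo_den_gt0 (p : R * R) : 0 < 1 + p.1 * p.1 + p.2 * p.2.
Proof. by rewrite -addrA ltr_pwDl// addr_ge0// -expr2 sqr_ge0. Qed.

Lemma smooth_stereo sg : smooth_on setT (stereo sg).
Proof.
have oT : open [set: R * R] by exact: openT.
have sw : smooth_on setT (fun p : R * R => (1 + p.1 * p.1 + p.2 * p.2)^-1).
  apply: smoothV => //; first by move=> p _; rewrite gt_eqF// stereo_den_gt0.
  apply: smoothD => //; last by apply: smoothM => //; exact: smooth_snd.
  apply: smoothD => //; first exact: smooth_cst.
  by apply: smoothM => //; exact: smooth_fst.
have s1 : smooth_on setT (fun p : R * R => p.1) by exact: smooth_fst.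
have s2 : smooth_on setT (fun p : R * R => p.2) by exact: smooth_snd.
have sc (a : R) : smooth_on setT (fun _ : R * R => a) by exact: smooth_cst.
apply/smooth_rV3 => //; apply: ord3P; rewrite /stereo.
- apply: (smooth_ext oT (f := fun p => c 0 i0 + r * (2 * p.1 * (1 + p.1 * p.1 + p.2 * p.2)^-1))).
    by move=> p _; rewrite mk30.
  by apply: smoothD => //; apply: smoothM => //; apply: smoothM => //; exact: smoothM.
- apply: (smooth_ext oT (f := fun p => c 0 i1 + r * (2 * p.2 * (1 + p.1 * p.1 + p.2 * p.2)^-1))).
    by move=> p _; rewrite mk31.
  by apply: smoothD => //; apply: smoothM => //; apply: smoothM => //; exact: smoothM.
- apply: (smooth_ext oT
    (f := fun p => c 0 i2 + r * (sg * (1 - 2 * (1 + p.1 * p.1 + p.2 * p.2)^-1)))).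
    by move=> p _; rewrite mk32.
  apply: smoothD => //; apply: smoothM => //; apply: smoothM => //.
  by apply: smoothB => //; exact: smoothM.
Qed.

Lemma derive_stereo sg p (v : R * R) :
  let w := (1 + p.1 * p.1 + p.2 * p.2)^-1 in
  let dw := - (w * w) * (2 * p.1 * v.1 + 2 * p.2 * v.2) in
  'D_v (stereo sg) p =
    mk3 (r * (2 * (v.1 * w + p.1 * dw))) (r * (2 * (v.2 * w + p.2 * dw)))
        (r * (sg * (- (2 * dw)))).
Proof.
move=> w dw.
have d1 : is_derive p v (fst : R * R -> R) v.1.
  have [d E] := linear_derive p v (fun _ _ _ => erefl) (fun x => @cvg_fst _ _ _ _ _).
  exact: DeriveDef (diff_derivable d) E.
have d2 : is_derive p v (snd : R * R -> R) v.2.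
  have [d E] := linear_derive p v (fun _ _ _ => erefl) (fun x => @cvg_snd _ _ _ _ _).
  exact: DeriveDef (diff_derivable d) E.
pose q (x : R * R) := 1 + x.1 * x.1 + x.2 * x.2.
have q0 : q p != 0 by rewrite /q gt_eqF// stereo_den_gt0.
have K (a : R) := is_derive_const p v a.
have dq : is_derive p v q (2 * p.1 * v.1 + 2 * p.2 * v.2).
  have h := is_derive_add (is_derive_add (K 1) (is_derive_mul d1 d1)) (is_derive_mul d2 d2).
  by apply: (is_derive_eq h); ring.
have dV : is_derive p v (fun x => (q x)^-1) dw by exact: is_derive_invf.
have E : is_derive p v (stereo sg) (mk3 (r * (2 * (v.1 * w + p.1 * dw)))
    (r * (2 * (v.2 * w + p.2 * dw))) (r * (sg * (- (2 * dw))))).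
  apply: is_derive_rV3; apply: ord3P; rewrite !mk3E.
  - rewrite (_ : (fun x => _) = (fun x => c 0 i0 + r * (2 * x.1 * (q x)^-1))); last first.
      by apply/funext => x; rewrite /stereo mk30.
    apply: (is_derive_eq (is_derive_add (K _)
      (is_derive_mul (K _) (is_derive_mul (is_derive_mul (K _) d1) dV)))).
    by rewrite -/(q p) /w -/(q p); ring.
  - rewrite (_ : (fun x => _) = (fun x => c 0 i1 + r * (2 * x.2 * (q x)^-1))); last first.
      by apply/funext => x; rewrite /stereo mk31.
    apply: (is_derive_eq (is_derive_add (K _)
      (is_derive_mul (K _) (is_derive_mul (is_derive_mul (K _) d2) dV)))).
    by rewrite -/(q p) /w -/(q p); ring.
  - rewrite (_ : (fun x => _) = (fun x => c 0 i2 + r * (sg * (1 - 2 * (q x)^-1)))); last first.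
      by apply/funext => x; rewrite /stereo mk32.
    apply: (is_derive_eq (is_derive_add (K _) (is_derive_mul (K _)
      (is_derive_mul (K _) (is_derive_sub (K _) (is_derive_mul (K _) dV)))))).
    ring.
by rewrite derive_val.
Qed.

Let stereo_identity (a1 b1 k1 a2 b2 k2 sg : R) : sg ^+ 2 = 1 ->
  r * a1 * (r * a2) + r * b1 * (r * b2) + r * (sg * k1) * (r * (sg * k2)) =
  r ^+ 2 * (a1 * a2 + b1 * b2 + k1 * k2).
Proof.
move=> sg2; transitivity (r ^+ 2 * (a1 * a2 + b1 * b2 + sg ^+ 2 * (k1 * k2))); first by ring.
by rewrite sg2 mul1r.
Qed.

Lemma stereo_area_gt0 sg p : sg ^+ 2 = 1 -> 0 < area_element (stereo sg) p.
Proof.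
move=> sg2; rewrite /area_element sqrtr_gt0 !derive_stereo /gram !dotE !mk3E /=.
rewrite !stereo_identity//.
have := stereo_den_gt0 p; move: p.1 p.2 => u v Q0.
(* Stereographic projection is conformal with factor 2 r / (1 + u^2 + v^2), and the Gram determinant
   is the fourth power of this factor. *)
set g := (X in 0 < X).
have -> : g = r ^+ 4 * 16 * (1 + u * u + v * v)^-1 ^+ 4.
  by rewrite /g; field; rewrite gt_eqF.
by rewrite mulr_gt0// ?exprn_gt0 ?invr_gt0// mulr_gt0// exprn_gt0.
Qed.

Let coordn (x : 'rV[R]_3) i := (x 0 i - c 0 i) / r.

Definition unstereo (sg : R) (x : 'rV[R]_3) : R * R :=
  (coordn x i0 / (1 - sg * coordn x i2), coordn x i1 / (1 - sg * coordn x i2)).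

Lemma stereoK sg p : sg ^+ 2 = 1 ->
  1 - sg * coordn (stereo sg p) i2 != 0 /\ unstereo sg (stereo sg p) = p.
Proof.
move=> sg2; have Q0 := stereo_den_gt0 p; rewrite /unstereo /coordn /stereo !mk3E.
have rn : r != 0 by rewrite gt_eqF.
set w := (1 + _ + _)^-1.
have w0 : w != 0 by rewrite invr_eq0 gt_eqF.
have E : 1 - sg * ((c 0 i2 + r * (sg * (1 - 2 * w)) - c 0 i2) / r) = 2 * w.
  rewrite (_ : _ / r = sg * (1 - 2 * w)); last by field.
  by rewrite mulrA -expr2 sg2; ring.
rewrite E; split; first by rewrite mulf_neq0.
rewrite [RHS]surjective_pairing; congr (_, _); field; exact/andP.
Qed.

Lemma stereo_sphere sg p : sg ^+ 2 = 1 -> sphere (stereo sg p).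
Proof.
move=> sg2; have Q0 := stereo_den_gt0 p; rewrite /sphere /= dotE /stereo !mxE /= -/(mk3 _ _ _).
have h (a b : R) : a + b - a = b by ring.
rewrite !h -[r * (2 * p.1 * _)]mulr1 -[r * (2 * p.2 * _)]mulr1 !mulr1.
rewrite stereo_identity// -[RHS]mulr1; congr (_ * _).
by move: p.1 p.2 Q0 => u v Q0; field; rewrite gt_eqF.
Qed.

Lemma unstereoK sg x : sg ^+ 2 = 1 -> sphere x -> 1 - sg * coordn x i2 != 0 ->
  stereo sg (unstereo sg x) = x.
Proof.
move=> sg2; rewrite /sphere /= dotE !mxE => sx den.
have rn : r != 0 by rewrite gt_eqF.
have E i : x 0 i = c 0 i + r * coordn x i by rewrite /coordn; field.
have S : coordn x i0 ^+ 2 + coordn x i1 ^+ 2 + coordn x i2 ^+ 2 = 1.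
  apply: (mulfI (_ : r ^+ 2 != 0)); first by rewrite expf_neq0.
  by rewrite mulr1 -[RHS]sx /coordn; field.
have q : (1 + (unstereo sg x).1 * (unstereo sg x).1 + (unstereo sg x).2 * (unstereo sg x).2)^-1
   = (1 - sg * coordn x i2) / 2.
  rewrite /unstereo /= ; move: (coordn x i0) (coordn x i1) (coordn x i2) den S => n0 n1 n2 den S.
  have -> : 1 + n0 / (1 - sg * n2) * (n0 / (1 - sg * n2)) +
      n1 / (1 - sg * n2) * (n1 / (1 - sg * n2)) =
     ((1 - sg * n2) ^+ 2 + (n0 ^+ 2 + n1 ^+ 2)) / (1 - sg * n2) ^+ 2 by field.
  have -> : n0 ^+ 2 + n1 ^+ 2 = 1 - sg ^+ 2 * n2 ^+ 2 by rewrite sg2 mul1r -S; ring.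
  have -> : (1 - sg * n2) ^+ 2 + (1 - sg ^+ 2 * n2 ^+ 2) = 2 * (1 - sg * n2) by ring.
  by field.
apply: rV3P; rewrite /stereo !mk3E q E; congr (_ + _ * _); rewrite /unstereo /=.
- by move: (coordn x i0) (coordn x i2) den => n0 n2 den; field.
- by move: (coordn x i1) (coordn x i2) den => n0 n2 den; field.
- transitivity (sg ^+ 2 * coordn x i2); [by field|by rewrite sg2 mul1r].
Qed.

Let coordn_diff i x : differentiable (fun x => coordn x i) x.
Proof.
have -> : (fun x => coordn x i) = (fun x : 'rV[R]_3 => x 0 i - c 0 i) * cst (r^-1) by [].
apply: differentiableM => //; apply: differentiableB => //; exact: differentiable_coord.
Qed.

Let pole_diff sg x : differentiable (fun x => 1 - sg * coordn x i2) x.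
Proof.
have -> : (fun x => 1 - sg * coordn x i2) = cst 1 - cst sg * (fun x => coordn x i2) by [].
by apply: differentiableB => //; apply: differentiableM => //; exact: coordn_diff.
Qed.

Lemma unstereo_continuous sg x : 1 - sg * coordn x i2 != 0 ->
  {for x, continuous (unstereo sg)}.
Proof.
move=> den; have dden := differentiableV (pole_diff sg x) den.
by apply: diff_cont; apply: differentiable_pair; apply: differentiableM => //; exact: coordn_diff.
Qed.

Lemma stereo_param sg : sg ^+ 2 = 1 -> local_param sphere setT (stereo sg).
Proof.
move=> sg2; split; first exact: openT.
- exact: smooth_stereo.
- move=> p q _ _ pq; have [_ <-] := stereoK p sg2; have [_ <-] := stereoK q sg2.
  by rewrite pq.
- by move=> p _; exact: stereo_area_gt0.
- move=> W Wo _.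
  (* At the pole [unstereo] takes the default value (0, 0), which may lie in W; the condition on the
     denominator removes the pole and secures continuity. *)
  exists [set x | 1 - sg * coordn x i2 != 0 /\ W (unstereo sg x)].
    rewrite openE => x [den Wx]; rewrite /interior; near=> y; split; near: y.
      have cden := diff_cont (pole_diff sg x).
      exact: (cvgr_neq0 _ cden den).
    by apply: (unstereo_continuous den); exact: open_nbhs_nbhs.
  apply/seteqP; split=> x.
    move=> [p Wp <-]; split; first exact: stereo_sphere.
    by have [den uE] := stereoK p sg2; split=> //=; rewrite uE.
  by move=> [sx [den Wx]]; exists (unstereo sg x) => //; exact: unstereoK.
Unshelve. all: by end_near. Qed.

Lemma sphere_surface : closed_surface sphere.
Proof.
split; first exact: sphere_compact.
move=> s ss; have rn : r != 0 by rewrite gt_eqF.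
(* Each projection misses only its own pole, and that pole is covered by the opposite projection. *)
have [d1|d1] := eqVneq (1 - 1 * coordn s i2) 0.
  exists setT, (stereo (-1)); split; first by apply: stereo_param; rewrite sqrrN expr1n.
  exists (unstereo (-1) s) => //; apply: unstereoK => //; first by rewrite sqrrN expr1n.
  by rewrite (_ : coordn s i2 = 1); [rewrite mulr1 opprK|lra].
exists setT, (stereo 1); split; first by apply: stereo_param; rewrite expr1n.
by exists (unstereo 1 s) => //; apply: unstereoK => //; rewrite expr1n.
Qed.

End Sphere.

(** * The image of a sphere under a diffeomorphism *)

Section VectorCalculus.
Context {R : realType} {E : normedModType R}.
Implicit Types (f g : E -> 'rV[R]_3) (x v : E).

Lemma is_derive_dot f g x v (df dg : 'rV[R]_3) :
  is_derive x v f df -> is_derive x v g dg ->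
  is_derive x v (fun y => dot (f y) (g y)) (dot df (g x) + dot (f x) dg).
Proof.
move=> hf hg; have cf i := is_derive_coord _ _ _ _ i hf; have cg i := is_derive_coord _ _ _ _ i hg.
rewrite (_ : (fun y => _) = (fun y => f y 0 i0 * g y 0 i0 + f y 0 i1 * g y 0 i1 +
  f y 0 i2 * g y 0 i2)); last by apply/funext => y; rewrite dotE.
have h := is_derive_add (is_derive_add (is_derive_mul (cf i0) (cg i0))
  (is_derive_mul (cf i1) (cg i1))) (is_derive_mul (cf i2) (cg i2)).
apply: (is_derive_eq h); rewrite !dotE; ring.
Qed.

Lemma differentiable_cross f g x :
  differentiable f x -> differentiable g x -> differentiable (fun y => cross (f y) (g y)) x.
Proof.
move=> df dg; have cf i := differentiable_comp_rV3 _ _ i df.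
have cg i := differentiable_comp_rV3 _ _ i dg.
apply: differentiable_rV3; apply: ord3P.
- rewrite (_ : (fun y => _) = (fun y => f y 0 i1) * (fun y => g y 0 i2) -
    (fun y => f y 0 i2) * (fun y => g y 0 i1)); last by apply/funext => y; rewrite mk30.
  exact: (differentiableB (differentiableM (cf i1) (cg i2)) (differentiableM (cf i2) (cg i1))).
- rewrite (_ : (fun y => _) = (fun y => f y 0 i2) * (fun y => g y 0 i0) -
    (fun y => f y 0 i0) * (fun y => g y 0 i2)); last by apply/funext => y; rewrite mk31.
  exact: (differentiableB (differentiableM (cf i2) (cg i0)) (differentiableM (cf i0) (cg i2))).
- rewrite (_ : (fun y => _) = (fun y => f y 0 i0) * (fun y => g y 0 i1) -
    (fun y => f y 0 i1) * (fun y => g y 0 i0)); last by apply/funext => y; rewrite mk32.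
  exact: (differentiableB (differentiableM (cf i0) (cg i1)) (differentiableM (cf i1) (cg i0))).
Qed.

Lemma differentiable_scale (k : E -> R) f x : differentiable k x -> differentiable f x ->
  differentiable (fun y => k y *: f y) x.
Proof.
move=> dk df; apply: differentiable_rV3 => i.
rewrite (_ : (fun y => _) = k * (fun y => f y 0 i)); last by apply/funext => y; rewrite mxE.
by apply: differentiableM => //; exact: differentiable_comp_rV3.
Qed.

Lemma differentiable_sqrt (f : E -> R) x : 0 < f x -> differentiable f x ->
  differentiable (fun y => Num.sqrt (f y)) x.
Proof.
move=> f0 df; apply: (@differentiable_comp _ _ _ _ f Num.sqrt) => //.
by apply/derivable1_diffP; have [] := is_derive1_sqrt f0.
Qed.

End VectorCalculus.

(** * Differentiability of an inverse map *)

Section InverseMap.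
Context {R : realType} {E F : normedModType R}.
Variables (T : E -> F) (S : F -> E) (s : E) (N : {linear F -> E}).
Variable K : R.
Hypothesis dT : differentiable T s.
Hypothesis ST : cancel T S.
Hypothesis TS : cancel S T.
Hypothesis S_lip : forall y y', `|S y - S y'| <= K * `|y - y'|.
Hypothesis N_cont : continuous N.
Hypothesis NT : forall b, N ('D_b T s) = b.

(** With k = S (h + T s) - s the Lipschitz bound gives k = O(h), while h = T (k + s) - T s = 'd T s
    k + o(k). Applying [N], a left inverse of the derivative, yields k = N h + o(h). *)
Lemma inverse_is_diff : is_diff (T s) S N.
Proof.
have [M M0 NM] : exists2 M, 0 < M & forall x, `|N x| <= M * `|x|.
  exact: linear_lipschitz.
have K0 : 0 <= `|K| by [].
have SE : S \o shift (T s) = cst (S (T s)) + N +o_ 0 id.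
  apply/eqaddoP => eps eps0.
  (* Chosen so that the norm bound [M] of [N] times [eps'] times the Lipschitz factor [|K| + 1]
     equals [eps]. *)
  pose eps' := eps / (M * (`|K| + 1)).
  have K1 : 0 < `|K| + 1 by rewrite ltr_wpDl.
  have eps'0 : 0 < eps' by rewrite divr_gt0// mulr_gt0.
  have /eqaddoP/(_ _ eps'0) := diff_locally dT.
  move=> /nbhs_ballP[d /= d0 Hd].
  near=> h.
  pose k := S (h + T s) - s.
  have kh : `|k| <= (`|K| + 1) * `|h|.
    rewrite /k -{2}(ST s) (le_trans (S_lip _ _))// addrK ler_wpM2r//.
    by rewrite (le_trans (ler_norm _))// lerDl.
  have kd : `|k| < d.
    rewrite (le_lt_trans kh)// mulrC -ltr_pdivlMr//.
    by near: h; apply: nbhs0_lt; rewrite divr_gt0.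
  have := Hd k; rewrite -ball_normE /= sub0r normrN => /(_ kd).
  rewrite -[X in `|X| <= _ -> _]/(T (k + s) - (T s + 'd T s k)).
  rewrite /k subrK TS -/k => Tk.
  rewrite -[X in `|X| <= _]/(S (h + T s) - (S (T s) + N h)) ST.
  have -> : S (h + T s) - (s + N h) = - N (h + T s - (T s + 'd T s k)).
    have -> : h + T s - (T s + 'd T s k) = h - 'd T s k by rewrite opprD addrA addrK.
    by rewrite -deriveE// linearB NT opprB /k -addrA opprD.
  rewrite normrN (le_trans (NM _))//.
  apply: (@le_trans _ _ (M * (eps' * `|k|))); first by rewrite ler_pM2l.
  apply: (@le_trans _ _ (M * (eps' * ((`|K| + 1) * `|h|)))).
    by rewrite ler_pM2l// ler_pM2l.
  rewrite /eps' le_eqVlt; apply/orP; left; apply/eqP.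
  by field; rewrite !gt_eqF.
have dSE : 'd S (T s) = N :> (F -> E) by exact: diff_unique.
by apply: DiffDef => //; apply/diff_locallyP; rewrite dSE.
Unshelve. all: by end_near. Qed.

End InverseMap.

(** * Tangent frames and curves of the sphere *)

Section SphereTangent.
Context {R : realType}.

(* An orthonormal frame of the plane orthogonal to the unit vector n: the
   image of (e_0, e_1) under the rotation taking e_2 to n. At n = - e_2 the
   convention x / 0 = 0 gives (e_0, e_1). *)
Definition frame (n : 'rV[R]_3) (i : 'I_3) : 'rV[R]_3 :=
  e_ i - (n 0 i / (1 + n 0 i2)) *: (n + e_ i2).

Lemma frame_orthonormal n : dot n n = 1 ->
  [/\ dot (frame n i0) (frame n i0) = 1, dot (frame n i1) (frame n i1) = 1,
      dot (frame n i0) (frame n i1) = 0, dot (frame n i0) n = 0 &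
      dot (frame n i1) n = 0].
Proof.
rewrite /frame !dotE !mxE !eqxx /=.
move: (n 0 i0) (n 0 i1) (n 0 i2) => x y z nn.
have [z1|z1] := eqVneq (1 + z) 0.
  have zE : z = -1 by lra.
  have x0 : x = 0 by nra.
  have y0 : y = 0 by nra.
  by rewrite z1 invr0 !mulr0 x0 y0 zE; split; ring.
have E0 : x * x + y * y + z * z - 1 = 0 by rewrite nn subrr.
(* Each of the five differences is an explicit multiple of |n|^2 - 1. *)
split; apply/eqP; rewrite -subr_eq0; apply/eqP.
- transitivity (x ^+ 2 / (1 + z) ^+ 2 * (x * x + y * y + z * z - 1)); first by field.
  by rewrite E0 mulr0.
- transitivity (y ^+ 2 / (1 + z) ^+ 2 * (x * x + y * y + z * z - 1)); first by field.
  by rewrite E0 mulr0.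
- transitivity (x * y / (1 + z) ^+ 2 * (x * x + y * y + z * z - 1)); first by field.
  by rewrite E0 mulr0.
- transitivity (- x / (1 + z) * (x * x + y * y + z * z - 1)); first by field.
  by rewrite E0 mulr0.
- transitivity (- y / (1 + z) * (x * x + y * y + z * z - 1)); first by field.
  by rewrite E0 mulr0.
Qed.

Variables (c : 'rV[R]_3) (r : R).
Hypothesis r0 : 0 < r.
Local Notation sph := (sphere c r).

Lemma is_derive_subc (E : normedModType R) (f : E -> 'rV[R]_3) x v df :
  is_derive x v f df -> is_derive x v (fun y => f y - c) df.
Proof.
move=> hf; have : is_derive x v (f - cst c) (df - 0) by exact: is_deriveB.
by rewrite subr0.
Qed.

Lemma sphere_valued_derive (E : normedModType R) (f : E -> 'rV[R]_3) x v df :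
  (\near x, sph (f x)) -> is_derive x v f df -> dot df (f x - c) = 0.
Proof.
move=> fs /is_derive_subc hf.
have h := is_derive_dot hf hf.
have h0 : is_derive x v (fun y => dot (f y - c) (f y - c)) 0.
  apply: (near_eq_is_derive (f := cst (r ^+ 2))).
  by apply: filterS fs => y ->.
have := @derive_val _ _ _ _ _ _ _ h; rewrite (@derive_val _ _ _ _ _ _ _ h0).
by rewrite (dotC (f x - c)); lra.
Qed.

Lemma sphere_curve s b : sph s -> dot b (s - c) = 0 -> exists gam, curve_at sph s gam b.
Proof.
have sE : c + (s - c) = s by rewrite addrC subrK.
rewrite /sphere /=; move: (s - c) sE => y sE ss bs.
(* [curve_at] asks for a curve defined for all times, so the great circle is parametrized
   rationally. The choice |b|^2 = 4 k r^2 gives (1 - k t^2)^2 r^2 + t^2 |b|^2 = (1 + k t^2)^2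
   r^2. *)
pose k := dot b b / (4 * r ^+ 2).
have k0 : 0 <= k by rewrite divr_ge0 ?dot_ge0// mulr_ge0// sqr_ge0.
have den t : 1 + k * (t * t) != 0.
  by rewrite gt_eqF// ltr_pwDl// mulr_ge0// -expr2 sqr_ge0.
pose gam (t : R) := c + (1 + k * (t * t))^-1 *: ((1 - k * (t * t)) *: y + t *: b).
exists gam; split.
- move=> t; rewrite /sphere /= /gam addrC addKr dotZl dotZr !dotLE ss (dotC y b) bs.
  have -> : dot b b = k * (4 * r ^+ 2) by rewrite /k divfK// mulf_neq0// expf_neq0// gt_eqF.
  by field; exact: den.
- by rewrite /gam mulr0 mulr0 addr0 subr0 invr1 !scale1r scale0r addr0.
- have K (a : R) := is_derive_const (0 : R) (1 : R) a.
  have I : is_derive (0 : R) (1 : R) (id : R -> R) 1 by exact: is_derive_id.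
  have tt := is_derive_mul (K k) (is_derive_mul I I).
  have d1 := @is_derive_invf _ _ (fun t : R => 1 + k * (t * t)) _ _ _ (den 0) (is_derive_add (K 1) tt).
  apply: is_derive_rV3 => i.
  have d2 := is_derive_add (is_derive_mul (is_derive_sub (K 1) tt) (K (y 0 i)))
    (is_derive_mul I (K (b 0 i))).
  have d3 := is_derive_add (K (c 0 i)) (is_derive_mul d1 d2).
  rewrite (_ : (fun x => _) = (fun t => c 0 i + (1 + k * (t * t))^-1 *
    ((1 - k * (t * t)) * y 0 i + t * b 0 i))); last first.
    by apply/funext => t; rewrite /gam !mxE.
  apply: (is_derive_eq d3) => /=; rewrite !(mulr0, mul0r, addr0, add0r, mul1r, mulr1, subr0, oppr0).
  by rewrite invr1 !mul1r ?mulr0 ?mul0r ?add0r.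
Qed.

Definition sphere_frame s i := frame (r^-1 *: (s - c)) i.

Lemma sphere_frame_orthonormal s : sph s ->
  [/\ dot (sphere_frame s i0) (sphere_frame s i0) = 1,
      dot (sphere_frame s i1) (sphere_frame s i1) = 1,
      dot (sphere_frame s i0) (sphere_frame s i1) = 0,
      dot (sphere_frame s i0) (s - c) = 0 &
      dot (sphere_frame s i1) (s - c) = 0].
Proof.
rewrite /sphere /= => ss.
have [|h1 h2 h3 h4 h5] := @frame_orthonormal (r^-1 *: (s - c)).
  by rewrite dotZl dotZr ss; field; rewrite gt_eqF.
have rn : r^-1 != 0 by rewrite invr_eq0 gt_eqF.
split=> //.
- by move: h4; rewrite dotZr => /eqP; rewrite mulf_eq0 (negPf rn) => /eqP.
- by move: h5; rewrite dotZr => /eqP; rewrite mulf_eq0 (negPf rn) => /eqP.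
Qed.

(** [trace_sqr] is quadratic in its last three arguments, so normalizing the normal, with n =
    |nu|^2, costs a factor 1 / n; the squared area Jacobian n / r^2 cancels it. *)
Lemma trace_sqr_scale (g11 g12 g22 g n w11 w12 w22 k11 k12 k22 : R) : 0 < n ->
  w22 = k22 / Num.sqrt n -> w12 = k12 / Num.sqrt n -> w11 = k11 / Num.sqrt n ->
  g = n / r ^+ 2 ->
  trace_sqr g11 g12 g22 w11 w12 w22 / g ^+ 2 * (Num.sqrt n / r) ^+ 2 =
  trace_sqr g11 g12 g22 k11 k12 k22 / (r * g) ^+ 2.
Proof.
move=> n0 -> -> -> ->.
have sq : n = Num.sqrt n ^+ 2 by rewrite sqr_sqrtr// ltW.
have S0 : Num.sqrt n != 0 by rewrite gt_eqF// sqrtr_gt0.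
rewrite [X in X / r ^+ 2]sq /trace_sqr; move: (Num.sqrt n) S0 => m m0.
by field; rewrite m0 gt_eqF.
Qed.

Lemma sqrt_scale (A B C D : R) : 0 <= A -> 0 < B -> 0 < C ->
  A * B ^+ 2 = D / C ^+ 2 -> Num.sqrt A * B = Num.sqrt D / C.
Proof.
move=> A0 B0 C0 e; have C2 : C != 0 by rewrite gt_eqF.
have -> : D = A * (B * C) ^+ 2 by rewrite exprMn mulrA e divfK// expf_neq0.
by rewrite sqrtrM// sqrtr_sqr gtr0_norm ?mulr_gt0// mulrA mulfK.
Qed.

End SphereTangent.

Section ChainRule.
Context {R : realType} {E F W : normedModType R}.

Lemma derive_comp (f : E -> F) (g : F -> W) x v :
  differentiable f x -> differentiable g (f x) ->
  'D_v (g \o f) x = 'D_('D_v f x) g (f x).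
Proof.
move=> df dg; rewrite !deriveE//; last exact: differentiable_comp.
by rewrite diff_comp.
Qed.

Lemma lipschitz_continuous (f : E -> F) (K : R) :
  (forall y y', `|f y - f y'| <= K * `|y - y'|) -> continuous f.
Proof.
move=> fK y; apply/cvgrPdist_lt => eps eps0.
have K1 : 0 < `|K| + 1 by rewrite ltr_wpDl.
near=> y'; apply: (@le_lt_trans _ _ ((`|K| + 1) * `|y - y'|)).
  apply: (le_trans (fK y y')); apply: ler_wpM2r => //.
  by rewrite (le_trans (ler_norm _))// lerDl.
rewrite mulrC -ltr_pdivlMr//.
near: y'; apply: (@cvgr_dist_lt _ _ _ _ _ id y) => //; exact: divr_gt0.
Unshelve. all: by end_near. Qed.

End ChainRule.

(** * Tangent plane, normal and curvature of the image surface *)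

Section ImageOfSphere.
Context {R : realType}.
Variables (c : 'rV[R]_3) (r : R) (T S : 'rV[R]_3 -> 'rV[R]_3) (K : R).
Hypothesis r0 : 0 < r.
Hypothesis sT : smooth_on setT T.
Hypothesis ST : cancel T S.
Hypothesis TS : cancel S T.
Hypothesis S_lip : forall y y', `|S y - S y'| <= K * `|y - y'|.

Local Notation sph := (sphere c r).
Local Notation m i x := ('D_(e_ i) T x).

Definition jac_det x := det3 (m i0 x) (m i1 x) (m i2 x).
Definition jac_normal x := cof3 (m i0 x) (m i1 x) (m i2 x) (x - c).
Local Notation nu := jac_normal.

Hypothesis det0 : forall x, 0 < jac_det x.

Let dT x : differentiable T x.
Proof. exact: (smooth_diff _ _ _ sT). Qed.

Let T_cont : continuous T.
Proof. by move=> x; exact: diff_cont. Qed.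

Lemma derive_comb3 x b : 'D_b T x = comb3 (m i0 x) (m i1 x) (m i2 x) b.
Proof. by rewrite derive_basis. Qed.

Lemma jac_normal_dot x b : dot (nu x) ('D_b T x) = jac_det x * dot (x - c) b.
Proof. by rewrite derive_comb3 dot_cof3. Qed.

Lemma sphere_center_neq s : sph s -> dot (s - c) (s - c) != 0.
Proof. by rewrite /sphere /= => ->; rewrite expf_neq0// gt_eqF. Qed.

Lemma jac_normal_gt0 s : sph s -> 0 < dot (nu s) (nu s).
Proof.
move=> ss; rewrite dot_gt0; apply/eqP => n0.
have := jac_normal_dot s (s - c); rewrite n0 dot0l => /esym/eqP.
by rewrite mulf_eq0 (negPf (sphere_center_neq ss)) orbF gt_eqF.
Qed.

(** The cross product of two tangent vectors is a multiple of s - c, and cross products are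
    transported by the cofactor matrix, hence land on a multiple of [nu]. *)
Lemma jac_gram s u v : sph s -> dot u (s - c) = 0 -> dot v (s - c) = 0 ->
  gram ('D_u T s) ('D_v T s) = dot (nu s) (nu s) / r ^+ 2 * gram u v.
Proof.
move=> ss us vs; rewrite -!dot_cross (derive_comb3 s u) (derive_comb3 s v) cross_comb3.
have cE := cross_orthogonal (s - c) u v.
rewrite cE ?(dotC (s - c)) ?sphere_center_neq// [in RHS]dotZl dotZr.
set k := _ / _.
rewrite cof3Z -/(jac_normal s) [in LHS]dotZl dotZr ss.
by move: (dot (nu s) (nu s)) => d; field; exact: lt0r_neq0.
Qed.

Definition area_jac s := Num.sqrt (dot (nu s) (nu s)) / r.

Lemma param_tangent U X p v : local_param sph U X -> U p -> dot ('D_v X p) (X p - c) = 0.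
Proof.
move=> lp Up; have [Uo sX _ _ _] := lp.
apply: (@sphere_valued_derive _ c r _ X p v).
  have : nbhs p U by exact: open_nbhs_nbhs.
  by apply: filterS => q Uq; apply: (local_param_sub lp); exists q.
apply: derivableP; apply: diff_derivable; exact: (smooth_diff _ _ _ sX).
Qed.

Lemma image_area U X p : local_param sph U X -> U p ->
  area_element (T \o X) p = area_jac (X p) * area_element X p.
Proof.
move=> lp Up; have [Uo sX _ _ _] := lp.
have dX : differentiable X p by exact: (smooth_diff _ _ _ sX).
have ss : sph (X p) by apply: (local_param_sub lp); exists p.
rewrite /area_element 2!(derive_comp _ dX (dT _)).
rewrite (jac_gram ss (param_tangent _ lp Up) (param_tangent _ lp Up)).
rewrite sqrtrM; last by rewrite divr_ge0 ?sqr_ge0// dot_ge0.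
by rewrite sqrtrM ?dot_ge0// sqrtrV ?sqr_ge0// sqrtr_sqr gtr0_norm.
Qed.

Lemma area_jac_gt0 s : sph s -> 0 < area_jac s.
Proof. by move=> ss; rewrite divr_gt0// sqrtr_gt0 jac_normal_gt0. Qed.

Lemma image_param U X : local_param sph U X -> local_param (T @` sph) U (T \o X).
Proof.
move=> lp; have [Uo sX injX posX opnX] := lp; split; first exact: Uo.
- exact: smooth_comp.
- move=> p q Up Uq /(congr1 S) /=; rewrite !ST; exact: injX.
- move=> p Up; rewrite (image_area lp Up) mulr_gt0//; last exact: posX.
  by apply: area_jac_gt0; apply: (local_param_sub lp); exists p.
- move=> W Wo WU; have [Z Zo XW] := opnX W Wo WU.
  have So : continuous S by exact: lipschitz_continuous S_lip.
  exists (S @^-1` Z); first by apply: open_comp => // y _; exact: So.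
  apply/seteqP; split=> y.
    move=> [p Wp <-]; have [ss Zs] : (sph `&` Z) (X p) by rewrite -XW; exists p.
    by split; [exists (X p)|rewrite /= ST].
  move=> [[s ss <-]]; rewrite /= ST => Zs.
  have [p Wp <-] : (X @` W) s by rewrite XW.
  by exists p.
Qed.

Lemma image_surface : closed_surface (T @` sph).
Proof.
have [cs ch] := sphere_surface c r0; split.
  by apply: continuous_compact => //; exact: continuous_subspaceT.
move=> _ [s ss <-]; have [U [X [lp [p Up Xp]]]] := ch s ss.
exists U, (T \o X); split; first exact: image_param.
by exists p => //=; rewrite Xp.
Qed.

Lemma inverse_derive s :
  differentiable S (T s) /\ forall b, 'D_('D_b T s) S (T s) = b.
Proof.
have lin : linear (solve3 (m i0 s) (m i1 s) (m i2 s)).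
  move=> k u v; apply: rV3P; rewrite !(mk3E, mxE) !dotDr !dotZr; ring.
pose NM := GRing.isLinear.Build _ _ _ _ _ lin.
pose N : {linear 'rV[R]_3 -> 'rV[R]_3} := HB.pack (solve3 (m i0 s) (m i1 s) (m i2 s)) NM.
have Nc : continuous N.
  move=> y; apply: (@diff_cont R); apply: differentiable_rV3.
  have dd (w : 'rV[R]_3) : differentiable (fun x : 'rV[R]_3 => dot w x / jac_det s) y.
    rewrite (_ : (fun x => _) = (fun x => dot (cst w x) x) * cst (jac_det s)^-1)//.
    by apply: differentiableM => //; apply: differentiable_dot.
  apply: ord3P.
  - rewrite (_ : (fun x => _) = (fun x => dot (cross (m i1 s) (m i2 s)) x / jac_det s)) //.
    by apply/funext => x; rewrite mk30.
  - rewrite (_ : (fun x => _) = (fun x => dot (cross (m i2 s) (m i0 s)) x / jac_det s)) //.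
    by apply/funext => x; rewrite mk31.
  - rewrite (_ : (fun x => _) = (fun x => dot (cross (m i0 s) (m i1 s)) x / jac_det s)) //.
    by apply/funext => x; rewrite mk32.
have NT b : N ('D_b T s) = b.
  by rewrite derive_comb3 /= solve3K//; exact/lt0r_neq0/det0.
have [dS SE] := inverse_is_diff (dT s) ST TS S_lip Nc NT.
by split=> // b; rewrite deriveE// SE.
Qed.

Lemma derive_onto s xi : exists b, 'D_b T s = xi.
Proof.
exists (solve3 (m i0 s) (m i1 s) (m i2 s) xi); rewrite derive_comb3 comb3K//.
exact/lt0r_neq0/det0.
Qed.

(** The inverse [S] is differentiable, so a curve in the image surface comes from a curve on the
    sphere; tangent vectors and derivatives along the surface can be computed upstairs. *)
Lemma pullback_curve s gam xi : curve_at (T @` sph) (T s) gam xi ->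
  exists b, [/\ xi = 'D_b T s, curve_at sph s (S \o gam) b & dot b (s - c) = 0].
Proof.
move=> [gG g0 dg]; have [b bE] := derive_onto s xi.
have [dS SD] := inverse_derive s.
have sph_g t : sph (S (gam t)) by have [x sx <-] := gG t; rewrite ST.
have dSg : is_derive (0 : R) (1 : R) (S \o gam) b.
  by rewrite -(SD b) bE -g0; apply: is_derive_curve => //; rewrite g0.
have cv : curve_at sph s (S \o gam) b by split=> //=; rewrite g0 ST.
exists b; split=> //.
have ns : \forall t \near (0 : R), sph ((S \o gam) t) by near=> t; exact: sph_g.
by have := sphere_valued_derive ns dSg; rewrite /= g0 ST.
Unshelve. all: by end_near. Qed.

Lemma push_curve s gam b : curve_at sph s gam b ->
  curve_at (T @` sph) (T s) (T \o gam) ('D_b T s).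
Proof.
move=> [gG g0 dg]; split=> [t|/=|]; [by exists (gam t)|by rewrite g0|].
by rewrite -g0; exact: is_derive_curve.
Qed.

Lemma image_tangent_space s : sph s ->
  tangent_space (T @` sph) (T s) = [set 'D_b T s | b in [set b | dot b (s - c) = 0]].
Proof.
move=> ss; apply/seteqP; split=> [xi [gam /pullback_curve[b [-> _ bs]]]|_ [b /= bs <-]].
  by exists b.
have [gam cv] := sphere_curve r0 ss bs.
by exists (T \o gam); exact: push_curve.
Qed.

(** The normal of the image, pulled back by [T] and extended to the whole space, so that ordinary
    directional derivatives apply to it. *)
Definition unit_normal x := (Num.sqrt (dot (nu x) (nu x)))^-1 *: nu x.

Lemma jac_normal_diff x : differentiable nu x.
Proof.
have dm i : differentiable ('D_(e_ i) T) x.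
  exact: (smooth_diff _ _ _ (smooth_derive _ _ _ _ sT)).
have dc i : differentiable (fun x : 'rV[R]_3 => (x - c) 0 i) x.
  by apply: differentiable_comp_rV3; exact: differentiable_subc.
have t0 := differentiable_scale (dc i0) (differentiable_cross (dm i1) (dm i2)).
have t1 := differentiable_scale (dc i1) (differentiable_cross (dm i2) (dm i0)).
have t2 := differentiable_scale (dc i2) (differentiable_cross (dm i0) (dm i1)).
have := differentiableD (differentiableD t0 t1) t2.
by rewrite /jac_normal /cof3 !fctE.
Qed.

Lemma jac_det_diff x : differentiable jac_det x.
Proof.
have dm i : differentiable ('D_(e_ i) T) x.
  exact: (smooth_diff _ _ _ (smooth_derive _ _ _ _ sT)).
exact: (differentiable_dot (dm i0) (differentiable_cross (dm i1) (dm i2))).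
Qed.

Let inv_norm x := (Num.sqrt (dot (nu x) (nu x)))^-1.

Let inv_norm_diff s : sph s -> differentiable inv_norm s.
Proof.
move=> ss; have n0 := jac_normal_gt0 ss.
have dn := differentiable_dot (jac_normal_diff s) (jac_normal_diff s).
apply: differentiableV; first exact: differentiable_sqrt.
by rewrite gt_eqF// sqrtr_gt0.
Qed.

Lemma unit_normal_diff s : sph s -> differentiable unit_normal s.
Proof.
by move=> ss; exact: (differentiable_scale (inv_norm_diff ss) (jac_normal_diff s)).
Qed.

Lemma unit_normal1 x : 0 < dot (nu x) (nu x) -> dot (unit_normal x) (unit_normal x) = 1.
Proof.
move=> n0; rewrite /unit_normal dotZl dotZr mulrA -expr2 exprVn sqr_sqrtr ?ltW//.
by rewrite mulVf// gt_eqF.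
Qed.

Lemma derive_unit_normal_orth s a : sph s -> dot (unit_normal s) ('D_a unit_normal s) = 0.
Proof.
move=> ss; have h := derivableP (diff_derivable (v := a) (unit_normal_diff ss)).
have h2 := is_derive_dot h h.
have h0 : is_derive s a (fun x => dot (unit_normal x) (unit_normal x)) 0.
  apply: (near_eq_is_derive (f := cst (1 : R))).
  near=> x; rewrite unit_normal1//; near: x.
  have cn : {for s, continuous (fun x => dot (nu x) (nu x))}.
    exact: (diff_cont (differentiable_dot (jac_normal_diff s) (jac_normal_diff s))).
  exact: (cvgr_gt _ cn _ (jac_normal_gt0 ss)).
have := @derive_val _ _ _ _ _ _ _ h2; rewrite (@derive_val _ _ _ _ _ _ _ h0).
by rewrite (dotC ('D_a _ _)); lra.
Unshelve. all: by end_near. Qed.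

Lemma unit_normal_dot s b : dot (unit_normal s) ('D_b T s) =
  inv_norm s * (jac_det s * dot (s - c) b).
Proof. by rewrite /unit_normal dotZl jac_normal_dot. Qed.

(** The second fundamental form of the image surface, pulled back to the sphere and multiplied by
    |nu|; for the identity map it is [dot a b]. *)
Definition second_form a b s := jac_det s * dot a b - dot (nu s) ('D_a ('D_b T) s).

(** Differentiate [unit_normal_dot] at s in direction a. The derivatives of 1 / |nu| and of the
    determinant drop out, because they are multiplied by [dot (s - c) b = 0]. *)
Lemma derive_unit_normal_dot s a b : sph s -> dot b (s - c) = 0 ->
  dot ('D_a unit_normal s) ('D_b T s) =
  second_form a b s / Num.sqrt (dot (nu s) (nu s)).
Proof.
move=> ss bs.
have hn := derivableP (diff_derivable (v := a) (unit_normal_diff ss)).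
have hT : is_derive s a ('D_b T) ('D_a ('D_b T) s).
  apply: derivableP; apply: diff_derivable.
  exact: (smooth_diff _ _ _ (smooth_derive _ _ _ _ sT)).
have hi := derivableP (diff_derivable (v := a) (inv_norm_diff ss)).
have hd := derivableP (diff_derivable (v := a) (jac_det_diff s)).
have hc : is_derive s a (fun x => dot (x - c) b) (dot a b).
  have h := is_derive_dot (is_derive_subc c (is_derive_id s a)) (is_derive_cst b s a).
  by apply: (is_derive_eq h); rewrite dot0r addr0.
have L := is_derive_dot hn hT.
have Rr := is_derive_mul hi (is_derive_mul hd hc).
have E : (fun x => dot (unit_normal x) ('D_b T x)) =
    (fun x => inv_norm x * (jac_det x * dot (x - c) b)).
  by apply/funext => x; exact: unit_normal_dot.
have := @derive_val _ _ _ _ _ _ _ L; rewrite E (@derive_val _ _ _ _ _ _ _ Rr).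
have -> : dot (unit_normal s) ('D_a ('D_b T) s) =
  inv_norm s * dot (nu s) ('D_a ('D_b T) s) by exact: dotZl.
rewrite (dotC (s - c)) bs !mulr0 add0r add0r /second_form -/(inv_norm s).
move: (dot ('D_a _ s) _) (dot (nu s) ('D_a _ s)) (inv_norm s) => P X i.
by move=> h; rewrite mulrBl [jac_det s * _ * i]mulrC h [X * i]mulrC addrK.
Qed.

Let derivative_sign (f : R -> R) (df : R) : is_derive (0 : R) (1 : R) f df -> 0 < df ->
  exists2 d : R, 0 < d & forall t, 0 < t < d -> f (- t) < f 0 < f t.
Proof.
move=> [dv dE] df0.
have lim : h^-1 *: (f (h *: 1 + 0) - f 0) @[h --> (0 : R)^'] --> df.
  by rewrite -dE; exact: dv.
have : \forall h \near (0 : R)^', 0 < h^-1 *: (f (h *: 1 + 0) - f 0).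
  exact: cvgr_gt lim _ df0.
rewrite near_withinE => /nbhs_ballP[d /= d0 Hd].
exists d => // t /andP[t0 td].
have q h : h != 0 -> `|h| < d -> 0 < h^-1 * (f h - f 0).
  move=> hn hd; have := Hd h; rewrite -ball_normE /= sub0r normrN => /(_ hd hn).
  by rewrite /GRing.scale /= mulr1 addr0.
apply/andP; split.
  have := q (- t); rewrite oppr_eq0 gt_eqF// normrN gtr0_norm// => /(_ isT td).
  by rewrite invrN mulNr -mulrN opprB pmulr_rgt0 ?invr_gt0// subr_gt0.
have := q t; rewrite gt_eqF// gtr0_norm// => /(_ isT td).
by rewrite pmulr_rgt0 ?invr_gt0// subr_gt0.
Qed.

Local Notation ball' := (T @` eball c r).
Local Notation sph' := (T @` sph).

(** The side is tested on |S y - c|^2, which is below r^2 exactly on the image of the ball. Its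
    derivative along the normal is positive because the Jacobian determinant is. *)
Lemma unit_normal_outer s : sph s -> is_outer_normal ball' sph' (T s) (unit_normal s).
Proof.
move=> ss; have n0 := jac_normal_gt0 ss; split.
- by rewrite /enorm unit_normal1// sqrtr1.
- move=> xi; rewrite image_tangent_space// => -[b /= bs <-].
  by rewrite unit_normal_dot (dotC (s - c)) bs !mulr0.
have [b bE] := derive_onto s (unit_normal s).
have [dS SD] := inverse_derive s.
pose g t := S (T s + t *: unit_normal s).
have g0 : g 0 = s by rewrite /g scale0r addr0 ST.
have dg : is_derive (0 : R) (1 : R) g b.
  have : is_derive (0 : R) (1 : R) g ('D_(unit_normal s) S (T s + 0 *: unit_normal s)).
    by apply: is_derive_line; rewrite scale0r addr0.
  by rewrite scale0r addr0 -[in 'D_(unit_normal s) _ _]bE SD.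
have dq := is_derive_dot (is_derive_subc c dg) (is_derive_subc c dg).
have pos : 0 < dot b (g 0 - c) + dot (g 0 - c) b.
  rewrite g0 (dotC (s - c)) -mulr2n mulrn_wgt0//.
  have := jac_normal_dot s b; rewrite bE /unit_normal dotZr => h.
  have : 0 < jac_det s * dot (s - c) b.
    by rewrite -h mulr_gt0// invr_gt0 sqrtr_gt0.
  by rewrite pmulr_rgt0// dotC.
have [d d0 Hd] := derivative_sign dq pos.
exists d => // t td; have /andP[lt gt] := Hd t td.
rewrite g0 ss in lt gt; rewrite eballE//; split.
  exists (g (- t)) => //; by rewrite /g TS scaleNr.
move=> [x /= xb xE]; move: gt; rewrite /g -xE ST => /lt_trans/(_ xb).
by rewrite ltxx.
Qed.

Section AtPoint.
Variables (s a1 a2 : 'rV[R]_3).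
Hypothesis ss : sph s.
Hypotheses (a11 : dot a1 a1 = 1) (a22 : dot a2 a2 = 1) (a12 : dot a1 a2 = 0).
Hypotheses (a1s : dot a1 (s - c) = 0) (a2s : dot a2 (s - c) = 0).

Let gram12 : gram a1 a2 = 1.
Proof. by rewrite /gram a11 a22 a12; ring. Qed.

Lemma image_gram : gram ('D_a1 T s) ('D_a2 T s) = dot (nu s) (nu s) / r ^+ 2.
Proof. by rewrite jac_gram// gram12 mulr1. Qed.

Lemma image_gram_gt0 : 0 < gram ('D_a1 T s) ('D_a2 T s).
Proof. by rewrite image_gram divr_gt0 ?exprn_gt0// jac_normal_gt0. Qed.

Lemma image_tangent_basis :
  is_basis (tangent_space sph' (T s)) ('D_a1 T s) ('D_a2 T s).
Proof.
split; first exact: image_gram_gt0.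
rewrite /is_span image_tangent_space//; apply/seteqP; split=> xi.
  move=> [b /= bs <-].
  have g0 : 0 < gram a1 a2 by rewrite gram12.
  rewrite dotC in bs; have := orthogonal_span (s - c) a1 a2 b.
  rewrite (dotC _ a1) (dotC _ a2) => /(_ a1s a2s g0 bs (sphere_center_neq ss))[k [l ->]].
  exists k => //; exists l => //; by rewrite derive_linear.
move=> [k _] [l _] <-; exists (k *: a1 + l *: a2); last by rewrite derive_linear.
by rewrite /= dotDl !dotZl a1s a2s !mulr0 addr0.
Qed.

(** Orthogonality to the tangent plane and unit length leave only a sign. With the opposite sign,
    points at small distance along the normal would lie both inside and outside the image of the
    ball. *)
Lemma outer_normal_unique nu' : is_outer_normal ball' sph' (T s) nu' ->
  nu' = unit_normal s.
Proof.
move=> [n1 nt [d d0 Hd]].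
have [_ tn [d' d'0 Hd']] := unit_normal_outer ss.
have [g0 sp] := image_tangent_basis.
have u1 := unit_normal1 (jac_normal_gt0 ss).
have t1 : tangent_space sph' (T s) ('D_a1 T s).
  by have := is_spanI sp 1 0; rewrite scale1r scale0r addr0.
have t2 : tangent_space sph' (T s) ('D_a2 T s).
  by have := is_spanI sp 0 1; rewrite scale1r scale0r add0r.
set k := dot (unit_normal s) nu'.
have n'E : nu' = k *: unit_normal s.
  apply/eqP; rewrite -subr_eq0; apply/eqP.
  have un0 : dot (unit_normal s) (unit_normal s) != 0 by rewrite u1 oner_neq0.
  have uw : dot (unit_normal s) (nu' - k *: unit_normal s) = 0.
    by rewrite dotBr dotZr u1 mulr1 subrr.
  have w1 : dot (nu' - k *: unit_normal s) ('D_a1 T s) = 0.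
    by rewrite dotBl dotZl (nt _ t1) (tn _ t1) mulr0 subrr.
  have w2 : dot (nu' - k *: unit_normal s) ('D_a2 T s) = 0.
    by rewrite dotBl dotZl (nt _ t2) (tn _ t2) mulr0 subrr.
  have [k1 [k2 wE]] := orthogonal_span _ _ _ _ (tn _ t1) (tn _ t2) g0 uw un0.
  exact: span_orthogonal0 w1 w2 wE.
have k2 : k ^+ 2 = 1.
  have : dot nu' nu' = 1 by rewrite -enorm_sqr n1 expr1n.
  by rewrite n'E dotZl dotZr u1 mulr1 expr2.
have /eqP := k2; rewrite sqrf_eq1 => /orP[/eqP kE|/eqP kE]; first by rewrite n'E kE scale1r.
exfalso; pose t := Num.min d d' / 2.
have m0 : 0 < Num.min d d' by rewrite lt_min d0.
have t0 : 0 < t by rewrite divr_gt0.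
have tm : t < Num.min d d' by rewrite /t; lra.
have td : 0 < t < d by rewrite t0 (lt_le_trans tm)// ge_min lexx.
have td' : 0 < t < d' by rewrite t0 (lt_le_trans tm)// ge_min lexx orbT.
have [in1 _] := Hd t td; have [_ out] := Hd' t td'.
by apply: out; move: in1; rewrite n'E kE scaleN1r scalerN opprK.
Qed.

Lemma outer_normalE : outer_normal ball' sph' (T s) = unit_normal s.
Proof.
by apply: xget_unique; [exact: unit_normal_outer|exact: outer_normal_unique].
Qed.

End AtPoint.

Lemma outer_normal_image s : sph s -> outer_normal ball' sph' (T s) = unit_normal s.
Proof.
move=> ss; have [h1 h2 h3 h4 h5] := sphere_frame_orthonormal r0 ss.
exact: (outer_normalE ss h1 h2 h3 h4 h5).
Qed.

(** Every curve in the image pulls back to the sphere, where the normal is the differentiable map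
    [unit_normal]. Uniqueness of the selected value also needs one curve with the given velocity,
    which [sphere_curve] supplies. *)
Lemma Dnormal_image s b : sph s -> dot b (s - c) = 0 ->
  Dnormal ball' sph' (T s) ('D_b T s) = 'D_b unit_normal s.
Proof.
move=> ss bs; apply: xget_unique.
  move=> gam cv; have [b' [bE cv' _]] := pullback_curve cv.
  have [_ SD] := inverse_derive s.
  have bb : b' = b by rewrite -(SD b') -bE SD.
  rewrite -bb; case: cv' => gs g0 dg.
  have -> : outer_normal ball' sph' \o gam = unit_normal \o (S \o gam).
    apply/funext => t /=; have [gT _ _] := cv; have [x sx xE] := gT t.
    by rewrite -xE ST outer_normal_image.
  rewrite -g0; apply: (is_derive_curve _ _ _ _ dg).
  by rewrite g0; exact: unit_normal_diff.
move=> w Hw; have [gam cv] := sphere_curve r0 ss bs.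
have := Hw _ (push_curve cv).
have [gs g0 dg] := cv.
have -> : outer_normal ball' sph' \o (T \o gam) = unit_normal \o gam.
  by apply/funext => t /=; rewrite outer_normal_image//; exact: gs.
move=> h; have h' : is_derive (0 : R) (1 : R) (unit_normal \o gam) ('D_b unit_normal s).
  by rewrite -g0; apply: (is_derive_curve _ _ _ _ dg); rewrite g0; exact: unit_normal_diff.
by rewrite -(@derive_val _ _ _ _ _ _ _ h) (@derive_val _ _ _ _ _ _ _ h').
Qed.

Lemma second_form_sym a b s : second_form a b s = second_form b a s.
Proof.
by rewrite /second_form (dotC a b) (deriveC_rV3 s a b sT).
Qed.

Section Densities.
Variables (s a1 a2 : 'rV[R]_3).
Hypothesis ss : sph s.
Hypotheses (a11 : dot a1 a1 = 1) (a22 : dot a2 a2 = 1) (a12 : dot a1 a2 = 0).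
Hypotheses (a1s : dot a1 (s - c) = 0) (a2s : dot a2 (s - c) = 0).

Let p := 'D_a1 T s.
Let q := 'D_a2 T s.
Let W := Dnormal ball' sph' (T s).
Let tau := tangent_space sph' (T s).
Let N := unit_normal s.

Let basis : is_basis tau p q.
Proof. exact: image_tangent_basis. Qed.

Let N1 : dot N N = 1.
Proof. exact: (unit_normal1 (jac_normal_gt0 ss)). Qed.

Let Ntau x : tau x -> dot N x = 0.
Proof. by have [_ h _] := unit_normal_outer ss; exact: h. Qed.

Let tauP x : tau x -> exists2 b, dot b (s - c) = 0 & x = 'D_b T s.
Proof. by rewrite /tau image_tangent_space// => -[b /= bs <-]; exists b. Qed.

Let Wdot u v : dot u (s - c) = 0 -> dot v (s - c) = 0 ->
  dot (W ('D_u T s)) ('D_v T s) = second_form u v s / Num.sqrt (dot (nu s) (nu s)).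
Proof.
move=> us vs; rewrite /W (Dnormal_image ss us); exact: derive_unit_normal_dot.
Qed.

Let W_lin a b x y : tau x -> tau y -> W (a *: x + b *: y) = a *: W x + b *: W y.
Proof.
move=> /tauP[u us ->] /tauP[v vs ->].
have uv : dot (a *: u + b *: v) (s - c) = 0.
  by rewrite dotDl (dotZl a) (dotZl b) us vs !mulr0 addr0.
rewrite -(derive_linear _ _ _ _ _ _ (dT s)) /W (Dnormal_image ss uv).
rewrite (Dnormal_image ss us) (Dnormal_image ss vs).
exact: (derive_linear _ _ _ _ _ _ (unit_normal_diff ss)).
Qed.

Let NW x : tau x -> dot N (W x) = 0.
Proof. by move=> /tauP[u us ->]; rewrite /W Dnormal_image// derive_unit_normal_orth. Qed.

Let W_sym : dot (W p) q = dot (W q) p.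
Proof.
have h := congr1 (fun x => x / Num.sqrt (dot (nu s) (nu s))) (second_form_sym a1 a2 s).
exact: etrans (Wdot a1s a2s) (etrans h (esym (Wdot a2s a1s))).
Qed.

(** Equals (k_1^2 + k_2^2) |nu|^2 (gram p q)^2, which is polynomial in the first two derivatives of
    [T]. *)
Definition willmore_sqr := trace_sqr (dot p p) (dot p q) (dot q q)
  (second_form a1 a1 s) (second_form a1 a2 s) (second_form a2 a2 s).

Let shapeE : shape_sqr p q W * area_jac s ^+ 2 = willmore_sqr / (r * gram p q) ^+ 2.
Proof.
exact: (trace_sqr_scale r0 (dot p p) (dot p q) (dot q q) (jac_normal_gt0 ss)
  (Wdot a2s a2s) (Wdot a1s a2s) (Wdot a1s a1s) (image_gram ss a11 a22 a12 a1s a2s)).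
Qed.

Let shape_ge0 : 0 <= shape_sqr p q W.
Proof.
have [x1 [x2 onb]] := orthonormal_exists _ _ _ basis.
rewrite -(orthonormal_shape _ _ _ _ _ basis N1 Ntau W_lin NW W_sym _ _ onb).
exact: addr_ge0 (dot_ge0 _) (dot_ge0 _).
Qed.

Lemma tv_density_image : tv_density ball' sph' (T s) = Num.sqrt (shape_sqr p q W).
Proof.
rewrite /tv_density /=.
have : exists b : 'rV[R]_3 * 'rV[R]_3, is_orthonormal_basis tau b.1 b.2.
  have [x1 [x2 onb]] := orthonormal_exists _ _ _ basis.
  by exists (x1, x2).
move=> /(@xgetPex _ (0, 0)); rewrite -/(tangent_frame sph' (T s)) => onb.
by rewrite !enorm_sqr (orthonormal_shape _ _ _ _ _ basis N1 Ntau W_lin NW W_sym _ _ onb).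
Qed.

(** Some eigenbasis exists, so [principal_curvatures] selects a genuine one; the sum of squares is
    the trace of W^2 for whichever is selected. *)
Lemma curvature_density_image :
  curvature_density ball' sph' (T s) = tv_density ball' sph' (T s).
Proof.
rewrite tv_density_image /curvature_density /=; congr Num.sqrt.
have : exists k : R * R, exists e1 e2, [/\ is_basis tau e1 e2,
    W e1 = k.1 *: e1 & W e2 = k.2 *: e2].
  have [k1 [k2 H]] := eigen_exists _ _ _ _ _ basis N1 Ntau W_lin NW W_sym.
  by exists (k1, k2).
move=> /(@xgetPex _ (0, 0)); rewrite -/(principal_curvatures ball' sph' (T s)).
move=> [e1 [e2 [bs E1 E2]]].
exact: (eigen_shape _ _ _ _ _ basis N1 Ntau W_lin NW W_sym _ _ _ _ bs E1 E2).
Qed.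

Lemma tv_density_jac : tv_density ball' sph' (T s) * area_jac s =
  Num.sqrt willmore_sqr / (r * gram p q).
Proof.
have rg : 0 < r * gram p q.
  exact: mulr_gt0 r0 (image_gram_gt0 ss a11 a22 a12 a1s a2s).
by rewrite tv_density_image; exact: sqrt_scale shape_ge0 (area_jac_gt0 ss) rg shapeE.
Qed.

End Densities.

End ImageOfSphere.

(** * Uniform first-order expansions *)

Section UniformExpansion.
Context {R : realType} {X : Type}.
Variable D : set X.

(* f e s = f0 s + e f1 s + O(e^2) as e -> 0+, uniformly for s in D. *)
Definition uexp (f : R -> X -> R) (f0 f1 : X -> R) := exists C e0 : R, [/\ 0 < C, 0 < e0 <= 1 &
  forall e s, D s -> 0 <= e <= e0 ->
    [/\ `|f e s - (f0 s + e * f1 s)| <= C * e ^+ 2, `|f0 s| <= C & `|f1 s| <= C]].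

Definition ubounded (f0 : X -> R) := exists2 C : R, 0 < C & forall s, D s -> `|f0 s| <= C.

Lemma uexp_ext f g f0 g0 f1 g1 :
  (forall e s, D s -> f e s = g e s) -> (forall s, D s -> f0 s = g0 s) ->
  (forall s, D s -> f1 s = g1 s) -> uexp f f0 f1 -> uexp g g0 g1.
Proof.
move=> fg fg0 fg1 [C [e0 [C0 e01 H]]]; exists C, e0; split=> // e s Ds ee.
by rewrite -fg// -fg0// -fg1//; exact: H.
Qed.

Lemma uexp_cst f0 : ubounded f0 -> uexp (fun _ => f0) f0 (fun _ => 0).
Proof.
move=> [C C0 HC]; exists C, 1; split=> // [|e s Ds _]; first by rewrite ltr01 lexx.
rewrite mulr0 addr0 subrr normr0; split=> //; [|exact: HC|exact: ltW].
by rewrite mulr_ge0 ?sqr_ge0// ltW.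
Qed.

Lemma uexp_lin f1 : ubounded f1 -> uexp (fun e s => e * f1 s) (fun _ => 0) f1.
Proof.
move=> [C C0 HC]; exists C, 1; split=> // [|e s Ds _]; first by rewrite ltr01 lexx.
rewrite add0r subrr normr0; split=> //; [|exact: ltW|exact: HC].
by rewrite mulr_ge0 ?sqr_ge0// ltW.
Qed.

Lemma uexpD f f0 f1 g g0 g1 : uexp f f0 f1 -> uexp g g0 g1 ->
  uexp (fun e s => f e s + g e s) (fun s => f0 s + g0 s) (fun s => f1 s + g1 s).
Proof.
move=> [C [e0 [C0 /andP[e00 e01] H]]] [C' [e0' [C0' /andP[e00' e01'] H']]].
exists (C + C'), (Num.min e0 e0'); split; first exact: addr_gt0.
  by rewrite lt_min e00 e00' ge_min e01.
move=> e s Ds /andP[eg0]; rewrite le_min => /andP[ee ee'].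
have [|h1 h2 h3] := H e s Ds; first by rewrite eg0.
have [|h1' h2' h3'] := H' e s Ds; first by rewrite eg0.
split; try by rewrite (le_trans (ler_normD _ _))// lerD.
rewrite (_ : _ - _ = (f e s - (f0 s + e * f1 s)) + (g e s - (g0 s + e * g1 s))); last by ring.
by rewrite (le_trans (ler_normD _ _))// mulrDl lerD.
Qed.

Lemma uexpM f f0 f1 g g0 g1 : uexp f f0 f1 -> uexp g g0 g1 ->
  uexp (fun e s => f e s * g e s) (fun s => f0 s * g0 s)
       (fun s => f0 s * g1 s + f1 s * g0 s).
Proof.
move=> [C [e0 [C0 /andP[e00 e01] H]]] [C' [e0' [C0' /andP[e00' e01'] H']]].
(* 6 = 1 + 2 + 2 + 1 counts the four error terms in the decomposition of the product below. *)
exists (6 * (C * C')), (Num.min e0 e0'); split; first by rewrite !mulr_gt0.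
  by rewrite lt_min e00 e00' ge_min e01.
move=> e s Ds /andP[eg0]; rewrite le_min => /andP[ee ee'].
have [|h1 h2 h3] := H e s Ds; first by rewrite eg0.
have [|h1' h2' h3'] := H' e s Ds; first by rewrite eg0.
have e1 : e <= 1 by apply: le_trans e01.
have e2 : e ^+ 2 <= 1 by rewrite exprn_ile1.
have CC : 0 < C * C' by rewrite mulr_gt0.
split.
- set d := f e s - _ in h1; set d' := g e s - _ in h1'.
  have -> : f e s * g e s - (f0 s * g0 s + e * (f0 s * g1 s + f1 s * g0 s)) =
    e ^+ 2 * (f1 s * g1 s) + (f0 s + e * f1 s) * d' + d * (g0 s + e * g1 s) + d * d'.
    by rewrite /d /d'; ring.
  have bf : `|f0 s + e * f1 s| <= 2 * C.
    rewrite (le_trans (ler_normD _ _))// mulrDl mul1r lerD//.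
    by rewrite normrM (ger0_norm eg0) (le_trans _ h3)// ler_piMl.
  have bg : `|g0 s + e * g1 s| <= 2 * C'.
    rewrite (le_trans (ler_normD _ _))// mulrDl mul1r lerD//.
    by rewrite normrM (ger0_norm eg0) (le_trans _ h3')// ler_piMl.
  have t1 : `|e ^+ 2 * (f1 s * g1 s)| <= C * C' * e ^+ 2.
    rewrite normrM (ger0_norm (sqr_ge0 e)) mulrC ler_wpM2r ?sqr_ge0// normrM.
    exact: ler_pM.
  have t2 : `|(f0 s + e * f1 s) * d'| <= 2 * (C * C') * e ^+ 2.
    rewrite normrM (_ : _ * e ^+ 2 = (2 * C) * (C' * e ^+ 2)); last by ring.
    exact: ler_pM.
  have t3 : `|d * (g0 s + e * g1 s)| <= 2 * (C * C') * e ^+ 2.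
    rewrite normrM (_ : _ * e ^+ 2 = (C * e ^+ 2) * (2 * C')); last by ring.
    exact: ler_pM.
  have t4 : `|d * d'| <= (C * C') * e ^+ 2.
    rewrite normrM (le_trans (ler_pM _ _ h1 h1'))//.
    rewrite (_ : _ * (C' * _) = C * C' * e ^+ 2 * e ^+ 2); last by ring.
    by rewrite ler_piMr// mulr_ge0 ?sqr_ge0// ltW.
  rewrite (le_trans (ler_normD _ _))//.
  rewrite (_ : 6 * _ * _ = C * C' * e ^+ 2 + 2 * (C * C') * e ^+ 2 +
    2 * (C * C') * e ^+ 2 + C * C' * e ^+ 2); last by ring.
  rewrite lerD// (le_trans (ler_normD _ _))// lerD// (le_trans (ler_normD _ _))//.
  by rewrite lerD.
- rewrite normrM (le_trans (ler_pM _ _ h2 h2'))// ler_peMl// ?ltW//.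
  by rewrite ltr1n.
- rewrite (le_trans (ler_normD _ _))// !normrM.
  have := ler_pM (normr_ge0 _) (normr_ge0 _) h2 h3'.
  have := ler_pM (normr_ge0 _) (normr_ge0 _) h3 h2'.
  lra.
Qed.

Lemma ubounded_cst (k : R) : ubounded (fun _ => k).
Proof. by exists (`|k| + 1) => [|s _]; [rewrite ltr_wpDl|rewrite lerDl]. Qed.

Lemma uboundedD f0 g0 : ubounded f0 -> ubounded g0 -> ubounded (fun s => f0 s + g0 s).
Proof.
move=> [C C0 H] [C' C'0 H']; exists (C + C') => [|s Ds]; first exact: addr_gt0.
by rewrite (le_trans (ler_normD _ _))// lerD// ?H ?H'.
Qed.

Lemma uboundedM f0 g0 : ubounded f0 -> ubounded g0 -> ubounded (fun s => f0 s * g0 s).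
Proof.
move=> [C C0 H] [C' C'0 H']; exists (C * C') => [|s Ds]; first exact: mulr_gt0.
by rewrite normrM ler_pM// ?H ?H'.
Qed.

Lemma uexp_scale (k : R) f f0 f1 : uexp f f0 f1 ->
  uexp (fun e s => k * f e s) (fun s => k * f0 s) (fun s => k * f1 s).
Proof.
move=> hf; apply: uexp_ext (uexpM (uexp_cst (ubounded_cst k)) hf) => //= s _.
by rewrite mul0r addr0.
Qed.

Lemma uexpB f f0 f1 g g0 g1 : uexp f f0 f1 -> uexp g g0 g1 ->
  uexp (fun e s => f e s - g e s) (fun s => f0 s - g0 s) (fun s => f1 s - g1 s).
Proof.
move=> hf hg; apply: uexp_ext (uexpD hf (uexp_scale (-1) hg)) => //= *; by rewrite mulN1r.
Qed.

Lemma uexp_near f f0 f1 (eps : R) : uexp f f0 f1 -> 0 < eps ->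
  exists2 e0 : R, 0 < e0 & forall e s, D s -> 0 <= e <= e0 -> `|f e s - f0 s| <= eps.
Proof.
move=> [C [e0 [C0 /andP[e00 e01] H]]] eps0.
exists (Num.min e0 (eps / (2 * C))).
  by rewrite lt_min e00 divr_gt0// mulr_gt0.
move=> e s Ds /andP[eg0]; rewrite le_min => /andP[ee ee'].
have [|h1 h2 h3] := H e s Ds; first by rewrite eg0.
have e1 : e <= 1 by apply: le_trans e01.
rewrite (_ : _ - _ = (f e s - (f0 s + e * f1 s)) + e * f1 s); last by ring.
rewrite (le_trans (ler_normD _ _))// normrM (ger0_norm eg0).
have : e * (2 * C) <= eps by rewrite -ler_pdivlMr// mulr_gt0.
have : e * `|f1 s| <= e * C by rewrite ler_wpM2l.
have : C * e ^+ 2 <= C * e by rewrite ler_pM2l// expr2 ler_piMl.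
lra.
Qed.

(** The zeroth-order term is the same [k] at all points, so one quadratic Taylor bound for h at [k]
    serves the whole set. *)
Lemma uexp_comp (h : R -> R) (k h1 M eta : R) f f1 : 0 < eta -> 0 <= M ->
  (forall x, `|x - k| <= eta -> `|h x - (h k + h1 * (x - k))| <= M * (x - k) ^+ 2) ->
  uexp f (fun _ => k) f1 ->
  uexp (fun e s => h (f e s)) (fun _ => h k) (fun s => h1 * f1 s).
Proof.
move=> eta0 M0 Hh hf; have [e1 e10 H1] := uexp_near hf eta0.
(* The product rule applied to f - k, whose constant term is 0, shows that (f - k)^2 is O(e^2). *)
have hq : uexp (fun e s => (f e s - k) ^+ 2) (fun=> 0) (fun=> 0).
  have hk := uexpB hf (uexp_cst (ubounded_cst k)).
  by apply: uexp_ext (uexpM hk hk) => //= s _; rewrite subrr !(mul0r, mulr0) ?addr0.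
move: hf hq => [C [e0 [C0 /andP[e00 e01] H]]] [C' [e0' [C'0 /andP[e00' e01'] H']]].
have B0 : 0 <= `|h1| * C by rewrite mulr_ge0// ltW.
have B1 : 0 <= M * C' by rewrite mulr_ge0// ltW.
exists (`|h1| * C + M * C' + `|h k| + 1), (Num.min e1 (Num.min e0 e0')); split.
- by rewrite ltr_wpDl// !addr_ge0.
- by rewrite !lt_min e10 e00 e00' !ge_min e01 orbT.
move=> e s Ds /andP[eg0]; rewrite !le_min => /and3P[ee1 ee ee'].
have [|g1 _ g3] := H e s Ds; first by rewrite eg0.
have [|g1' _ _] := H' e s Ds; first by rewrite eg0.
have g4 : `|f e s - k| <= eta by apply: H1 => //; rewrite eg0.
split; first last.
- by rewrite normrM (le_trans (ler_wpM2l (normr_ge0 h1) g3))// -!addrA lerDl !addr_ge0.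
- by rewrite [leRHS]addrAC lerDr addr_ge0 ?addr_ge0.
move: g1 g1' (Hh _ g4); rewrite mulr0 addr0 subr0 (ger0_norm (sqr_ge0 _)); set x := f e s.
move=> g1 g1' g5; rewrite (_ : _ - _ = (h x - (h k + h1 * (x - k))) +
  h1 * (x - (k + e * f1 s))); last by ring.
have t1 : `|h1 * (x - (k + e * f1 s))| <= `|h1| * C * e ^+ 2.
  by rewrite normrM -mulrA ler_wpM2l.
have t2 : M * (x - k) ^+ 2 <= M * C' * e ^+ 2 by rewrite -mulrA ler_wpM2l.
have t3 : 0 <= (`|h k| + 1) * e ^+ 2 by rewrite mulr_ge0 ?sqr_ge0// addr_ge0.
rewrite (le_trans (ler_normD _ _))//.
move: g5 t1 t2 t3; rewrite !mulrDl; move: `|_| `|_| (M * _) => u v w; lra.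
Qed.

(* The difference to the affine expansion of x^-1 at k is (x - k)^2 / (k^2 x). *)
Lemma uexpV (k : R) f f1 : 0 < k -> uexp f (fun _ => k) f1 ->
  uexp (fun e s => (f e s)^-1) (fun _ => k^-1) (fun s => - f1 s / k ^+ 2).
Proof.
move=> k0 hf; have k2 : 0 < k / 2 by rewrite divr_gt0.
have M0 : 0 <= 2 / k ^+ 3 by rewrite divr_ge0// exprn_ge0// ltW.
have H x : `|x - k| <= k / 2 ->
    `|x^-1 - (k^-1 + - (k ^+ 2)^-1 * (x - k))| <= 2 / k ^+ 3 * (x - k) ^+ 2; last first.
  apply: uexp_ext (uexp_comp k2 M0 H hf) => // s _.
  by rewrite mulNr mulrC mulNr.
move=> xk.
have x0 : k / 2 <= x by move: xk; rewrite ler_norml => /andP[+ _]; lra.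
have xp : 0 < x by apply: lt_le_trans x0.
have -> : x^-1 - (k^-1 + - (k ^+ 2)^-1 * (x - k)) = (x - k) ^+ 2 * (k ^+ 2 * x)^-1.
  by field; rewrite !gt_eqF.
rewrite ger0_norm; last by rewrite mulr_ge0 ?sqr_ge0// invr_ge0 mulr_ge0 ?sqr_ge0// ltW.
rewrite mulrC (ler_wpM2r (sqr_ge0 _))//.
have -> : 2 / k ^+ 3 = (k ^+ 2 * (k / 2))^-1 by field; rewrite gt_eqF.
by rewrite lef_pV2 ?posrE ?mulr_gt0 ?exprn_gt0// ler_pM2l ?exprn_gt0.
Qed.

(** For x = s^2 the error is exactly (s - k)^2 / (2 k), and (s + k)^2 >= k^2. For x < 0 the default
    value 0 of the root still satisfies the bound. *)
Lemma sqrt_expansion (k x : R) : 0 < k ->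
  `|Num.sqrt x - (k + (x - k ^+ 2) / (2 * k))| <= (x - k ^+ 2) ^+ 2 / (2 * k ^+ 3).
Proof.
move=> k0; have kn : k != 0 by rewrite gt_eqF.
have [x0|x0] := ltP x 0.
  rewrite ler0_sqrtr ?(ltW x0)// sub0r normrN.
  have -> : k + (x - k ^+ 2) / (2 * k) = (k ^+ 2 + x) / (2 * k) by field.
  have -> : (x - k ^+ 2) ^+ 2 / (2 * k ^+ 3) = (x - k ^+ 2) ^+ 2 / k ^+ 2 / (2 * k) by field.
  rewrite normrM (gtr0_norm (_ : 0 < (2 * k)^-1)) ?invr_gt0 ?mulr_gt0//.
  rewrite ler_pM2r ?invr_gt0 ?mulr_gt0// ler_pdivlMr ?exprn_gt0//.
  have k2 : 0 < k ^+ 2 by rewrite exprn_gt0.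
  move: (k ^+ 2) k2 => K K0; rewrite -[K in `|_| * K]gtr0_norm// -normrM.
  rewrite ler_norml; apply/andP; split; nra.
have s2 : Num.sqrt x ^+ 2 = x by rewrite sqr_sqrtr.
have s0 := sqrtr_ge0 x; move: (Num.sqrt x) s2 s0 => s <- s0.
have -> : s - (k + (s ^+ 2 - k ^+ 2) / (2 * k)) = - ((s - k) ^+ 2 / (2 * k)) by field.
rewrite normrN normrM (ger0_norm (sqr_ge0 _)) gtr0_norm ?invr_gt0 ?mulr_gt0//.
rewrite ler_pdivlMr ?mulr_gt0 ?exprn_gt0//.
have -> : (s - k) ^+ 2 / (2 * k) * (2 * k ^+ 3) = (s - k) ^+ 2 * k ^+ 2 by field.
have -> : (s ^+ 2 - k ^+ 2) ^+ 2 = (s - k) ^+ 2 * (s + k) ^+ 2 by ring.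
rewrite ler_wpM2l ?sqr_ge0//; nra.
Qed.

Lemma uexp_sqrt (k : R) f f1 : 0 < k -> uexp f (fun _ => k ^+ 2) f1 ->
  uexp (fun e s => Num.sqrt (f e s)) (fun _ => k) (fun s => f1 s / (2 * k)).
Proof.
move=> k0 hf; have M0 : 0 <= (2 * k ^+ 3)^-1.
  by rewrite invr_ge0 mulr_ge0// exprn_ge0// ltW.
have sk : Num.sqrt (k ^+ 2) = k by rewrite sqrtr_sqr gtr0_norm.
(* The bound of [sqrt_expansion] is global; the radius [k] only serves as a positive number. *)
have H x : `|x - k ^+ 2| <= k -> `|Num.sqrt x - (Num.sqrt (k ^+ 2) + (2 * k)^-1 * (x - k ^+ 2))|
    <= (2 * k ^+ 3)^-1 * (x - k ^+ 2) ^+ 2.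
  by move=> _; rewrite sk mulrC [leRHS]mulrC; exact: sqrt_expansion.
by apply: uexp_ext (uexp_comp k0 M0 H hf) => // s _; exact: mulrC.
Qed.

End UniformExpansion.

(** * Expansions of vector-valued quantities *)

Section VectorExpansion.
Context {R : realType} {X : Type}.
Variable D : set X.

Definition vexp (f : R -> X -> 'rV[R]_3) (f0 f1 : X -> 'rV[R]_3) :=
  forall i, uexp D (fun e s => f e s 0 i) (fun s => f0 s 0 i) (fun s => f1 s 0 i).

Definition vbounded (f0 : X -> 'rV[R]_3) := forall i, ubounded D (fun s => f0 s 0 i).

Lemma vexp_affine f0 f1 : vbounded f0 -> vbounded f1 ->
  vexp (fun e s => f0 s + e *: f1 s) f0 f1.
Proof.
move=> b0 b1 i; apply: uexp_ext (uexpD (uexp_cst (b0 i)) (uexp_lin (b1 i))) => //=.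
- by move=> e s _; rewrite !mxE.
- by move=> s _; rewrite addr0.
- by move=> s _; rewrite add0r.
Qed.

Lemma vexp_lin f1 : vbounded f1 -> vexp (fun e s => e *: f1 s) (fun=> 0) f1.
Proof.
by move=> b1 i; apply: uexp_ext (uexp_lin (b1 i)) => //= *; rewrite !mxE.
Qed.

Lemma uexp_dot f f0 f1 g g0 g1 : vexp f f0 f1 -> vexp g g0 g1 ->
  uexp D (fun e s => dot (f e s) (g e s)) (fun s => dot (f0 s) (g0 s))
    (fun s => dot (f0 s) (g1 s) + dot (f1 s) (g0 s)).
Proof.
move=> hf hg.
have h := uexpD (uexpD (uexpM (hf i0) (hg i0)) (uexpM (hf i1) (hg i1))) (uexpM (hf i2) (hg i2)).
by apply: uexp_ext h => /= *; rewrite !dotE; ring.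
Qed.

Lemma vexp_cross f f0 f1 g g0 g1 : vexp f f0 f1 -> vexp g g0 g1 ->
  vexp (fun e s => cross (f e s) (g e s)) (fun s => cross (f0 s) (g0 s))
    (fun s => cross (f0 s) (g1 s) + cross (f1 s) (g0 s)).
Proof.
move=> hf hg.
have h i j := uexpB (uexpM (hf i) (hg j)) (uexpM (hf j) (hg i)).
apply: ord3P.
- by apply: uexp_ext (h i1 i2) => /= *; rewrite !(mk3E, mxE) /=; ring.
- by apply: uexp_ext (h i2 i0) => /= *; rewrite !(mk3E, mxE) /=; ring.
- by apply: uexp_ext (h i0 i1) => /= *; rewrite !(mk3E, mxE) /=; ring.
Qed.

Lemma vexp_scale (k : X -> R) f f0 f1 : ubounded D k -> vexp f f0 f1 ->
  vexp (fun e s => k s *: f e s) (fun s => k s *: f0 s) (fun s => k s *: f1 s).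
Proof.
move=> bk hf i; apply: uexp_ext (uexpM (uexp_cst bk) (hf i)) => /= *; rewrite !mxE//.
by rewrite mul0r addr0.
Qed.

Lemma vexpD f f0 f1 g g0 g1 : vexp f f0 f1 -> vexp g g0 g1 ->
  vexp (fun e s => f e s + g e s) (fun s => f0 s + g0 s) (fun s => f1 s + g1 s).
Proof. by move=> hf hg i; apply: uexp_ext (uexpD (hf i) (hg i)) => /= *; rewrite !mxE. Qed.

(** At g = k = identity the trace of the square is 2, and the off-diagonal entries enter only at
    second order. *)
Lemma uexp_trace_sqr g11 g12 g22 k11 k12 k22 (a b d k l n : X -> R) :
  uexp D g11 (fun=> 1) a -> uexp D g12 (fun=> 0) b -> uexp D g22 (fun=> 1) d ->
  uexp D k11 (fun=> 1) k -> uexp D k12 (fun=> 0) l -> uexp D k22 (fun=> 1) n ->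
  uexp D (fun e s => trace_sqr (g11 e s) (g12 e s) (g22 e s) (k11 e s) (k12 e s) (k22 e s))
    (fun=> 2) (fun s => 2 * (a s + d s) + 2 * (k s + n s)).
Proof.
move=> h11 h12 h22 l11 l12 l22.
have A := uexpB (uexpD (uexpM h22 l11) (uexpM h11 l22)) (uexp_scale 2 (uexpM h12 l12)).
have B := uexpB (uexpM h11 h22) (uexpM h12 h12).
have C := uexpB (uexpM l11 l22) (uexpM l12 l12).
have E := uexpB (uexpM A A) (uexp_scale 2 (uexpM B C)).
by apply: uexp_ext E => /= *; rewrite /trace_sqr; ring.
Qed.

End VectorExpansion.

(** * Rotations *)

Section Rotation.
Context {R : realType}.
Variables (c : 'rV[R]_3) (r : R).
Hypothesis r0 : 0 < r.
Implicit Types (x y u v : 'rV[R]_3) (k : 'I_3) (t : R).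
Local Notation sph := (sphere c r).

(** Rodrigues' formula for the rotation by the angle t about the axis e_k. *)
Definition axrot k t y : 'rV[R]_3 :=
  y 0 k *: e_ k + cos t *: (y - y 0 k *: e_ k) + sin t *: cross (e_ k) y.

Lemma axrot_dot k t u v : dot (axrot k t u) (axrot k t v) = dot u v.
Proof.
have cs := cos2Dsin2 t; have cE : cos t ^+ 2 = 1 - sin t ^+ 2 by lra.
move: k; apply: ord3P; rewrite /axrot !dotE !(mk3E, e_E, mxE) /=;
  move: (u 0 i0) (u 0 i1) (u 0 i2) (v 0 i0) (v 0 i1) (v 0 i2) => a b d a' b' d'.
- transitivity (a * a' + (cos t ^+ 2 + sin t ^+ 2) * (b * b' + d * d')); [ring|rewrite cs; ring].
- transitivity (b * b' + (cos t ^+ 2 + sin t ^+ 2) * (a * a' + d * d')); [ring|rewrite cs; ring].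
- transitivity (d * d' + (cos t ^+ 2 + sin t ^+ 2) * (b * b' + a * a')); [ring|rewrite cs; ring].
Qed.

Lemma axrot_linear k t : linear (axrot k t).
Proof.
by move=> a u v; move: k; apply: ord3P; apply: rV3P; rewrite /axrot !(mk3E, e_E, mxE) /=; ring.
Qed.

Lemma axrotB k t u v : axrot k t (u - v) = axrot k t u - axrot k t v.
Proof. by rewrite addrC -scaleN1r axrot_linear scaleN1r addrC. Qed.

Lemma axrotK k t y : axrot k (- t) (axrot k t y) = y.
Proof.
have cs := cos2Dsin2 t.
have E (a b : R) : a = b * (cos t ^+ 2 + sin t ^+ 2) -> a = b by rewrite cs mulr1.
by move: k; apply: ord3P; apply: rV3P;
  rewrite /axrot cosN sinN !(mk3E, e_E, mxE) /=; first [ring | apply: E; ring].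
Qed.

Lemma axrotNK k t y : axrot k t (axrot k (- t) y) = y.
Proof. by have := axrotK k (- t) y; rewrite opprK. Qed.

Lemma axrot_norm k t y : `|axrot k t y| <= 3 * `|y|.
Proof.
apply: norm_rV3_le => [|i]; first by rewrite mulr_ge0.
by rewrite (le_trans (coord_le_enorm _ i))// /enorm axrot_dot; exact: enorm_le_norm.
Qed.

Lemma axrot_continuous k t : continuous (axrot k t).
Proof. by apply: (@lipschitz_continuous _ _ _ _ 3) => y y'; rewrite -axrotB; exact: axrot_norm. Qed.

Definition rotation k t x := c + axrot k t (x - c).

Lemma rotation_subc k t x : rotation k t x - c = axrot k t (x - c).
Proof. by rewrite /rotation addrC addKr. Qed.

Lemma rotationK k t : cancel (rotation k t) (rotation k (- t)).
Proof. by move=> x; rewrite {1}/rotation rotation_subc axrotK addrC subrK. Qed.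

Lemma rotationNK k t : cancel (rotation k (- t)) (rotation k t).
Proof. by move=> x; rewrite {1}/rotation rotation_subc axrotNK addrC subrK. Qed.

Lemma rotation_lip k t x y : `|rotation k t x - rotation k t y| <= 3 * `|x - y|.
Proof.
have -> : x - y = (x - c) - (y - c) by rewrite opprB addrA subrK.
rewrite /rotation opprD addrACA subrr add0r -axrotB.
exact: axrot_norm.
Qed.

Lemma rotation_sphere k t x : sph (rotation k t x) <-> sph x.
Proof. by rewrite /sphere /= rotation_subc axrot_dot. Qed.

Lemma rotation_image k t : rotation k t @` sph = sph.
Proof.
apply/seteqP; split=> [_ [x sx <-]|x sx]; first exact/rotation_sphere.
by exists (rotation k (- t) x); [exact/rotation_sphere|exact: rotationNK].
Qed.

Lemma axrotE k t y i : axrot k t y 0 i = y 0 k * e_ k 0 i +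
  cos t * (y 0 i - y 0 k * e_ k 0 i) + sin t * (cross (e_ k) y) 0 i.
Proof. by rewrite /axrot !mxE. Qed.

Let rotation_affine k t : rotation k t = (fun x => (c - axrot k t c) + axrot k t x).
Proof. by apply/funext => x; rewrite /rotation axrotB addrCA addrC addrA. Qed.

Lemma rotation_smooth k t : smooth_on setT (rotation k t).
Proof.
have oT : open [set: 'rV[R]_3] by exact: openT.
rewrite rotation_affine; apply: (smoothD oT); first exact: smooth_cst.
exact: (smooth_linear oT (axrot_linear k t) (@axrot_continuous k t)).
Qed.

Lemma derive_rotation k t x b : 'D_b (rotation k t) x = axrot k t b.
Proof.
have [d E] := linear_derive x b (axrot_linear k t) (@axrot_continuous k t).
have h := is_deriveD (is_derive_cst (c - axrot k t c) x b) (DeriveDef (diff_derivable d) E).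
rewrite rotation_affine; exact: etrans (@derive_val _ _ _ _ _ _ _ h) (add0r _).
Qed.

Lemma rotation_det k t x : jac_det (rotation k t) x = 1.
Proof.
rewrite /jac_det (derive_rotation k t x (e_ i0)) (derive_rotation k t x (e_ i1))
  (derive_rotation k t x (e_ i2)).
rewrite -(cos2Dsin2 t) /det3 dotE.
by move: k; apply: ord3P; rewrite /axrot !(mk3E, e_E, mxE) /=; ring.
Qed.

(** The squared area Jacobian is the Gram determinant of the image of an orthonormal tangent frame,
    and a rotation keeps the frame orthonormal. *)
Lemma rotation_area_jac k t s : sph s -> area_jac c r (rotation k t) s = 1.
Proof.
move=> ss; have [h1 h2 h3 h4 h5] := sphere_frame_orthonormal r0 ss.
have sT := rotation_smooth k t.
have := @image_gram _ c r (rotation k t) r0 sT s _ _ ss h1 h2 h3 h4 h5.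
rewrite (derive_rotation k t s (sphere_frame c r s i0)).
rewrite (derive_rotation k t s (sphere_frame c r s i1)).
rewrite /gram !axrot_dot h1 h2 h3 mulr1 expr2 mulr0 subr0 => h.
rewrite /area_jac -[r in _ / r]gtr0_norm// -sqrtr_sqr -sqrtrV ?sqr_ge0// -sqrtrM ?dot_ge0//.
by rewrite -h sqrtr1.
Qed.

End Rotation.

Lemma norm_sub_continuous (R : realType) (E : normedModType R) (c : E) :
  continuous (fun x => `|x - c|).
Proof. by move=> x; apply: cvg_norm; apply: cvgB; [exact: cvg_id|exact: cvg_cst]. Qed.

Section ContinuousReal.
Context {R : realType} {T : topologicalType}.
Implicit Types f g : T -> R.

Lemma continuous_addr f (B : R) : continuous f -> continuous (fun x => f x + B).
Proof. by move=> cf x; apply: cvgD; [exact: cf|exact: cvg_cst]. Qed.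

Lemma continuous_scaler f (k : R) : continuous f -> continuous (fun x => k * f x).
Proof. by move=> cf x; apply: cvgM; [exact: cvg_cst|exact: cf]. Qed.

Lemma continuous_subr f g : continuous f -> continuous g -> continuous (fun x => f x - g x).
Proof. by move=> cf cg x; apply: cvgB; [exact: cf|exact: cg]. Qed.

Lemma continuous_addf f g : continuous f -> continuous g -> continuous (fun x => f x + g x).
Proof. by move=> cf cg x; apply: cvgD; [exact: cf|exact: cg]. Qed.

End ContinuousReal.

Section SmoothVectors.
Context {R : realType} {E : normedModType R}.
Variables (U : set E) (Uo : open U).
Implicit Types f g : E -> 'rV[R]_3.

Lemma smooth_dot f g : smooth_on U f -> smooth_on U g ->
  smooth_on U (fun x => dot (f x) (g x)).
Proof.
move=> /(smooth_rV3 Uo) sf /(smooth_rV3 Uo) sg.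
apply: (smooth_ext Uo (f := fun x =>
  f x 0 i0 * g x 0 i0 + f x 0 i1 * g x 0 i1 + f x 0 i2 * g x 0 i2)).
  by move=> x _; rewrite dotE.
exact: (smoothD Uo (smoothD Uo (smoothM Uo (sf _) (sg _)) (smoothM Uo (sf _) (sg _)))
  (smoothM Uo (sf _) (sg _))).
Qed.

Lemma smooth_cross f g : smooth_on U f -> smooth_on U g ->
  smooth_on U (fun x => cross (f x) (g x)).
Proof.
move=> /(smooth_rV3 Uo) sf /(smooth_rV3 Uo) sg; apply/(smooth_rV3 Uo).
have B i j : smooth_on U (fun x => f x 0 i * g x 0 j - f x 0 j * g x 0 i).
  exact: (smoothB Uo (smoothM Uo (sf _) (sg _)) (smoothM Uo (sf _) (sg _))).
by apply: ord3P; [apply: (smooth_ext Uo _ (B i1 i2))|apply: (smooth_ext Uo _ (B i2 i0))|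
  apply: (smooth_ext Uo _ (B i0 i1))] => x _; rewrite !mk3E.
Qed.

End SmoothVectors.

Lemma smooth_subc (R : realType) (c : 'rV[R]_3) : smooth_on setT (fun x : 'rV[R]_3 => x - c).
Proof.
have oT : open [set: 'rV[R]_3] by exact: openT.
apply/(smooth_rV3 oT) => i.
apply: (smooth_ext oT (f := fun x : 'rV[R]_3 => x 0 i - c 0 i)).
  by move=> x _; rewrite !mxE.
by apply: (smoothB oT); [exact: smooth_coord|exact: smooth_cst].
Qed.

Section RotationTime.
Context {R : realType}.
Variables (c : 'rV[R]_3) (r : R).
Hypothesis r0 : 0 < r.
Local Notation sph := (sphere c r).

(** Each coordinate of e_k x y is 0 or, up to sign, a coordinate of y. *)
Lemma cross_e_le k (y : 'rV[R]_3) (B : R) i : 0 <= B -> (forall i, `|y 0 i| <= B) ->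
  `|cross (e_ k) y 0 i| <= B.
Proof.
move=> B0 yB; have y0 := yB i0; have y1 := yB i1; have y2 := yB i2.
by move: k; apply: ord3P; move: i; apply: ord3P; rewrite !mk3E !e_E /=
  ?mul1r ?mul0r ?subr0 ?sub0r ?normrN ?normr0.
Qed.

Lemma rotation_time_derive k s t :
  is_derive t (1 : R) (fun t => rotation c k t s) (cross (e_ k) (rotation c k t s - c)).
Proof.
apply: is_derive_rV3 => i; rewrite rotation_subc; set y := s - c.
rewrite (_ : (fun x => _) = (fun t => c 0 i + (y 0 k * e_ k 0 i +
  cos t * (y 0 i - y 0 k * e_ k 0 i) + sin t * (cross (e_ k) y) 0 i))); last first.
  by apply/funext => x; rewrite /rotation mxE axrotE.
have K (a : R) := is_derive_const t (1 : R) a.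
have h := is_derive_add (K (c 0 i)) (is_derive_add (is_derive_add
  (K (y 0 k * e_ k 0 i)) (is_derive_mul (is_derive_cos t) (K (y 0 i - y 0 k * e_ k 0 i))))
  (is_derive_mul (is_derive_sin t) (K ((cross (e_ k) y) 0 i)))).
apply: (is_derive_eq h); rewrite !add0r !mulr0 !addr0.
by move: k i {h}; apply: ord3P; apply: ord3P; rewrite !mk3E !axrotE !mk3E !e_E /=; ring.
Qed.

Lemma rotation_displacement k s t : 0 < t -> sph s ->
  `|rotation c k t s - s| <= r * t.
Proof.
move=> t0 ss; apply: norm_rV3_le => [|i]; first by rewrite mulr_ge0// ltW.
have d u := is_derive_coord _ _ _ _ i (rotation_time_derive k s u).
have [u ut] := MVT_line t0 d.
have r00 : rotation c k 0 s = s.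
  by rewrite /rotation /axrot cos0 sin0 scale1r scale0r addr0 [_ *: _ + _]addrC subrK addrC subrK.
rewrite r00 => e; rewrite mxE [(- s) 0 i]mxE e normrM (gtr0_norm t0) ler_wpM2r//; first exact: ltW.
apply: cross_e_le; first exact: ltW.
by move=> j; apply: (sphere_coord r0); apply/rotation_sphere.
Qed.

Lemma box_compact : compact [set x : 'rV[R]_3 | `|x - c| <= r].
Proof.
apply: bounded_closed_compact.
  exists (`|c| + r); split; first exact: num_real.
  move=> M lM x /= xr; rewrite (le_trans _ (ltW lM))//.
  by rewrite -{1}(subrK c x) (le_trans (ler_normD _ _))// addrC lerD2l.
rewrite (_ : mkset _ = (fun x => `|x - c|) @^-1` [set x : R | x <= r])//.
apply: closed_comp => [x _|]; last exact: closed_le.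
exact: norm_sub_continuous.
Qed.

(** Segments between points of the sphere leave it but stay in the convex box of [box_compact],
    where the partial derivatives are bounded. *)
Lemma smooth_lipschitz_sphere (h : 'rV[R]_3 -> R) : smooth_on setT h ->
  exists2 K, 0 <= K & forall x y, sph x -> sph y -> `|h y - h x| <= K * `|y - x|.
Proof.
move=> sh.
have [i|B B0 HB] := compact_funs_bounded (f := fun i => 'D_(e_ i) h) box_compact.
  move=> x; apply: diff_cont; exact: (smooth_diff _ _ _ (smooth_derive _ _ _ _ sh)).
exists (3 * B) => [|x y sx sy]; first by rewrite mulr_ge0.
apply: lipschitz_line => [z|t i /andP[t0 t1]]; first exact: (smooth_diff _ _ _ sh).
apply: HB => /=.
have nx : `|x - c| <= r by apply: norm_rV3_le; [exact: ltW|move=> j; exact: sphere_coord].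
have ny : `|y - c| <= r by apply: norm_rV3_le; [exact: ltW|move=> j; exact: sphere_coord].
have -> : x + t *: (y - x) - c = (1 - t) *: (x - c) + t *: (y - c).
  by apply: rV3P; rewrite !mxE; ring.
rewrite (le_trans (ler_normD _ _))// !normrZ (gtr0_norm t0) gtr0_norm ?subr_gt0//.
have -> : r = (1 - t) * r + t * r by ring.
by apply: lerD; apply: ler_wpM2l => //; [rewrite subr_ge0|]; exact: ltW.
Qed.

End RotationTime.

Lemma smooth_rotation_field (R : realType) (c : 'rV[R]_3) (psi : 'rV[R]_3 -> R) k :
  smooth_on setT psi -> smooth_on setT (fun x => 'D_(cross (e_ k) (x - c)) psi x).
Proof.
move=> spsi; have oT : open [set: 'rV[R]_3] by exact: openT.
have sd i : smooth_on setT ('D_(e_ i) psi) by exact: smooth_derive.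
have sc i : smooth_on setT (fun x : 'rV[R]_3 => cross (e_ k) (x - c) 0 i).
  move: i; apply/(smooth_rV3 oT); apply: (smooth_cross oT); first exact: smooth_cst.
  exact: smooth_subc.
apply: (smooth_ext oT (f := fun x => cross (e_ k) (x - c) 0 i0 * 'D_(e_ i0) psi x +
  cross (e_ k) (x - c) 0 i1 * 'D_(e_ i1) psi x + cross (e_ k) (x - c) 0 i2 * 'D_(e_ i2) psi x)).
  move=> x _; exact: esym (derive_basis _ _ _ _ (cross (e_ k) (x - c)) (smooth_diff _ _ _ spsi x I)).
exact: (smoothD oT (smoothD oT (smoothM oT (sc _) (sd _)) (smoothM oT (sc _) (sd _)))
  (smoothM oT (sc _) (sd _))).
Qed.

(** * Rotation invariance of integrals over the sphere *)

Section SphereIntegral.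
Context {R : realType}.
Variables (c : 'rV[R]_3) (r : R).
Hypothesis r0 : 0 < r.
Variable sigma : {measure set borel3 R -> \bar R}.
Local Notation sph := (sphere c r).
Hypothesis sigmaP : is_surface_measure sph sigma.
Local Notation S := (sph : set (borel3 R)).

Lemma sphere_measurable : measurable S.
Proof. by apply: compact_borel3; exact: sphere_compact. Qed.

Lemma sphere_finite : (sigma S < +oo)%E.
Proof. exact: compact_surface_finite (sphere_surface c r0) sigmaP. Qed.

Lemma bounded_integrable (f : borel3 R -> R) : measurable_fun S f ->
  (exists B, forall s, S s -> `|f s| <= B) -> sigma.-integrable S (EFin \o f).
Proof.
move=> mf [B HB]; apply: measurable_bounded_integrable => //.
- exact: sphere_measurable.
- exact: sphere_finite.
- exists B; split; first exact: num_real.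
  by move=> M BM x Sx; exact: le_trans (HB x Sx) (ltW BM).
Qed.

Lemma continuous_sphere_integrable (f : 'rV[R]_3 -> R) : continuous f ->
  sigma.-integrable S (EFin \o (f : borel3 R -> R)).
Proof.
move=> cf; apply: bounded_integrable; first exact: continuous_borel3.
by have [B _ HB] := compact_fun_bounded (sphere_compact (c := c) r0) cf; exists B.
Qed.

(** The sphere is its own image, so the change of variables relates [sigma] to itself, with area
    Jacobian 1. *)
Lemma rotation_invariant_ge0 (f : 'rV[R]_3 -> R) k t : continuous f ->
  (forall s, sph s -> 0 <= f s) ->
  surface_integral sigma sph (f \o rotation c k t) = surface_integral sigma sph f.
Proof.
move=> cf f0; congr fine.
have sT := rotation_smooth c k t.
have ST := @rotationK R c k t; have TS := @rotationNK R c k t.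
have Slip y y' := rotation_lip c k (- t) y y'.
have det0 x : 0 < jac_det (rotation c k t) x by rewrite rotation_det.
have J1 s : sph s -> area_jac c r (rotation c k t) s = 1 by exact: rotation_area_jac.
have mf : measurable_fun (rotation c k t @` sph : set (borel3 R)) (f : borel3 R -> R).
  exact: continuous_borel3.
have sP' : is_surface_measure (rotation c k t @` sph) sigma by rewrite rotation_image.
have cT : continuous (rotation c k t) by move=> x; exact: (diff_cont (smooth_diff _ _ _ sT x I)).
have Tinj : {in sph &, injective (rotation c k t)}.
  by move=> x y _ _ /(congr1 (rotation c k (- t))); rewrite !ST.
have mJ : measurable_fun S (area_jac c r (rotation c k t) : borel3 R -> R).
  apply: (@eq_measurable_fun _ _ _ _ S (cst (1 : R))) => [s|]; last exact: measurable_cst.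
  by rewrite inE => /J1 ->.
have J0 s : sph s -> 0 <= area_jac c r (rotation c k t) s by move=> /J1 ->.
have f0' s : (rotation c k t @` sph) s -> 0 <= f s by rewrite rotation_image; exact: f0.
have := change_of_variables (sphere_surface c r0) cT Tinj
  (fun U X => image_param r0 sT ST Slip det0 (U := U) (X := X))
  (fun U X p => image_area r0 sT (U := U) (X := X) (p := p)) J0 mJ sigmaP sP' mf f0'.
rewrite rotation_image => ->.
by apply: eq_integral => s; rewrite inE => /J1 ->; rewrite mulr1.
Qed.

(** Adding a bound B makes f nonnegative on the sphere, and the integral of B, finite and equal on
    both sides, cancels. *)
Lemma rotation_invariant (f : 'rV[R]_3 -> R) k t : continuous f ->
  surface_integral sigma sph (f \o rotation c k t) = surface_integral sigma sph f.
Proof.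
move=> cf; have [B B0 HB] := compact_fun_bounded (sphere_compact (c := c) r0) cf.
have cT : continuous (rotation c k t).
  by move=> x; exact: (diff_cont (smooth_diff _ _ _ (rotation_smooth c k t) x I)).
have cfB : continuous (fun x => f x + B).
  exact: continuous_addr.
have cfT : continuous (f \o rotation c k t).
  by move=> x; apply: continuous_comp; [exact: cT|exact: cf].
have fB0 s : sph s -> 0 <= f s + B.
  by move=> /HB; rewrite ler_norml => /andP[+ _]; rewrite lerNl -subr_ge0 opprK addrC.
have mS := sphere_measurable.
have iB : sigma.-integrable S (EFin \o (cst B : borel3 R -> R)).
  by apply: continuous_sphere_integrable; exact: cst_continuous.
have := rotation_invariant_ge0 k t cfB fB0.
rewrite /surface_integral.
rewrite (@RintegralD _ _ _ sigma S f (cst B) mS (continuous_sphere_integrable cf) iB).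
have -> : ((fun x => f x + B) \o rotation c k t) =
  (fun x => (f \o rotation c k t) x + cst B x) by [].
rewrite (@RintegralD _ _ _ sigma S (f \o rotation c k t) (cst B) mS
  (continuous_sphere_integrable cfT) iB).
by move/addIr.
Qed.

(** With h the integrand, the integral of psi \o rotation - psi is 0 by invariance, while this
    difference is t h + O(t^2) uniformly on the sphere. Hence the integral of h is O(t) for every t
    > 0. *)
Lemma sphere_integral_rotation_field (psi : 'rV[R]_3 -> R) k : smooth_on setT psi ->
  surface_integral sigma sph (fun x => 'D_(cross (e_ k) (x - c)) psi x) = 0.
Proof.
move=> spsi; set h := fun x => _.
have dpsi x : differentiable psi x by exact: (smooth_diff _ _ _ spsi).
have sh : smooth_on setT h by exact: smooth_rotation_field.
have [K K0 Klip] := smooth_lipschitz_sphere c r0 sh.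
have ch : continuous h by move=> x; exact: (diff_cont (smooth_diff _ _ _ sh x I)).
have cpsi : continuous psi by move=> x; exact: diff_cont.
have cT t : continuous (rotation c k t).
  by move=> x; exact: (diff_cont (smooth_diff _ _ _ (rotation_smooth c k t) x I)).
have cpT t : continuous (psi \o rotation c k t).
  by move=> x; apply: continuous_comp; [exact: cT|exact: cpsi].
have r00 s : rotation c k 0 s = s.
  by rewrite /rotation /axrot cos0 sin0 scale1r scale0r addr0 [_ *: _ + _]addrC subrK addrC subrK.
have expand t s : 0 < t -> sph s ->
    `|psi (rotation c k t s) - psi s - t * h s| <= K * r * t ^+ 2.
  move=> t0 ss.
  have d u : is_derive u (1 : R) (fun u => psi (rotation c k u s)) (h (rotation c k u s)).
    exact: (is_derive_curve psi _ _ _ (rotation_time_derive c k s u) (dpsi _)).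
  have [u /andP[u0 ut]] := MVT_line t0 d; rewrite r00 => ->.
  rewrite [t * _]mulrC -mulrBl normrM (gtr0_norm t0).
  have h1 : `|h (rotation c k u s) - h s| <= K * `|rotation c k u s - s|.
    by apply: Klip => //; apply/rotation_sphere.
  have h2 := rotation_displacement r0 k u0 ss.
  rewrite expr2 mulrA (ler_wpM2r (ltW t0))// (le_trans h1)// -mulrA (ler_wpM2l K0)//.
  by rewrite (le_trans h2)// (ler_wpM2l (ltW r0))// ltW.
have mS := sphere_measurable.
pose m := fine (sigma S).
have m0 : 0 <= m by apply: fine_ge0.
have ih := continuous_sphere_integrable ch.
have ip := continuous_sphere_integrable cpsi.
have ipT t := continuous_sphere_integrable (cpT t).
apply/eqP; rewrite -normr_le0; apply/ler_addgt0Pl => eps eps0; rewrite addr0.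
(* Makes the error [K * r * m * t] at most [eps]; the 1 guards against a zero denominator. *)
pose t := eps / (K * r * m + 1).
have d0 : 0 < K * r * m + 1 by rewrite ltr_wpDl// !mulr_ge0// ltW.
have t0 : 0 < t by rewrite divr_gt0.
have cth : continuous (fun x => t * h x).
  exact: continuous_scaler.
have ith := continuous_sphere_integrable cth.
have cdiff : continuous (fun x => (psi \o rotation c k t) x - psi x).
  exact: continuous_subr (cpT t) cpsi.
have idiff := continuous_sphere_integrable cdiff.
pose q x := (psi \o rotation c k t) x - psi x - t * h x.
have cq : continuous q by exact: continuous_subr cdiff cth.
have iq := continuous_sphere_integrable cq.
have qE : \int[sigma]_(x in S) q x = - (t * \int[sigma]_(x in S) h x).
  rewrite /q (RintegralB mS idiff ith) (RintegralB mS (ipT t) ip) (RintegralZl _ mS ih).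
  have := rotation_invariant k t cpsi; rewrite /surface_integral => ->.
  by rewrite subrr sub0r.
have qle : `|\int[sigma]_(x in S) q x| <= K * r * t ^+ 2 * m.
  apply: (le_trans (le_normr_Rintegral mS iq)).
  rewrite -(Rintegral_cst sigma mS); apply: le_Rintegral => //.
  - exact: integrable_norm.
  - by apply: continuous_sphere_integrable; exact: cst_continuous.
  - by move=> x Sx; exact: expand.
move: qle; rewrite qE normrN normrM (gtr0_norm t0) /surface_integral.
move: (`|_|) => I0.
have -> : K * r * t ^+ 2 * m = t * (K * r * m * t) by ring.
rewrite ler_pM2l// => /le_trans; apply.
have -> : eps = (K * r * m + 1) * t by rewrite /t mulrC divfK// gt_eqF.
by rewrite (ler_wpM2r (ltW t0))// lerDl.
Qed.

End SphereIntegral.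

(** * Perturbations of the identity *)

Lemma contraction_fixed_point (R : realType) (X : completeNormedModType R) (f : X -> X) (q : R) :
  0 <= q < 1 -> (forall x y, `|f x - f y| <= q * `|x - y|) -> exists x, f x = x.
Proof.
move=> /andP[q0 q1] fq.
pose g : {fun [set: X] >-> [set: X]} := totalfun f.
have cg : is_contraction g.
  exists (NngNum q0); split => //= -[x y] _; exact: fq.
have [p _ pE] := banach_fixed_point cg closedT (ex_intro _ 0 I).
by exists p; exact: esym pE.
Qed.

(* The library provides completeness and the normed module structure of
   'rV[R]_3 but not their join. *)
Definition complete_rV3 (R : realType) : completeNormedModType R :=
  HB.pack_for (completeNormedModType R) 'rV[R]_3 (Complete.on 'rV[R]_3).

Section Perturbation.
Context {R : realType}.
Variable V : 'rV[R]_3 -> 'rV[R]_3.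
Hypothesis sV : smooth_on setT V.

Lemma field_diff x : differentiable V x.
Proof. exact: (smooth_diff _ _ _ sV). Qed.

Lemma field_derive_diff a x : differentiable ('D_a V) x.
Proof. exact: (smooth_diff _ _ _ (smooth_derive _ _ _ _ sV)). Qed.

Let derive_affine (f g : 'rV[R]_3 -> 'rV[R]_3) e x a b df : is_derive x a f b ->
  is_derive x a g df -> is_derive x a (fun x => f x + e *: g x) (b + e *: df).
Proof. by move=> hf hg; exact: is_deriveD hf (is_deriveZ e hg). Qed.

Lemma derive_perturb e x b : 'D_b (perturb V e) x = b + e *: 'D_b V x.
Proof.
have h := derive_affine e (is_derive_id x b) (derivableP (diff_derivable (v := b) (field_diff x))).
exact: (@derive_val _ _ _ _ _ _ _ h).
Qed.

Lemma derive2_perturb e x a b : 'D_a ('D_b (perturb V e)) x = e *: 'D_a ('D_b V) x.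
Proof.
have -> : 'D_b (perturb V e) = (fun x => b + e *: 'D_b V x).
  by apply/funext => y; exact: derive_perturb.
have h := derive_affine e (is_derive_cst b x a)
  (derivableP (diff_derivable (v := a) (field_derive_diff b x))).
exact: (etrans (@derive_val _ _ _ _ _ _ _ h) (add0r _)).
Qed.

Lemma field_coord_smooth i : smooth_on setT (fun x => V x 0 i).
Proof. by move: sV => /(smooth_rV3 openT); apply. Qed.

Lemma smooth_perturb e : smooth_on setT (perturb V e).
Proof.
have oT : open [set: 'rV[R]_3] by exact: openT.
apply/(smooth_rV3 oT) => i.
apply: (smooth_ext oT (f := fun x : 'rV[R]_3 => x 0 i + e * V x 0 i)).
  by move=> x _; rewrite !mxE.
apply: (smoothD oT); first exact: smooth_coord.
apply: (smoothM oT); first exact: smooth_cst.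
exact: field_coord_smooth.
Qed.

Hypothesis cV : compact (closure [set x | V x != 0]).

(** The bound is global: continuity gives it on the compact support, and off the support the
    derivatives vanish. *)
Lemma field_derive_bounded : exists2 B : R, 0 <= B &
  forall i j x, `|('D_(e_ i) V x) 0 j| <= B.
Proof.
have [[i j] x|B B0 HB] := compact_funs_bounded
    (f := fun (ij : 'I_3 * 'I_3) x => ('D_(e_ ij.1) V x) 0 ij.2) cV.
  by apply: diff_cont; apply: differentiable_comp_rV3; exact: field_derive_diff.
exists B => // i j x.
have [/(HB (i, j))//|nx] := pselect (closure [set x | V x != 0] x).
by rewrite (derive_out_support _ nx) mxE normr0.
Qed.

Lemma field_lipschitz : exists2 K : R, 0 <= K & forall x y, `|V x - V y| <= K * `|x - y|.
Proof.
have [B B0 HB] := field_derive_bounded.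
exists (3 * B) => [|x y]; first exact: mulr_ge0.
apply: norm_rV3_le => [|i]; first by rewrite mulr_ge0// mulr_ge0.
rewrite mxE [(- V y) 0 i]mxE.
apply: (@lipschitz_line _ (fun x => V x 0 i) B y x) => [z|t j _].
  exact: (smooth_diff _ _ _ (field_coord_smooth i)).
set z := y + _.
have dz : derivable V z (e_ j) by apply: diff_derivable; exact: field_diff.
rewrite -(derive_rV3 _ _ _ i dz); exact: HB.
Qed.

(** The preimage of y is the fixed point of x |-> y - e V x, a contraction with factor 1/2. The same
    estimate gives |x - y| <= 2 |T x - T y|, hence injectivity and the Lipschitz constant 2 of the
    inverse. *)
Lemma perturb_inverse : exists2 e0 : R, 0 < e0 & forall e, 0 <= e < e0 ->
  exists S, [/\ cancel (perturb V e) S, cancel S (perturb V e) &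
    forall y y', `|S y - S y'| <= 2 * `|y - y'|].
Proof.
have [K K0 HK] := field_lipschitz.
have K1 : 0 < 2 * (K + 1) by rewrite mulr_gt0// ltr_wpDl.
(* Below this threshold [e * K <= 1 / 2]; the 1 covers the case K = 0. *)
exists (2 * (K + 1))^-1 => [|e /andP[e0 e1]]; first by rewrite invr_gt0.
have eK : e * K <= 2^-1.
  move: e1; rewrite -[(_ * _)^-1]mul1r ltr_pdivlMr// => e1; lra.
have lip x y : `|e *: V x - e *: V y| <= 2^-1 * `|x - y|.
  rewrite -scalerBr normrZ (ger0_norm e0).
  by rewrite (le_trans (ler_wpM2l e0 (HK x y)))// mulrA ler_wpM2r.
have low x y : `|x - y| <= 2 * `|perturb V e x - perturb V e y|.
  have -> : perturb V e x - perturb V e y = (x - y) + (e *: V x - e *: V y).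
    by rewrite /perturb opprD addrACA.
  have := lerB_normD (x - y) (e *: V x - e *: V y); have := lip x y.
  move: `|x - y| `|_| `|_| => a b d; lra.
have onto y : exists x, perturb V e x = y.
  have h : 0 <= (2^-1 : R) < 1 by apply/andP; split; lra.
  have [x z|x xE] := @contraction_fixed_point R (complete_rV3 R) (fun x => y - e *: V x) _ h.
    by rewrite opprB addrC addrA subrK distrC; exact: lip.
  by exists x; rewrite /perturb -{1}xE subrK.
have [S HS] := choice onto; exists S; split => //.
- move=> x; apply/eqP; rewrite -subr_eq0 -normr_le0.
  by rewrite (le_trans (low _ _))// HS subrr normr0 mulr0.
- by move=> y y'; rewrite -{2}(HS y) -{2}(HS y').
Qed.

End Perturbation.

Section VectorBounds.
Context {R : realType} {X : Type}.
Variable D : set X.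
Implicit Types f g u v w a : X -> 'rV[R]_3.

Lemma vexp_ext (f g : R -> X -> 'rV[R]_3) f0 g0 f1 g1 :
  (forall e s, D s -> f e s = g e s) -> (forall s, D s -> f0 s = g0 s) ->
  (forall s, D s -> f1 s = g1 s) -> vexp D f f0 f1 -> vexp D g g0 g1.
Proof.
by move=> fg fg0 fg1 hf i; apply: uexp_ext (hf i) => [e s|s|s] Ds; rewrite ?fg ?fg0 ?fg1.
Qed.

Lemma vbounded_unit f : (forall s, D s -> dot (f s) (f s) = 1) -> vbounded D f.
Proof.
move=> f1 i; exists 1 => // s /f1 fs.
by rewrite (le_trans (coord_le_enorm _ i))// /enorm fs sqrtr1.
Qed.

Lemma vbounded_comb u v w a : vbounded D u -> vbounded D v -> vbounded D w ->
  vbounded D a -> vbounded D (fun s => comb3 (u s) (v s) (w s) (a s)).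
Proof.
move=> bu bv bw ba i.
have [C C0 H] := uboundedD (uboundedD (uboundedM (ba i0) (bu i))
  (uboundedM (ba i1) (bv i))) (uboundedM (ba i2) (bw i)).
by exists C => // s /H; rewrite !mxE.
Qed.

Lemma vbounded_ext f g : (forall s, D s -> f s = g s) -> vbounded D f -> vbounded D g.
Proof. by move=> fg bf i; have [C C0 H] := bf i; exists C => // s Ds; rewrite -fg ?H. Qed.

End VectorBounds.

(** * First-order expansion of the perturbed geometry *)

Section Expansion.
Context {R : realType}.
Variables (c : 'rV[R]_3) (r : R).
Hypothesis r0 : 0 < r.
Variable V : 'rV[R]_3 -> 'rV[R]_3.
Hypothesis sV : smooth_on setT V.
Hypothesis cV : compact (closure [set x | V x != 0]).
Local Notation sph := (sphere c r).

Definition divergence x : R :=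
  ('D_(e_ i0) V x) 0 i0 + ('D_(e_ i1) V x) 0 i1 + ('D_(e_ i2) V x) 0 i2.

(** Compact support makes this uniform on any set D; D = [setT] is what [perturb_det_gt0] requires,
    and D = [sph] serves the densities. *)
Lemma derive_expansion D i : vexp D (fun e x => 'D_(e_ i) (perturb V e) x)
  (fun=> e_ i) (fun x => 'D_(e_ i) V x).
Proof.
have [B B0 HB] := field_derive_bounded sV cV.
apply: vexp_ext (vexp_affine (f0 := fun=> e_ i) (f1 := 'D_(e_ i) V) _ _) => //.
- by move=> e s _; rewrite (derive_perturb sV).
- by move=> j; exact: ubounded_cst.
- move=> j; exists (B + 1); first by rewrite ltr_wpDl.
  by move=> s _; rewrite (le_trans (HB i j s))// lerDl.
Qed.

Lemma det_expansion D :
  uexp D (fun e x => jac_det (perturb V e) x) (fun=> 1) divergence.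
Proof.
have h := uexp_dot (derive_expansion D i0)
  (vexp_cross (derive_expansion D i1) (derive_expansion D i2)).
apply: uexp_ext h => //= x _.
- by rewrite dotE !mk3E !e_E /=; ring.
- rewrite /divergence; move: ('D_(e_ i0) V x) ('D_(e_ i1) V x) ('D_(e_ i2) V x) => u v w.
  by rewrite !dotE !mxE /=; ring.
Qed.

Lemma perturb_det_gt0 : exists2 e0 : R, 0 < e0 & forall e, 0 <= e < e0 ->
  forall x, 0 < jac_det (perturb V e) x.
Proof.
have h2 : 0 < (2^-1 : R) by rewrite invr_gt0.
have [e0 e00 H] := uexp_near (det_expansion setT) h2.
exists e0 => // e /andP[eg e1] x; have := H e x I.
rewrite eg (ltW e1) => /(_ isT); rewrite ler_norml => /andP[+ _]; move: (jac_det _ _) => d; lra.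
Qed.

Lemma derive2_bounded i j : vbounded sph (fun x => 'D_(e_ i) ('D_(e_ j) V) x).
Proof.
move=> k; have [|B B0 HB] := @compact_fun_bounded _ _
    (fun x => ('D_(e_ i) ('D_(e_ j) V) x) 0 k) (sphere_compact (c := c) r0).
  move=> x; apply: diff_cont; apply: differentiable_comp_rV3.
  exact: (smooth_diff _ _ _ (smooth_derive _ _ _ _ (smooth_derive _ _ _ _ sV))).
by exists (B + 1) => [|s /HB /le_trans]; [rewrite ltr_wpDl|apply; rewrite lerDl].
Qed.

(** For directions frozen at the point, as in 'D_(a x) ('D_(b x) V) x, this is a polynomial in the
    coordinates of the directions; boundedness and measurability along vector fields follow. *)
Lemma derive2_basis a b x : 'D_a ('D_b V) x =
  comb3 (comb3 ('D_(e_ i0) ('D_(e_ i0) V) x) ('D_(e_ i0) ('D_(e_ i1) V) x) ('D_(e_ i0) ('D_(e_ i2) V) x) b)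
    (comb3 ('D_(e_ i1) ('D_(e_ i0) V) x) ('D_(e_ i1) ('D_(e_ i1) V) x) ('D_(e_ i1) ('D_(e_ i2) V) x) b)
    (comb3 ('D_(e_ i2) ('D_(e_ i0) V) x) ('D_(e_ i2) ('D_(e_ i1) V) x) ('D_(e_ i2) ('D_(e_ i2) V) x) b) a.
Proof.
have cE (u v w u' v' w' d : 'rV[R]_3) : u = u' -> v = v' -> w = w' ->
    comb3 u v w d = comb3 u' v' w' d by move=> -> -> ->.
have E i : 'D_(e_ i) ('D_b V) x = comb3 ('D_(e_ i) ('D_(e_ i0) V) x)
    ('D_(e_ i) ('D_(e_ i1) V) x) ('D_(e_ i) ('D_(e_ i2) V) x) b.
  apply: (etrans (deriveC_rV3 x (e_ i) b sV)).
  apply: (etrans (derive_basis _ _ _ _ b (field_derive_diff sV (e_ i) x))).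
  exact: (cE _ _ _ _ _ _ b (deriveC_rV3 x (e_ i0) (e_ i) sV)
    (deriveC_rV3 x (e_ i1) (e_ i) sV) (deriveC_rV3 x (e_ i2) (e_ i) sV)).
apply: (etrans (derive_basis _ _ _ _ a (field_derive_diff sV b x))).
exact: (cE _ _ _ _ _ _ a (E i0) (E i1) (E i2)).
Qed.

Lemma derive2_field_bounded (a b : 'rV[R]_3 -> 'rV[R]_3) : vbounded sph a -> vbounded sph b ->
  vbounded sph (fun x => 'D_(a x) ('D_(b x) V) x).
Proof.
move=> ba bb; have hb i := vbounded_comb (derive2_bounded i i0) (derive2_bounded i i1)
  (derive2_bounded i i2) bb.
apply: vbounded_ext (vbounded_comb (hb i0) (hb i1) (hb i2) ba) => s _.
exact: esym (derive2_basis _ _ _).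
Qed.

Lemma derive_field_bounded (a : 'rV[R]_3 -> 'rV[R]_3) : vbounded sph a ->
  vbounded sph (fun x => 'D_(a x) V x).
Proof.
have [B B0 HB] := field_derive_bounded sV cV.
have bd i : vbounded sph (fun x => 'D_(e_ i) V x).
  move=> j; exists (B + 1); first by rewrite ltr_wpDl.
  by move=> s _; rewrite (le_trans (HB i j s))// lerDl.
move=> ba; apply: vbounded_ext (vbounded_comb (bd i0) (bd i1) (bd i2) ba) => s _.
by rewrite (derive_basis _ _ _ _ (a s) (field_diff sV s)).
Qed.

Lemma sphere_position_bounded : vbounded sph (fun x => x - c).
Proof. by move=> i; exists r => // s ss; exact: sphere_coord. Qed.

Lemma frame_bounded :
  vbounded sph (fun s => sphere_frame c r s i0) /\ vbounded sph (fun s => sphere_frame c r s i1).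
Proof.
by split; apply: vbounded_unit => s /(sphere_frame_orthonormal r0)[].
Qed.

(** [n1] stays abstract: [second_form] pairs the normal with second derivatives of order e, so [n1]
    contributes only at order e^2. *)
Lemma jac_normal_expansion : exists n1,
  vexp sph (fun e s => jac_normal c (perturb V e) s) (fun s => s - c) n1.
Proof.
have m i := derive_expansion sph i.
have h i j k := vexp_scale (sphere_position_bounded i) (vexp_cross (m j) (m k)).
have H := vexpD (vexpD (h i0 i1 i2) (h i1 i2 i0)) (h i2 i0 i1).
eexists; apply: vexp_ext H => // s _.
by apply: rV3P; rewrite !(mk3E, e_E, mxE) /=; ring.
Qed.

Lemma derive_frame_expansion (a : 'rV[R]_3 -> 'rV[R]_3) : vbounded sph a ->
  vexp sph (fun e s => 'D_(a s) (perturb V e) s) a (fun s => 'D_(a s) V s).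
Proof.
move=> ba; apply: vexp_ext (vexp_affine ba (derive_field_bounded ba)) => // e s _.
exact: esym (derive_perturb sV e s (a s)).
Qed.

Lemma second_form_expansion (a b : 'rV[R]_3 -> 'rV[R]_3) (k : R) :
  vbounded sph a -> vbounded sph b -> (forall s, sph s -> dot (a s) (b s) = k) ->
  uexp sph (fun e s => second_form c (perturb V e) (a s) (b s) s) (fun=> k)
    (fun s => divergence s * k - dot (s - c) ('D_(a s) ('D_(b s) V) s)).
Proof.
move=> ba bb abk; have [n1 hn] := jac_normal_expansion.
have h1 := uexpM (det_expansion sph) (uexp_cst (@ubounded_cst _ _ sph k)).
have h2 := uexp_dot hn (vexp_lin (derive2_field_bounded ba bb)).
apply: uexp_ext (uexpB h1 h2) => /= [e s ss|s ss|s ss].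
- by rewrite /second_form abk// (derive2_perturb sV).
- by rewrite dot0r subr0 mul1r.
- by rewrite dot0r mulr0 add0r addr0.
Qed.

End Expansion.

Section DensityExpansion.
Context {R : realType}.
Variables (c : 'rV[R]_3) (r : R).
Hypothesis r0 : 0 < r.
Variable V : 'rV[R]_3 -> 'rV[R]_3.
Hypothesis sV : smooth_on setT V.
Hypothesis cV : compact (closure [set x | V x != 0]).
Local Notation sph := (sphere c r).
Local Notation a1 s := (sphere_frame c r s i0).
Local Notation a2 s := (sphere_frame c r s i1).

Definition image_metric e s := gram ('D_(a1 s) (perturb V e) s) ('D_(a2 s) (perturb V e) s).

(** The total variation density of the image times the area Jacobian, in the form given by
    [tv_density_jac]. *)
Definition tv_pullback e s :=
  Num.sqrt (willmore_sqr c (perturb V e) s (a1 s) (a2 s)) / (r * image_metric e s).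

Definition tangential_divergence s : R :=
  dot (a1 s) ('D_(a1 s) V s) + dot (a2 s) ('D_(a2 s) V s).

(** The tangential trace of the flat second derivative of [V], with the frame frozen at s, paired
    with s - c; not the intrinsic Laplacian of the normal component. *)
Definition normal_laplacian s : R :=
  dot (s - c) ('D_(a1 s) ('D_(a1 s) V) s) + dot (s - c) ('D_(a2 s) ('D_(a2 s) V) s).

Let onb s : sph s -> [/\ dot (a1 s) (a1 s) = 1, dot (a2 s) (a2 s) = 1,
  dot (a1 s) (a2 s) = 0, dot (a1 s) (s - c) = 0 & dot (a2 s) (s - c) = 0].
Proof. exact: sphere_frame_orthonormal. Qed.

Let b1 : vbounded sph (fun s => a1 s). Proof. by have [] := frame_bounded c r0. Qed.
Let b2 : vbounded sph (fun s => a2 s). Proof. by have [] := frame_bounded c r0. Qed.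

Lemma area_jac_metric e s : sph s ->
  area_jac c r (perturb V e) s = Num.sqrt (image_metric e s).
Proof.
move=> ss; have [h1 h2 h3 h4 h5] := onb ss.
rewrite /image_metric (image_gram r0 (smooth_perturb sV e) ss h1 h2 h3 h4 h5).
by rewrite sqrtrM ?dot_ge0// sqrtrV ?sqr_ge0// sqrtr_sqr gtr0_norm.
Qed.

Let d11 := uexp_dot (derive_frame_expansion sV cV b1) (derive_frame_expansion sV cV b1).
Let d12 := uexp_dot (derive_frame_expansion sV cV b1) (derive_frame_expansion sV cV b2).
Let d22 := uexp_dot (derive_frame_expansion sV cV b2) (derive_frame_expansion sV cV b2).

Let double_dot (u v : 'rV[R]_3) : dot u v + dot v u = 2 * dot u v.
Proof. by rewrite (dotC v) mulr_natl mulr2n. Qed.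

Let metric_first_order (x y u : R) :
  1 * (2 * y) + 2 * x * 1 - (0 * u + u * 0) = 2 * (x + y).
Proof. by ring. Qed.

Let willmore_first_order (x y d u v : R) :
  2 * (2 * x + 2 * y) + 2 * (d * 1 - u + (d * 1 - v)) =
  4 * (x + y) + 4 * d - 2 * (u + v).
Proof. by ring. Qed.

Let g11 : uexp sph (fun e s => dot ('D_(a1 s) (perturb V e) s) ('D_(a1 s) (perturb V e) s))
  (fun=> 1) (fun s => 2 * dot (a1 s) ('D_(a1 s) V s)).
Proof.
apply: uexp_ext d11 => [e s _|s ss|s _]; [by []| |].
- by case: (onb ss) => h _ _ _ _; exact: h.
- exact: double_dot.
Qed.

Let g22 : uexp sph (fun e s => dot ('D_(a2 s) (perturb V e) s) ('D_(a2 s) (perturb V e) s))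
  (fun=> 1) (fun s => 2 * dot (a2 s) ('D_(a2 s) V s)).
Proof.
apply: uexp_ext d22 => [e s _|s ss|s _]; [by []| |].
- by case: (onb ss) => _ h _ _ _; exact: h.
- exact: double_dot.
Qed.

Let g12 : uexp sph (fun e s => dot ('D_(a1 s) (perturb V e) s) ('D_(a2 s) (perturb V e) s))
  (fun=> 0) (fun s => dot (a1 s) ('D_(a2 s) V s) + dot ('D_(a1 s) V s) (a2 s)).
Proof.
apply: uexp_ext d12 => [e s _|s ss|s _]; [by []| |by []].
by case: (onb ss) => _ _ h _ _; exact: h.
Qed.

Lemma metric_expansion : uexp sph image_metric (fun=> 1)
  (fun s => 2 * tangential_divergence s).
Proof.
apply: uexp_ext (uexpB (uexpM g11 g22) (uexpM g12 g12)) => [e s _|s _|s _].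
- by rewrite /image_metric /gram expr2.
- by rewrite mulr1 mulr0 subr0.
- exact: metric_first_order.
Qed.

Lemma area_expansion : uexp sph (fun e s => area_jac c r (perturb V e) s) (fun=> 1)
  tangential_divergence.
Proof.
have h : uexp sph image_metric (fun=> 1 ^+ 2) (fun s => 2 * tangential_divergence s).
  by apply: uexp_ext metric_expansion => [//|s _|//]; rewrite expr1n.
apply: uexp_ext (uexp_sqrt ltr01 h) => [e s ss|s _|s _].
- exact: esym (area_jac_metric e ss).
- by [].
- by rewrite mulr1 mulrAC mulfV ?mul1r.
Qed.

Lemma willmore_expansion :
  uexp sph (fun e s => willmore_sqr c (perturb V e) s (a1 s) (a2 s)) (fun=> 2)
    (fun s => 4 * tangential_divergence s + 4 * divergence V s - 2 * normal_laplacian s).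
Proof.
have k11 := second_form_expansion r0 sV cV b1 b1 (fun s ss => let: And5 h _ _ _ _ := onb ss in h).
have k12 := second_form_expansion r0 sV cV b1 b2 (fun s ss => let: And5 _ _ h _ _ := onb ss in h).
have k22 := second_form_expansion r0 sV cV b2 b2 (fun s ss => let: And5 _ h _ _ _ := onb ss in h).
apply: uexp_ext (uexp_trace_sqr g11 g12 g22 k11 k12 k22) => [e s _|s _|s _]; [by []|by []|].
exact: willmore_first_order.
Qed.

Lemma tv_expansion : uexp sph tv_pullback (fun=> Num.sqrt 2 / r)
  (fun s => Num.sqrt 2 / r *
    (divergence V s - tangential_divergence s - 2^-1 * normal_laplacian s)).
Proof.
have s2 : 0 < Num.sqrt 2 :> R by rewrite sqrtr_gt0.
have sq : Num.sqrt 2 ^+ 2 = 2 :> R by rewrite sqr_sqrtr.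
have h1 : uexp sph (fun e s => willmore_sqr c (perturb V e) s (a1 s) (a2 s))
    (fun=> Num.sqrt 2 ^+ 2)
    (fun s => 4 * tangential_divergence s + 4 * divergence V s - 2 * normal_laplacian s).
  by apply: uexp_ext willmore_expansion => [//|s _|//]; rewrite sq.
have h2 : uexp sph (fun e s => r * image_metric e s) (fun=> r)
    (fun s => r * (2 * tangential_divergence s)).
  by apply: uexp_ext (uexp_scale r metric_expansion) => [//|s _|//]; rewrite mulr1.
apply: uexp_ext (uexpM (uexp_sqrt s2 h1) (uexpV r0 h2)) => [e s _|s _|s _]; [by []|by []|].
move: (tangential_divergence s) (divergence V s) (normal_laplacian s) => t d l.
have -> : (2 * Num.sqrt 2)^-1 = Num.sqrt 2 / 4 :> R.
  have q0 := lt0r_neq0 s2; apply: (mulfI (x := 2 * Num.sqrt 2)); first by rewrite mulf_neq0.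
  by rewrite mulfV ?mulf_neq0// -mulrA (mulrA (Num.sqrt 2)) -expr2 sq; field.
by field; exact: lt0r_neq0.
Qed.

(** Forced by dilations: the sphere of radius r has total variation 4 sqrt 2 pi r and area 4 pi r^2,
    so the derivatives in r balance for mu = - 4 sqrt 2 pi / (8 pi r). *)
Definition tv_multiplier : R := - (Num.sqrt 2 / (2 * r)).

Definition first_variation s :=
  tv_multiplier * (3 * tangential_divergence s - 2 * divergence V s + normal_laplacian s).

Lemma lagrangian_expansion :
  uexp sph (fun e s => tv_pullback e s + tv_multiplier * area_jac c r (perturb V e) s)
    (fun=> Num.sqrt 2 / r + tv_multiplier) first_variation.
Proof.
apply: uexp_ext (uexpD tv_expansion (uexp_scale tv_multiplier area_expansion)) => [e s _|s _|s _].
- by [].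
- by rewrite mulr1.
- rewrite /first_variation /tv_multiplier.
  move: (tangential_divergence s) (divergence V s) (normal_laplacian s) => t d l.
  by field; exact: lt0r_neq0.
Qed.

End DensityExpansion.

(** * Measurability of the pulled back densities *)

Section RealMeasurable.
Context {R : realType}.

Lemma measurable_invr : measurable_fun setT (fun x : R => x^-1).
Proof.
(* The inverse is discontinuous at 0, where its default value is 0, so this point is split off. *)
have -> : [set: R] = [set 0] `|` [set x | x != 0].
  by apply/seteqP; split=> x // _; have [->|x0] := eqVneq x 0; [left|right].
have op : open [set x : R | x != 0].
  exact: open_neq.
apply/measurable_funU => //; first exact: open_measurable.
split; first exact: measurable_fun_set1.
apply: open_continuous_measurable_fun => // x; rewrite inE /= => x0.
exact: inv_continuous.
Qed.

Context {d : measure_display} {T : measurableType d} (D : set T).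
Implicit Types f g : T -> R.

Lemma measurable_fun_inv f : measurable_fun D f -> measurable_fun D (fun x => (f x)^-1).
Proof. exact: (measurableT_comp measurable_invr). Qed.

Lemma measurable_fun_sqrt f : measurable_fun D f -> measurable_fun D (fun x => Num.sqrt (f x)).
Proof.
apply: (@measurableT_comp _ _ _ _ _ _ (@Num.sqrt R)).
apply: continuous_measurable_fun; exact: sqrt_continuous.
Qed.

Definition mvec (f : T -> 'rV[R]_3) := forall i, measurable_fun D (fun s => f s 0 i).

Lemma measurable_dot (f g : T -> 'rV[R]_3) : mvec f -> mvec g ->
  measurable_fun D (fun s => dot (f s) (g s)).
Proof.
move=> mf mg.
have h : measurable_fun D (fun s => f s 0 i0 * g s 0 i0 + f s 0 i1 * g s 0 i1 + f s 0 i2 * g s 0 i2).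
  by apply: measurable_funD; [apply: measurable_funD|]; apply: measurable_funM; [exact: mf|exact: mg|exact: mf|exact: mg|exact: mf|exact: mg].
by apply: eq_measurable_fun h => s _; rewrite dotE.
Qed.

Lemma mvec_comb (u v w a : T -> 'rV[R]_3) : mvec u -> mvec v -> mvec w -> mvec a ->
  mvec (fun s => comb3 (u s) (v s) (w s) (a s)).
Proof.
move=> mu mv mw ma i.
have h : measurable_fun D (fun s => a s 0 i0 * u s 0 i + a s 0 i1 * v s 0 i + a s 0 i2 * w s 0 i).
  by apply: measurable_funD; [apply: measurable_funD|]; apply: measurable_funM; [exact: ma|exact: mu|exact: ma|exact: mv|exact: ma|exact: mw].
by apply: eq_measurable_fun h => s _; rewrite !mxE.
Qed.

Lemma mvec_ext (f g : T -> 'rV[R]_3) : (forall s, f s = g s) -> mvec f -> mvec g.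
Proof. by move=> fg mf i; apply: eq_measurable_fun (mf i) => s _; rewrite fg. Qed.

Lemma mvec_scale (k : R) (f : T -> 'rV[R]_3) : mvec f -> mvec (fun s => k *: f s).
Proof.
move=> mf i; have h : measurable_fun D (fun s => k * f s 0 i).
  by apply: measurable_funM => //; exact: mf.
by apply: eq_measurable_fun h => s _; rewrite mxE.
Qed.

Lemma measurable_trace_sqr (g11 g12 g22 k11 k12 k22 : T -> R) :
  measurable_fun D g11 -> measurable_fun D g12 -> measurable_fun D g22 ->
  measurable_fun D k11 -> measurable_fun D k12 -> measurable_fun D k22 ->
  measurable_fun D (fun s => trace_sqr (g11 s) (g12 s) (g22 s) (k11 s) (k12 s) (k22 s)).
Proof.
move=> m1 m2 m3 m4 m5 m6; rewrite /trace_sqr.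
have C : measurable_fun D (cst (2 : R)) by exact: measurable_cst.
apply: measurable_funB; first apply: measurable_funX.
  apply: measurable_funB; last exact: measurable_funM (measurable_funM C m2) m5.
  by apply: measurable_funD; apply: measurable_funM.
apply: measurable_funM; first apply: measurable_funM C _.
  by apply: measurable_funB; [exact: measurable_funM|exact: measurable_funX].
by apply: measurable_funB; [exact: measurable_funM|exact: measurable_funX].
Qed.

End RealMeasurable.

Section DensityMeasurable.
Context {R : realType}.
Variables (c : 'rV[R]_3) (r : R).
Variable V : 'rV[R]_3 -> 'rV[R]_3.
Hypothesis sV : smooth_on setT V.
Local Notation mvec := (@mvec R _ (borel3 R)).
Variable D : set (borel3 R).

Lemma continuous_mvec (f : 'rV[R]_3 -> 'rV[R]_3) : (forall x, differentiable f x) -> mvec D f.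
Proof.
move=> df i; apply: continuous_borel3 => x; apply: diff_cont; exact: differentiable_comp_rV3.
Qed.

(** The frame is discontinuous at the pole n = - e_2, so the densities built from it are handled as
    measurable and bounded functions rather than continuous ones. *)
Lemma frame_measurable i : mvec D (fun s => sphere_frame c r s i).
Proof.
have mn : mvec D (fun s => r^-1 *: (s - c)).
  by apply: mvec_scale; apply: continuous_mvec => x; exact: differentiable_subc.
move=> j.
have h : measurable_fun D (fun s => e_ i 0 j - ((r^-1 *: (s - c)) 0 i *
    (1 + (r^-1 *: (s - c)) 0 i2)^-1) * ((r^-1 *: (s - c)) 0 j + e_ i2 0 j)).
  apply: measurable_funB; first exact: measurable_cst.
  apply: measurable_funM.
    apply: measurable_funM; first exact: mn.
    by apply: measurable_fun_inv; apply: measurable_funD; [exact: measurable_cst|exact: mn].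
  by apply: measurable_funD; [exact: mn|exact: measurable_cst].
by apply: eq_measurable_fun h => s _; rewrite /sphere_frame /frame !mxE.
Qed.

Lemma derive_field_measurable (f : 'rV[R]_3 -> 'rV[R]_3) (a : borel3 R -> 'rV[R]_3) :
  smooth_on setT f -> mvec D a -> mvec D (fun s => 'D_(a s) f s).
Proof.
move=> sf ma.
have m i : mvec D (fun s => 'D_(e_ i) f s).
  apply: continuous_mvec => x; exact: (smooth_diff _ _ _ (smooth_derive _ _ _ _ sf)).
apply: mvec_ext (mvec_comb (m i0) (m i1) (m i2) ma) => s.
exact: esym (derive_basis _ _ _ _ (a s) (smooth_diff _ _ _ sf s I)).
Qed.

Lemma derive2_field_measurable (a b : borel3 R -> 'rV[R]_3) : mvec D a -> mvec D b ->
  mvec D (fun s => 'D_(a s) ('D_(b s) V) s).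
Proof.
move=> ma mb.
have m i j : mvec D (fun s => 'D_(e_ i) ('D_(e_ j) V) s).
  apply: continuous_mvec => x.
  exact: (smooth_diff _ _ _ (smooth_derive _ _ _ _ (smooth_derive _ _ _ _ sV))).
have mm i := mvec_comb (m i i0) (m i i1) (m i i2) mb.
apply: mvec_ext (mvec_comb (mm i0) (mm i1) (mm i2) ma) => s.
exact: esym (derive2_basis sV _ _ _).
Qed.

Lemma jac_normal_measurable e : mvec D (jac_normal c (perturb V e)).
Proof. by apply: continuous_mvec => x; exact: jac_normal_diff (smooth_perturb sV e) x. Qed.

Lemma area_jac_measurable e : measurable_fun D (area_jac c r (perturb V e) : borel3 R -> R).
Proof.
apply: measurable_funM; last exact: measurable_cst.
by apply: measurable_fun_sqrt; apply: measurable_dot; exact: jac_normal_measurable.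
Qed.

Lemma second_form_measurable e (a b : borel3 R -> 'rV[R]_3) : mvec D a -> mvec D b ->
  measurable_fun D (fun s => second_form c (perturb V e) (a s) (b s) s).
Proof.
move=> ma mb; apply: measurable_funB.
  apply: measurable_funM; last exact: measurable_dot.
  apply: continuous_borel3 => x; apply: diff_cont; exact: jac_det_diff (smooth_perturb sV e) x.
apply: measurable_dot; first exact: jac_normal_measurable.
apply: mvec_ext (mvec_scale e (derive2_field_measurable ma mb)) => s.
exact: esym (derive2_perturb sV e s (a s) (b s)).
Qed.

Lemma metric_measurable e : measurable_fun D (image_metric c r V e : borel3 R -> R).
Proof.
have m i := derive_field_measurable (smooth_perturb sV e) (frame_measurable i).
rewrite /image_metric /gram; apply: measurable_funB.
  by apply: measurable_funM; exact: measurable_dot.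
by apply: measurable_funX; exact: measurable_dot.
Qed.

Lemma tv_pullback_measurable e : measurable_fun D (tv_pullback c r V e : borel3 R -> R).
Proof.
have f0 := frame_measurable i0; have f1 := frame_measurable i1.
have m i := derive_field_measurable (smooth_perturb sV e) (frame_measurable i).
have g00 := measurable_dot (m i0) (m i0).
have g01 := measurable_dot (m i0) (m i1).
have g11 := measurable_dot (m i1) (m i1).
have k00 := second_form_measurable e f0 f0.
have k01 := second_form_measurable e f0 f1.
have k11 := second_form_measurable e f1 f1.
apply: measurable_funM; last first.
  by apply: measurable_fun_inv; apply: measurable_funM; [exact: measurable_cst|exact: metric_measurable].
apply: measurable_fun_sqrt.
exact: (measurable_trace_sqr g00 g01 g11 k00 k01 k11).
Qed.

End DensityMeasurable.

Lemma uexp_bounded (R : realType) (X : Type) (D : set X) (f : R -> X -> R) f0 f1 :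
  uexp D f f0 f1 -> exists2 e0 : R, 0 < e0 & forall e, 0 <= e <= e0 ->
    exists B, forall s, D s -> `|f e s| <= B.
Proof.
move=> [C [e0 [C0 /andP[e00 e01] H]]]; exists e0 => // e ee; exists (3 * C) => s Ds.
have [h1 h2 h3] := H e s Ds ee; have /andP[eg eE] := ee.
have e1 : e <= 1 by exact: le_trans e01.
rewrite (_ : f e s = (f e s - (f0 s + e * f1 s)) + f0 s + e * f1 s); last by ring.
have t1 : C * e ^+ 2 <= C by rewrite ler_piMr ?exprn_ile1// ltW.
have t2 : `|e * f1 s| <= C.
  by rewrite normrM (ger0_norm eg) (le_trans _ h3)// ler_piMl.
rewrite (le_trans (ler_normD _ _))//.
have := ler_normD (f e s - (f0 s + e * f1 s)) (f0 s).
by move: h1 h2 t1 t2; move: `|_| `|_| `|_| `|_| (C * _) => *; lra.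
Qed.

(** * Differentiation under the surface integral *)

Section IntegralDerivative.
Context {R : realType}.
Variables (c : 'rV[R]_3) (r : R).
Hypothesis r0 : 0 < r.
Variable sigma : {measure set borel3 R -> \bar R}.
Local Notation sph := (sphere c r).
Hypothesis sigmaP : is_surface_measure sph sigma.
Local Notation S := (sph : set (borel3 R)).

(** The uniform O(e^2) remainder, integrated over a set of finite measure m and divided by e, is at
    most C m e. *)
Lemma surface_integral_derivative (f : R -> borel3 R -> R) f0 f1 :
  uexp S f f0 f1 -> (forall e, measurable_fun S (f e)) -> measurable_fun S f1 ->
  (fun e => e^-1 * (surface_integral sigma sph (f e) - surface_integral sigma sph (f 0)))
    @ 0^'+ --> surface_integral sigma sph f1.
Proof.
move=> [C [e0 [C0 /andP[e00 e01] H]]] mf mf1.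
have uf : uexp S f f0 f1 by exists C, e0; split; rewrite ?e00.
have [e1 e10 bf] := uexp_bounded uf.
have mS := sphere_measurable c r0.
have int e : 0 <= e <= e1 -> sigma.-integrable S (EFin \o f e).
  by move=> ee; apply: (bounded_integrable r0 sigmaP (mf e)); exact: bf.
have if1 : sigma.-integrable S (EFin \o f1).
  apply: (bounded_integrable r0 sigmaP mf1); exists C => s Ss.
  by have [|_ _ //] := H 0 s Ss; rewrite lexx ltW.
have i0 := int 0; rewrite lexx (ltW e10) in i0.
pose m := fine (sigma S).
have m0 : 0 <= m by exact: fine_ge0.
have Cm : 0 < C * m + 1 by rewrite ltr_wpDl// mulr_ge0// ltW.
rewrite /surface_integral; apply/cvgrPdist_le => eps eps0; near=> e.
have eg : 0 < e by near: e; exact: nbhs_right_gt.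
have ee0 : e <= e0 by near: e; exact: nbhs_right_le.
have ee1 : e <= e1 by near: e; exact: nbhs_right_le.
have eeps : e <= eps / (C * m + 1) by near: e; apply: nbhs_right_le; exact: divr_gt0.
have ie := int e; rewrite (ltW eg) ee1 in ie.
have ief : sigma.-integrable S (EFin \o (fun s => e * f1 s)).
  by have := integrableZl mS e if1; apply: eq_integrable => // s _.
have id := integrableB mS (ie isT) (i0 isT).
have id' : sigma.-integrable S (EFin \o (fun s => f e s - f 0 s)).
  by apply: eq_integrable id => // s _.
have iq : sigma.-integrable S (EFin \o (fun s => f e s - f 0 s - e * f1 s)).
  by have := integrableB mS id' ief; apply: eq_integrable => // s _.
have qE : \int[sigma]_(x in S) (f e x - f 0 x - e * f1 x) =
   \int[sigma]_(x in S) f e x - \int[sigma]_(x in S) f 0 x - e * \int[sigma]_(x in S) f1 x.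
  by rewrite (RintegralB mS id' ief) (RintegralB mS (ie isT) (i0 isT)) (RintegralZl _ mS if1).
have qle : `|\int[sigma]_(x in S) (f e x - f 0 x - e * f1 x)| <= C * e ^+ 2 * m.
  apply: (le_trans (le_normr_Rintegral mS iq)).
  rewrite -(Rintegral_cst sigma mS); apply: le_Rintegral => //.
  - exact: integrable_norm.
  - by apply: (continuous_sphere_integrable r0 sigmaP); exact: cst_continuous.
  - move=> x Sx; have [|h1 _ _] := H e x Sx; first by rewrite (ltW eg) ee0.
    (* At e = 0 the remainder bound is 0, which identifies [f 0] with [f0] on the sphere. *)
    have [|h2 _ _] := H 0 x Sx; first by rewrite lexx ltW.
    move: h2; rewrite expr0n /= mulr0 mul0r addr0 normr_le0 subr_eq0 => /eqP ->.
    by rewrite -addrA -opprD.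
rewrite distrC; set I := _ - \int[sigma]_(x in S) f1 x.
have -> : I = e^-1 * \int[sigma]_(x in S) (f e x - f 0 x - e * f1 x).
  rewrite qE /I; move: (Rintegral _ _ _) (Rintegral _ _ _) (Rintegral _ _ _) => u v w.
  by field; rewrite gt_eqF.
rewrite normrM gtr0_norm ?invr_gt0// mulrC ler_pdivrMr//.
apply: (le_trans qle); rewrite (_ : C * e ^+ 2 * m = C * m * e * e); last by ring.
rewrite ler_pM2r//.
rewrite ler_pdivlMr// in eeps; apply: le_trans eeps.
by rewrite mulrC ler_pM2l// lerDl.
Unshelve. all: by end_near. Qed.

End IntegralDerivative.

(** * Total variation and area of the perturbed surface as integrals over the sphere *)

Section Pullback.
Context {R : realType}.
Variable sigma : set 'rV[R]_3 -> {measure set borel3 R -> \bar R}.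
Hypothesis hsigma : forall G, closed_surface G -> is_surface_measure G (sigma G).
Variables (c : 'rV[R]_3) (r : R).
Hypothesis r0 : 0 < r.
Variable V : 'rV[R]_3 -> 'rV[R]_3.
Hypothesis sV : smooth_on setT V.
Local Notation sph := (sphere c r).

Section AtTime.
Variables (e : R) (S : 'rV[R]_3 -> 'rV[R]_3) (K : R).
Local Notation T := (perturb V e).
Hypothesis det0 : forall x, 0 < jac_det T x.
Hypotheses (ST : cancel T S) (TS : cancel S T).
Hypothesis S_lip : forall y y', `|S y - S y'| <= K * `|y - y'|.

Let sT : smooth_on setT T. Proof. exact: smooth_perturb. Qed.

Let sphere_sigma : is_surface_measure sph (sigma sph).
Proof. by apply: hsigma; exact: sphere_surface. Qed.

Let image_sigma : is_surface_measure (T @` sph) (sigma (T @` sph)).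
Proof. by apply: hsigma; exact: image_surface r0 sT ST S_lip det0. Qed.

Lemma surface_integral_pullback (f : 'rV[R]_3 -> R) :
  measurable_fun (T @` sph : set (borel3 R)) (f : borel3 R -> R) ->
  (forall y, (T @` sph) y -> 0 <= f y) ->
  surface_integral (sigma (T @` sph)) (T @` sph) f =
  surface_integral (sigma sph) sph (fun s => f (T s) * area_jac c r T s).
Proof.
move=> mf f0; congr fine.
have cT : continuous T by move=> x; exact: (diff_cont (smooth_diff _ _ _ sT x I)).
have Tinj : {in sph &, injective T} by move=> x y _ _ /(congr1 S); rewrite !ST.
have J0 s : sph s -> 0 <= area_jac c r T s.
  by move=> ss; exact: ltW (area_jac_gt0 r0 sT det0 ss).
exact: (change_of_variables (sphere_surface c r0) cT Tinj
  (fun U X => image_param r0 sT ST S_lip det0 (U := U) (X := X))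
  (fun U X p => image_area r0 sT (U := U) (X := X) (p := p)) J0
  (area_jac_measurable c r sV (D := _) e) sphere_sigma image_sigma mf f0).
Qed.

Lemma area_pullback : area (sigma (T @` sph)) (T @` sph) =
  surface_integral (sigma sph) sph (area_jac c r T).
Proof.
rewrite /area surface_integral_pullback//.
by apply: eq_Rintegral => s _; rewrite mul1r.
Qed.

Lemma tv_density_pullback s : sph s ->
  tv_density (T @` eball c r) (T @` sph) (T s) * area_jac c r T s = tv_pullback c r V e s.
Proof.
move=> ss; have [h1 h2 h3 h4 h5] := sphere_frame_orthonormal r0 ss.
exact: (tv_density_jac r0 sT ST TS S_lip det0 ss h1 h2 h3 h4 h5).
Qed.

Lemma normal_TV_pullback : normal_TV (sigma (T @` sph)) (T @` eball c r) (T @` sph) =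
  surface_integral (sigma sph) sph (tv_pullback c r V e).
Proof.
rewrite /normal_TV surface_integral_pullback.
- by apply: eq_Rintegral => s; rewrite inE => ss; exact: tv_density_pullback.
(* [tv_density] is defined by choices, so its measurability on the image comes from an explicit
   formula: [tv_pullback] divided by the positive area Jacobian, composed with the inverse map. *)
- pose h s := tv_pullback c r V e s * (area_jac c r T s)^-1.
  have mh : measurable_fun [set: borel3 R] (h : borel3 R -> R).
    apply: measurable_funM; first exact: tv_pullback_measurable.
    by apply: measurable_fun_inv; exact: area_jac_measurable.
  have cS : continuous S by exact: lipschitz_continuous S_lip.
  have mS : measurable_fun (T @` sph : set (borel3 R)) (S : borel3 R -> borel3 R).
    by apply: measurable_funTS; exact: continuous_borel3_borel3.
  apply: eq_measurable_fun (measurableT_comp mh mS) => y; rewrite inE => -[s ss <-] /=.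
  rewrite ST /h -tv_density_pullback// mulfK// gt_eqF//; exact: (area_jac_gt0 r0 sT det0 ss).
- by move=> y _; exact: sqrtr_ge0.
Qed.

Lemma normal_TV_curvE : normal_TV_curv (sigma (T @` sph)) (T @` eball c r) (T @` sph) =
  normal_TV (sigma (T @` sph)) (T @` eball c r) (T @` sph).
Proof.
apply: eq_Rintegral => y; rewrite inE => -[s ss <-].
have [h1 h2 h3 h4 h5] := sphere_frame_orthonormal r0 ss.
exact: (curvature_density_image r0 sT ST TS S_lip det0 ss h1 h2 h3 h4 h5).
Qed.

End AtTime.

End Pullback.

(** * The first variation *)

Section Traces.
Context {R : realType}.
Implicit Types (u v w x y a b : 'rV[R]_3).

(** The matrix with rows a1, a2, a3 satisfies M M^T = 1, hence M^T M = 1. Traces can therefore be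
    computed in any orthonormal basis. *)
Lemma orthonormal_completeness a1 a2 a3 : dot a1 a1 = 1 -> dot a2 a2 = 1 -> dot a3 a3 = 1 ->
  dot a1 a2 = 0 -> dot a1 a3 = 0 -> dot a2 a3 = 0 ->
  forall i j, a1 0 i * a1 0 j + a2 0 i * a2 0 j + a3 0 i * a3 0 j = (i == j)%:R.
Proof.
move=> h11 h22 h33 h12 h13 h23 i j.
pose f (i : 'I_3) := if i == i0 then a1 else if i == i1 then a2 else a3.
pose M : 'M[R]_3 := \matrix_(i, j) f i 0 j.
have MM : M *m M^T = 1%:M.
  apply/matrixP => k l; rewrite !mxE sum3E !mxE -dotE.
  by move: k; apply: ord3P; move: l; apply: ord3P; rewrite /f /= // dotC.
have /matrixP/(_ i j) := mulmx1C MM.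
by rewrite !mxE sum3E !mxE /f /=.
Qed.

Lemma comb3_e (f : 'I_3 -> 'rV[R]_3) i : comb3 (f i0) (f i1) (f i2) (e_ i) = f i.
Proof.
by move: i; apply: ord3P; rewrite /comb3 !e_E /= !scale0r !scale1r ?add0r ?addr0.
Qed.

Definition trace3 u v w : R := u 0 i0 + v 0 i1 + w 0 i2.

Lemma trace_orthonormal a1 a2 a3 u v w :
  dot a1 a1 = 1 -> dot a2 a2 = 1 -> dot a3 a3 = 1 ->
  dot a1 a2 = 0 -> dot a1 a3 = 0 -> dot a2 a3 = 0 ->
  dot a1 (comb3 u v w a1) + dot a2 (comb3 u v w a2) + dot a3 (comb3 u v w a3) =
  trace3 u v w.
Proof.
move=> h11 h22 h33 h12 h13 h23.
have P := orthonormal_completeness h11 h22 h33 h12 h13 h23.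
pose p i j := a1 0 i * a1 0 j + a2 0 i * a2 0 j + a3 0 i * a3 0 j.
transitivity (p i0 i0 * u 0 i0 + p i1 i1 * v 0 i1 + p i2 i2 * w 0 i2 +
  p i0 i1 * (v 0 i0 + u 0 i1) + p i0 i2 * (w 0 i0 + u 0 i2) + p i1 i2 * (w 0 i1 + v 0 i2)).
  by rewrite /p !dotE !mxE; ring.
by rewrite /p !P /trace3 /=; ring.
Qed.

(** The matrices (e_k x y)(e_k x y)^T sum to |y|^2 I - y y^T. *)
Lemma rotation_trace u v w y :
  dot (cross (e_ i0) y) (comb3 u v w (cross (e_ i0) y)) +
  dot (cross (e_ i1) y) (comb3 u v w (cross (e_ i1) y)) +
  dot (cross (e_ i2) y) (comb3 u v w (cross (e_ i2) y)) =
  dot y y * trace3 u v w - dot y (comb3 u v w y).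
Proof. by rewrite /trace3 /comb3 !dotE !(mk3E, e_E, mxE) /=; ring. Qed.

Lemma rotation_comb_sum u v w x y :
  dot x (comb3 u v w (cross (e_ i0) (cross (e_ i0) y))) +
  dot x (comb3 u v w (cross (e_ i1) (cross (e_ i1) y))) +
  dot x (comb3 u v w (cross (e_ i2) (cross (e_ i2) y))) = - 2 * dot x (comb3 u v w y).
Proof.
have comb3N2 : comb3 u v w (- 2 *: y) = - 2 *: comb3 u v w y.
  by rewrite /comb3 !mxE !scalerDr !scalerA.
have comb3D a b : comb3 u v w (a + b) = comb3 u v w a + comb3 u v w b.
  by rewrite /comb3 !mxE !scalerDl [RHS]addrACA; congr (_ + _); exact: addrACA.
by rewrite -!dotDr -!comb3D rotation_cross_sum comb3N2 dotZr.
Qed.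

End Traces.

Section FirstVariation.
Context {R : realType}.
Variables (c : 'rV[R]_3) (r : R).
Hypothesis r0 : 0 < r.
Variable V : 'rV[R]_3 -> 'rV[R]_3.
Hypothesis sV : smooth_on setT V.
Local Notation sph := (sphere c r).
Local Notation m i s := ('D_(e_ i) V s).

Definition rotation_potential k x : R := dot (x - c) ('D_(cross (e_ k) (x - c)) V x).

(* The matrix of (a, b) |-> dot (s - c) ('D_a ('D_b V) s), by columns. *)
Definition hessian_column s j : 'rV[R]_3 :=
  mk3 (dot (s - c) ('D_(e_ i0) ('D_(e_ j) V) s))
      (dot (s - c) ('D_(e_ i1) ('D_(e_ j) V) s))
      (dot (s - c) ('D_(e_ i2) ('D_(e_ j) V) s)).

Local Notation Hc s := (comb3 (hessian_column s i0) (hessian_column s i1) (hessian_column s i2)).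
Local Notation Mc s := (comb3 (m i0 s) (m i1 s) (m i2 s)).

Lemma derive_field s b : 'D_b V s = Mc s b.
Proof. exact: (derive_basis _ _ _ _ b (field_diff sV s)). Qed.

Lemma hessian_form s a b : dot (s - c) ('D_a ('D_b V) s) = dot a (Hc s b).
Proof.
have E (y h00 h01 h02 h10 h11 h12 h20 h21 h22 : 'rV[R]_3) :
    dot y (comb3 (comb3 h00 h01 h02 b) (comb3 h10 h11 h12 b) (comb3 h20 h21 h22 b) a) =
    dot a (comb3 (mk3 (dot y h00) (dot y h10) (dot y h20))
      (mk3 (dot y h01) (dot y h11) (dot y h21)) (mk3 (dot y h02) (dot y h12) (dot y h22)) b).
  by rewrite /comb3 !dotE !(mk3E, mxE); ring.
exact: etrans (congr1 (dot (s - c)) (derive2_basis sV a b s)) (E _ _ _ _ _ _ _ _ _ _).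
Qed.

Lemma cross_e_is_derive k s b :
  is_derive s b (fun x => cross (e_ k) (x - c)) (cross (e_ k) b).
Proof.
have lin : linear (cross (e_ k) : 'rV[R]_3 -> _).
  by move=> a u v; apply: rV3P; rewrite !(mk3E, mxE); ring.
have cont : continuous (cross (e_ k) : 'rV[R]_3 -> _).
  by move=> x; apply: diff_cont; apply: differentiable_cross.
have [d E] := linear_derive s b lin cont.
rewrite (_ : (fun x => _) = (fun x => cross (e_ k) x - cross (e_ k) c)); last first.
  by apply/funext => x; apply: rV3P; rewrite !(mk3E, mxE); ring.
exact: (is_derive_subc _ (DeriveDef (diff_derivable d) E)).
Qed.

Let rotation_potentialE k : rotation_potential k = (fun x =>
  cross (e_ k) (x - c) 0 i0 * dot (x - c) (m i0 x) +
  cross (e_ k) (x - c) 0 i1 * dot (x - c) (m i1 x) +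
  cross (e_ k) (x - c) 0 i2 * dot (x - c) (m i2 x)).
Proof.
apply/funext => x; rewrite /rotation_potential derive_field.
have E (y u v w b : 'rV[R]_3) : dot y (comb3 u v w b) =
    b 0 i0 * dot y u + b 0 i1 * dot y v + b 0 i2 * dot y w.
  by rewrite /comb3 !dotE !mxE; ring.
exact: E.
Qed.

Lemma rotation_potential_smooth k : smooth_on setT (rotation_potential k).
Proof.
have oT : open [set: 'rV[R]_3] by exact: openT.
rewrite rotation_potentialE.
have sc i : smooth_on setT (fun x : 'rV[R]_3 => cross (e_ k) (x - c) 0 i).
  move: i; apply/(smooth_rV3 oT); apply: (smooth_cross oT); first exact: smooth_cst.
  exact: smooth_subc.
have sm i : smooth_on setT (fun x => dot (x - c) (m i x)).
  exact: (smooth_dot oT (smooth_subc c) (smooth_derive _ _ _ _ sV)).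
exact: (smoothD oT (smoothD oT (smoothM oT (sc _) (sm _)) (smoothM oT (sc _) (sm _)))
  (smoothM oT (sc _) (sm _))).
Qed.

(** Product rule for y . DV(e_k x y): the three terms come from differentiating y, then DV, then the
    rotation field. *)
Lemma derive_rotation_potential k s : let w := cross (e_ k) (s - c) in
  'D_w (rotation_potential k) s =
  dot w (Mc s w) + dot w (Hc s w) + dot (s - c) (Mc s (cross (e_ k) w)).
Proof.
move=> w; rewrite rotation_potentialE.
have dc i := is_derive_coord _ _ _ _ i (cross_e_is_derive k s w).
have dm i := is_derive_dot (is_derive_subc c (is_derive_id s w))
  (derivableP (diff_derivable (v := w) (field_derive_diff sV (e_ i) s))).
have h := is_derive_add (is_derive_add (is_derive_mul (dc i0) (dm i0))
  (is_derive_mul (dc i1) (dm i1))) (is_derive_mul (dc i2) (dm i2)).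
have E (y w' u v z h0 h1 h2 : 'rV[R]_3) (d0 d1 d2 : R) :
    d0 = dot w h0 -> d1 = dot w h1 -> d2 = dot w h2 ->
    w' 0 i0 * dot y u + w 0 i0 * (dot w u + d0) +
    (w' 0 i1 * dot y v + w 0 i1 * (dot w v + d1)) +
    (w' 0 i2 * dot y z + w 0 i2 * (dot w z + d2)) =
    dot w (comb3 u v z w) + dot w (comb3 h0 h1 h2 w) + dot y (comb3 u v z w').
  by move=> -> -> ->; rewrite /comb3 !(dotDr, dotZr); ring.
have H i : dot (s - c) ('D_w ('D_(e_ i) V) s) = dot w (hessian_column s i).
  exact: etrans (hessian_form s w (e_ i)) (congr1 (dot w) (comb3_e (hessian_column s) i)).
exact: (etrans (@derive_val _ _ _ _ _ _ _ h) (E _ _ _ _ _ _ _ _ _ _ _ (H i0) (H i1) (H i2))).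
Qed.

(** The coefficient 3 is 1 from [rotation_trace] plus 2 from [rotation_comb_sum]. *)
Lemma rotation_potential_sum s :
  'D_(cross (e_ i0) (s - c)) (rotation_potential i0) s +
  'D_(cross (e_ i1) (s - c)) (rotation_potential i1) s +
  'D_(cross (e_ i2) (s - c)) (rotation_potential i2) s =
  dot (s - c) (s - c) * divergence V s - 3 * dot (s - c) (Mc s (s - c)) +
  dot (s - c) (s - c) * trace3 (hessian_column s i0) (hessian_column s i1) (hessian_column s i2) -
  dot (s - c) (Hc s (s - c)).
Proof.
have E (x0 x1 x2 a0 b0 d0 a1 b1 d1 a2 b2 d2 yy t q tm qm : R) :
    x0 = a0 + b0 + d0 -> x1 = a1 + b1 + d1 -> x2 = a2 + b2 + d2 ->
    a0 + a1 + a2 = yy * tm - qm -> b0 + b1 + b2 = yy * t - q -> d0 + d1 + d2 = - 2 * qm ->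
    x0 + x1 + x2 = yy * tm - 3 * qm + yy * t - q by lra.
exact: (E _ _ _ _ _ _ _ _ _ _ _ _ _ _ _ _ _ (derive_rotation_potential i0 s)
  (derive_rotation_potential i1 s) (derive_rotation_potential i2 s)
  (rotation_trace (m i0 s) (m i1 s) (m i2 s) (s - c))
  (rotation_trace (hessian_column s i0) (hessian_column s i1) (hessian_column s i2) (s - c))
  (rotation_comb_sum (m i0 s) (m i1 s) (m i2 s) (s - c) (s - c))).
Qed.

(** In the orthonormal basis formed by the tangent frame and (s - c) / r, the full traces split into
    tangential and normal entries. The normal entry of the Hessian then cancels, and what remains is
    [first_variation]. *)
Lemma first_variationE s : sph s -> first_variation c r V s =
  tv_multiplier r / r ^+ 2 * ('D_(cross (e_ i0) (s - c)) (rotation_potential i0) s +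
  'D_(cross (e_ i1) (s - c)) (rotation_potential i1) s +
  'D_(cross (e_ i2) (s - c)) (rotation_potential i2) s).
Proof.
move=> ss; rewrite rotation_potential_sum.
have [h1 h2 h3 h4 h5] := sphere_frame_orthonormal r0 ss.
have rn : r != 0 by rewrite gt_eqF.
have y2 : dot (s - c) (s - c) = r ^+ 2 by exact: ss.
have nn : dot (r^-1 *: (s - c)) (r^-1 *: (s - c)) = 1.
  by rewrite dotZl dotZr y2; field.
have n1 : dot (sphere_frame c r s i0) (r^-1 *: (s - c)) = 0 by rewrite dotZr h4 mulr0.
have n2 : dot (sphere_frame c r s i1) (r^-1 *: (s - c)) = 0 by rewrite dotZr h5 mulr0.
have tr u v w := trace_orthonormal u v w h1 h2 nn h3 n1 n2.
have N u v w : dot (r^-1 *: (s - c)) (comb3 u v w (r^-1 *: (s - c))) =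
    dot (s - c) (comb3 u v w (s - c)) / r ^+ 2.
  have -> : comb3 u v w (r^-1 *: (s - c)) = r^-1 *: comb3 u v w (s - c).
    by rewrite /comb3 !mxE !scalerDr !scalerA.
  by rewrite dotZl dotZr; field.
have tm := tr (m i0 s) (m i1 s) (m i2 s).
have th := tr (hessian_column s i0) (hessian_column s i1) (hessian_column s i2).
rewrite N -!derive_field in tm; rewrite N -!hessian_form in th.
rewrite /first_variation y2 -!derive_field -!hessian_form -th.
have -> : divergence V s = trace3 (m i0 s) (m i1 s) (m i2 s) by [].
rewrite -tm /tangential_divergence /normal_laplacian.
have E (t a b p q k l : R) : t * (3 * (a + b) - 2 * (a + b + p / r ^+ 2) + (k + l)) =
  t / r ^+ 2 * (r ^+ 2 * (a + b + p / r ^+ 2) - 3 * p + r ^+ 2 * (k + l + q / r ^+ 2) - q).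
  by field.
exact: E.
Qed.

End FirstVariation.

(** * Stationarity of the Lagrangian *)

Section Stationarity.
Context {R : realType}.
Variable sigma : set 'rV[R]_3 -> {measure set borel3 R -> \bar R}.
Hypothesis hsigma : forall G, closed_surface G -> is_surface_measure G (sigma G).
Variables (c : 'rV[R]_3) (r : R).
Hypothesis r0 : 0 < r.
Variable V : 'rV[R]_3 -> 'rV[R]_3.
Hypothesis sV : smooth_on setT V.
Hypothesis cV : compact (closure [set x | V x != 0]).
Local Notation sph := (sphere c r).
Local Notation S := (sph : set (borel3 R)).

Let sigmaP : is_surface_measure sph (sigma sph).
Proof. by apply: hsigma; exact: sphere_surface. Qed.

Let mS : measurable S. Proof. exact: sphere_measurable. Qed.

Let field k x : R := 'D_(cross (e_ k) (x - c)) (rotation_potential c V k) x.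

Let field_continuous k : continuous (field k).
Proof.
move=> x; apply: diff_cont.
exact: (smooth_diff _ _ _ (smooth_rotation_field c k (rotation_potential_smooth c sV k))).
Qed.

Let field_integral k : \int[sigma sph]_(x in S) field k x = 0.
Proof.
exact: (sphere_integral_rotation_field r0 sigmaP k (rotation_potential_smooth c sV k)).
Qed.

Let field_sum_continuous : continuous (fun x => field i0 x + field i1 x + field i2 x).
Proof.
exact: (continuous_addf (continuous_addf (@field_continuous i0) (@field_continuous i1))
  (@field_continuous i2)).
Qed.

(** The defining formula uses the discontinuous frame; on the sphere it agrees with a frame-free
    expression that is continuous on the whole space. *)
Lemma first_variation_measurable :
  measurable_fun S (first_variation c r V : borel3 R -> R).
Proof.
have h : measurable_fun S (fun s : borel3 R =>
    tv_multiplier r / r ^+ 2 * (field i0 s + field i1 s + field i2 s)).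
  apply: measurable_funM; first exact: measurable_cst.
  exact: continuous_borel3.
by apply: eq_measurable_fun h => s; rewrite inE => ss; exact: esym (first_variationE r0 sV ss).
Qed.

Lemma first_variation_integral : surface_integral (sigma sph) sph (first_variation c r V) = 0.
Proof.
transitivity (\int[sigma sph]_(s in S) (tv_multiplier r / r ^+ 2 *
    (field i0 s + field i1 s + field i2 s))).
  by apply: eq_Rintegral => s; rewrite inE => ss; exact: (first_variationE r0 sV ss).
have int k := continuous_sphere_integrable r0 sigmaP (@field_continuous k).
have c01 : continuous (fun x => field i0 x + field i1 x).
  exact: (continuous_addf (@field_continuous i0) (@field_continuous i1)).
rewrite (RintegralZl _ mS (continuous_sphere_integrable r0 sigmaP field_sum_continuous)).
rewrite (RintegralD mS (continuous_sphere_integrable r0 sigmaP c01) (int i2)).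
rewrite (RintegralD mS (int i0) (int i1)).
have Z (k x y z : R) : x = 0 -> y = 0 -> z = 0 -> k * (x + y + z) = 0.
  by move=> -> -> ->; rewrite !addr0 mulr0.
exact: (Z _ _ _ _ (field_integral i0) (field_integral i1) (field_integral i2)).
Qed.

Lemma perturb_diffeomorphism : exists2 e0 : R, 0 < e0 & forall e, 0 <= e < e0 ->
  exists2 T', [/\ cancel (perturb V e) T', cancel T' (perturb V e) &
    forall y y', `|T' y - T' y'| <= 2 * `|y - y'|] & forall x, 0 < jac_det (perturb V e) x.
Proof.
have [e1 e10 H1] := perturb_det_gt0 sV cV; have [e2 e20 H2] := perturb_inverse sV cV.
exists (Num.min e1 e2) => [|e /andP[eg]]; first by rewrite lt_min e10.
rewrite lt_min => /andP[ee1 ee2].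
have [|T' HT] := H2 e; first by rewrite eg.
by exists T' => //; apply: H1; rewrite eg.
Qed.

Definition lagrangian A0 e : R :=
  normal_TV (sigma (perturb V e @` sph)) (perturb V e @` eball c r) (perturb V e @` sph) +
  tv_multiplier r * (area (sigma (perturb V e @` sph)) (perturb V e @` sph) - A0).

Definition lagrangian_density e s := tv_pullback c r V e s + tv_multiplier r * area_jac c r (perturb V e) s.

Let lagrangianE : exists2 e0 : R, 0 < e0 & forall A0 e, 0 <= e < e0 ->
  lagrangian A0 e = surface_integral (sigma sph) sph (lagrangian_density e) - tv_multiplier r * A0.
Proof.
have [e1 e10 H1] := perturb_diffeomorphism.
have [e2 e20 H2] := uexp_bounded (tv_expansion c r0 sV cV).
have [e3 e30 H3] := uexp_bounded (area_expansion c r0 sV cV).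
exists (Num.min e1 (Num.min e2 e3)) => [|A0 e /andP[eg]]; first by rewrite !lt_min e10 e20.
rewrite !lt_min => /and3P[ee1 ee2 ee3].
have [|T' [ST TS T'_lip] det0] := H1 e; first by rewrite eg.
have it : (sigma sph).-integrable S (EFin \o (tv_pullback c r V e : borel3 R -> R)).
  apply: (bounded_integrable r0 sigmaP (tv_pullback_measurable c r sV e)).
  by apply: H2; rewrite eg ltW.
have ia : (sigma sph).-integrable S (EFin \o (area_jac c r (perturb V e) : borel3 R -> R)).
  apply: (bounded_integrable r0 sigmaP (area_jac_measurable c r sV e)).
  by apply: H3; rewrite eg ltW.
have iz : (sigma sph).-integrable S
    (EFin \o (fun s => tv_multiplier r * area_jac c r (perturb V e) s : R)).
  by have := integrableZl mS (tv_multiplier r) ia; apply: eq_integrable => // s _.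
rewrite /lagrangian (normal_TV_pullback hsigma c r0 sV det0 ST TS T'_lip).
rewrite (area_pullback hsigma c r0 sV det0 ST T'_lip) mulrBr addrA; congr (_ - _).
by rewrite /surface_integral (RintegralD mS it iz) (RintegralZl _ mS ia).
Qed.

Lemma sphere_stationary A0 :
  (fun e => e^-1 * (lagrangian A0 e - lagrangian A0 0)) @ 0^'+ --> (0 : R).
Proof.
have [e0 e00 LE] := lagrangianE.
have := surface_integral_derivative r0 sigmaP (lagrangian_expansion c r0 sV cV)
  (fun e => measurable_funD (tv_pullback_measurable c r sV e)
    (measurable_funM (measurable_cst (tv_multiplier r)) (area_jac_measurable c r sV e)))
  first_variation_measurable.
rewrite first_variation_integral; apply: cvg_trans; apply: near_eq_cvg.
near=> e.
have eg : 0 < e by near: e; exact: nbhs_right_gt.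
have ee : e < e0 by near: e; exact: nbhs_right_lt.
have E0 := LE A0 0; have Ee := LE A0 e.
rewrite lexx e00 in E0; rewrite (ltW eg) ee in Ee.
rewrite (E0 isT) (Ee isT); congr (_ * _).
by rewrite opprB addrA subrK.
Unshelve. all: by end_near. Qed.

Lemma normal_TV_curv_near : exists2 e0 : R, 0 < e0 & forall e, 0 <= e < e0 ->
  normal_TV (sigma (perturb V e @` sph)) (perturb V e @` eball c r) (perturb V e @` sph) =
  normal_TV_curv (sigma (perturb V e @` sph)) (perturb V e @` eball c r) (perturb V e @` sph).
Proof.
have [e0 e00 H] := perturb_diffeomorphism; exists e0 => // e /H[T' [ST TS T'_lip] det0].
exact: esym (normal_TV_curvE sigma c r0 sV det0 ST TS T'_lip).
Qed.

End Stationarity.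

Theorem theorem3p6 (R : realType)
    (sigma : set 'rV[R]_3 -> {measure set borel3 R -> \bar R})
    (hsigma : forall G, closed_surface G -> is_surface_measure G (sigma G))
    (c : 'rV[R]_3) (r : R) (hr : 0 < r) :
  let Om := eball c r in
  let G := frontier Om in
  let A0 := area (sigma G) G in
  exists mu : R,
  forall (D : set 'rV[R]_3) (V : 'rV[R]_3 -> 'rV[R]_3),
  open D -> closure Om `<=` D -> test_field D V ->
  let Om_ e := perturb V e @` Om in
  let G_ e := perturb V e @` G in
  let TV e := normal_TV (sigma (G_ e)) (Om_ e) (G_ e) in
  let TVk e := normal_TV_curv (sigma (G_ e)) (Om_ e) (G_ e) in
  let L e := TV e + mu * (area (sigma (G_ e)) (G_ e) - A0) in
  (exists2 e0 : R, 0 < e0 & forall e, 0 <= e < e0 -> TV e = TVk e) /\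
  (fun e => e^-1 * (L e - L 0)) @ 0^'+ --> (0 : R).
Proof.
move=> Om G; have GE : G = sphere c r by exact: frontier_eball.
(* The multiplier depends on r alone, so it is fixed before the hold-all and the field. *)
rewrite GE; exists (tv_multiplier r) => D V _ _ [sV cV _]; split.
  exact: (normal_TV_curv_near sigma c hr sV cV).
exact: (sphere_stationary hsigma c hr sV cV _).
Qed.
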